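(* Let $a>0$ and let $V:\mathbf{R}\to\mathbf{C}$ satisfy $e^{2a|x|}V(x)\in L^2(\mathbf{R})$. The Evans function $\mathbb E(\lambda)$ of the operator $-\frac{d^2}{dx^2}+V(x)$ has an analytic continuation from the plane $-2\pi<\arg\lambda<0$ to the Riemann surface $P(a)=\{\lambda\,|\,-a<\mathrm{Im}\sqrt\lambda<a\}$, whose zeros give generalized eigenvalues of $-\frac{d^2}{dx^2}+V(x)$.
   Context: Riemann surface and branch. $P(a)$ is a region of the Riemann surface of $\sqrt\lambda$ with the branch point $0$ removed. The first sheet is $-2\pi<\arg\lambda<0$ (where $\mathrm{Im}\sqrt\lambda<0$), the second sheet is the part $0<\arg\lambda<2\pi$ ($\mathrm{Im}\sqrt\lambda>0$); they are joined along $\arg\lambda=0$. The branch of $\sqrt{-\lambda}$ has $\mathrm{Re}\sqrt{-\lambda}>0$ on the first sheet and is continued analytically to $P(a)$ (i.e. $\sqrt{-\lambda}=\sqrt{-1}\,\sqrt\lambda$). Evans function. For $-2\pi<\arg\lambda<0$ let $\mu_\pm$ be solutions of $\left(\frac{d^2}{dx^2}+\lambda-V(x)\right)\mu=0$ with $$\begin{pmatrix}\mu_+(x,\lambda)\\\mu_+'(x,\lambda)\end{pmatrix}e^{\sqrt{-\lambda}x}\to\begin{pmatrix}1\\-\sqrt{-\lambda}\end{pmatrix}\ (x\to\infty),\qquad\begin{pmatrix}\mu_-(x,\lambda)\\\mu_-'(x,\lambda)\end{pmatrix}e^{-\sqrt{-\lambda}x}\to\begin{pmatrix}1\\\sqrt{-\lambda}\end{pmatrix}\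 (x\to-\infty).$$ Then $\mathbb E(\lambda)=\mu_+(x,\lambda)\mu_-'(x,\lambda)-\mu_+'(x,\lambda)\mu_-(x,\lambda)$, which is independent of $x$. Generalized eigenvalues. $X=L^2(\mathbf{R},e^{2a|x|}dx)$, $X'=L^2(\mathbf{R},e^{-2a|x|}dx)$; $A(\lambda)$ is the analytic continuation to $\lambda\in P(a)$ of the resolvent $(\lambda+d^2/dx^2)^{-1}$ as an operator from $X$ into $X'$, and $K^\times$ is multiplication by $V$. $\lambda\in P(a)$ is a generalized eigenvalue iff $\mu=A(\lambda)K^\times\mu$ has a nonzero solution $\mu\in X'$, where in dimension one this equation is $$\mu(x)=-\frac{1}{2\sqrt{-\lambda}}\int_x^\infty e^{-\sqrt{-\lambda}(y-x)}V(y)\mu(y)dy-\frac{1}{2\sqrt{-\lambda}}\int_{-\infty}^xe^{\sqrt{-\lambda}(y-x)}V(y)\mu(y)dy.$$ *)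

(* Defs.v *)
(* MathComp-Analysis, with the complex numbers R[i] of mathcomp-real-closed. *)
From HB Require Import structures.
From mathcomp Require Import all_boot all_order all_algebra.
From mathcomp Require Import complex.
From mathcomp Require Import all_classical all_reals all_analysis.

Set Implicit Arguments.
Unset Strict Implicit.
Unset Printing Implicit Defensive.

Import Order.TTheory GRing.Theory Num.Theory.
Import numFieldNormedType.Exports.

Local Open Scope classical_set_scope.
Local Open Scope ring_scope.
Local Open Scope complex_scope.

Section Complex.
Variable R : realType.
Local Notation C := R[i].
Local Notation mu_L := (@lebesgue_measure R).

Definition cexp (z : C) : C :=
  (expR (complex.Re z))%:C * (cos (complex.Im z) +i* sin (complex.Im z)).

Definition sqnormc (z : C) : R := complex.Re z ^+ 2 + complex.Im z ^+ 2.

(* Complex differentiability: [C^o] is C as a normed module over itself. *)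
Definition analytic_on (U : set C) (F : C -> C) : Prop :=
  forall k, U k -> derivable (F : C^o -> C^o) k 1.

Definition is_cderive (f : R -> C) (x : R) (l : C) : Prop :=
  is_derive x 1 (fun t => complex.Re (f t)) (complex.Re l) /\
  is_derive x 1 (fun t => complex.Im (f t)) (complex.Im l).

Definition cmeasurable (f : R -> C) : Prop :=
  measurable_fun setT (fun x => complex.Re (f x)) /\
  measurable_fun setT (fun x => complex.Im (f x)).

Definition cintegral (D : set R) (f : R -> C) : C :=
  Rintegral mu_L D (fun x => complex.Re (f x)) +i*
  Rintegral mu_L D (fun x => complex.Im (f x)).

(* f is in L^2(R, w(x) dx). *)
Definition in_L2 (w : R -> R) (f : R -> C) : Prop :=
  cmeasurable f /\
  (\int[mu_L]_x (sqnormc (f x) * w x)%:E < +oo)%E.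

Definition locally_abs_continuous (f : R -> R) : Prop :=
  forall (b c eps : R), 0 < eps ->
  exists2 delta : R, 0 < delta &
    forall (n : nat) (u v : 'I_n -> R),
      (forall i, [/\ b <= u i, u i <= v i & v i <= c]) ->
      (forall i j, i != j -> v i <= u j \/ v j <= u i) ->
      \sum_(i < n) (v i - u i) < delta ->
      \sum_(i < n) `|f (v i) - f (u i)| < eps.

Definition locally_abs_continuousC (f : R -> C) : Prop :=
  locally_abs_continuous (fun x => complex.Re (f x)) /\
  locally_abs_continuous (fun x => complex.Im (f x)).

End Complex.

Section Schrodinger.
Variable R : realType.
Local Notation C := R[i].
Local Notation mu_L := (@lebesgue_measure R).

(* The Riemann surface of sqrt(lambda), without its branch point, is
   represented through its global coordinate k = sqrt(lambda) <> 0: the point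
   with coordinate k lies over lambda = k ^+ 2, and a function on (a region of)
   the surface is a function of k. *)

Definition lambda_of (k : C) : C := k ^+ 2.

(* sqrt(-lambda) = sqrt(-1) sqrt(lambda) *)
Definition sqrt_opp_lambda (k : C) : C := 'i%C * k.

(* On the first sheet, -2 pi < arg lambda < 0, that is -pi < arg k < 0. *)
Definition first_sheet : set C := [set k | complex.Im k < 0].

Definition surfaceP (a : R) : set C :=
  [set k | k != 0 /\ - a < complex.Im k < a].

(* mu is a (Caratheodory) solution, with derivative mu', of
   mu'' + (lambda - V) mu = 0: V is only locally square integrable, so mu' is
   locally absolutely continuous and the equation holds almost everywhere. *)
Definition is_solution (V : R -> C) (lambda : C) (mu mu' : R -> C) : Prop :=
  [/\ forall x, is_cderive mu x (mu' x),
      locally_abs_continuousC mu' &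
      exists mu'' : R -> C,
        {ae mu_L, forall x, is_cderive mu' x (mu'' x) /\
                            mu'' x + (lambda - V x) * mu x = 0} ].

Definition is_mu_plus (V : R -> C) (k : C) (mu mu' : R -> C) : Prop :=
  let s := sqrt_opp_lambda k in
  [/\ is_solution V (lambda_of k) mu mu',
      (fun x : R => mu x * cexp (s * x%:C) : C^o) @ +oo --> (1 : C^o) &
      (fun x : R => mu' x * cexp (s * x%:C) : C^o) @ +oo --> (- s : C^o) ].

Definition is_mu_minus (V : R -> C) (k : C) (mu mu' : R -> C) : Prop :=
  let s := sqrt_opp_lambda k in
  [/\ is_solution V (lambda_of k) mu mu',
      (fun x : R => mu x * cexp (- s * x%:C) : C^o) @ -oo --> (1 : C^o) &
      (fun x : R => mu' x * cexp (- s * x%:C) : C^o) @ -oo --> (s : C^o) ].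

(* e is the value E(lambda) of the Evans function: mu_+ and mu_- exist, and
   their Wronskian is e, whatever x and whatever the choice of mu_+, mu_-. *)
Definition is_Evans (V : R -> C) (k e : C) : Prop :=
  [/\ exists mup mup', is_mu_plus V k mup mup',
      exists mum mum', is_mu_minus V k mum mum' &
      forall mup mup' mum mum',
        is_mu_plus V k mup mup' -> is_mu_minus V k mum mum' ->
        forall x, e = mup x * mum' x - mup' x * mum x ].

(* The analytic continuation A(lambda) of the resolvent
   (lambda + d^2/dx^2)^-1, in dimension one. *)
Definition resolventA (k : C) (f : R -> C) (x : R) : C :=
  let s := sqrt_opp_lambda k in
  - (2 * s)^-1 *
      cintegral `]x, +oo[ (fun y => cexp (- s * (y - x)%:C) * f y)
  - (2 * s)^-1 *
      cintegral `]-oo, x[ (fun y => cexp (s * (y - x)%:C) * f y).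

(* mu is a nonzero element of X' = L^2(R, e^{-2a|x|} dx), whose elements are
   functions modulo equality almost everywhere, with mu = A(lambda) (V mu). *)
Definition is_generalized_eigenvalue (a : R) (V : R -> C) (k : C) : Prop :=
  exists mu : R -> C,
    [/\ in_L2 (fun x => expR (- (2 * a * `|x|))) mu,
        ~ {ae mu_L, forall x, mu x = 0} &
        {ae mu_L, forall x, mu x = resolventA k (fun y => V y * mu y) x} ].

End Schrodinger.

Arguments first_sheet R : clear implicits.

(* Main.v *)
Require Import Defs.
From HB Require Import structures.
From mathcomp Require Import all_boot all_order all_algebra.
From mathcomp Require Import complex.
From mathcomp Require Import all_classical all_reals all_analysis.
From mathcomp Require Import measurable_realfun ring lra.

(** Put s = i k = sqrt(-lambda), so that Re s = - Im k is positive on the first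
    sheet and |Re s| < a on P(a). For mu_+ = e^{-sx} m, the equation and the
    normalization at + oo become the Volterra equation

      m(x) = 1 + int_x^oo (1 - e^{-2s(y-x)}) / (2s) V(y) m(y) dy.

    If Re s >= - b with 0 <= b < a, the kernel is O(e^{2b(y-x)}), which the decay
    of V absorbs. For a suitable weighted sup norm on the whole line
    (exists_volterra_weight) the integral operator is a contraction, so m exists
    and is unique for all s with Re s > - a and s <> 0 (jost_exists, jost_unique).
    Taking mu_- to be the reflection of the solution mu_+ for the potential V(-x),
    the Wronskian at x = 0 of these two solutions is a function, evans, defined on
    the first sheet and on P(a).

    Analyticity is proved by differentiating the equation. If n solves the Volterra
    equation differentiated formally in s, then m_{s+h} - m_s - h n solves one with
    a source of order h^2, hence is itself of order h^2 (jost_differentiable).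

    On the first sheet one may take b = 0. Then m is bounded, m tends to 1 and m'
    to 0 at + oo, and e^{-sx} m solves the equation in the sense of Caratheodory
    (jost_is_solution, jost_tame). There V is only locally square integrable, so
    derivatives exist almost everywhere; the passage back to all points, and the
    constancy of Wronskians, rest on a mean value inequality for absolutely
    continuous functions (abs_cont_ae_lipschitz). The Evans function refers to
    arbitrary solutions mu_+ and mu_-, and any of these has the same Wronskians
    as the ones constructed (tame_evans).

    If the Wronskian vanishes at a point of P(a), the Cauchy data at 0 of mu_+ and
    mu_- are proportional, and suitable multiples of mu_+ on the right and of mu_-
    on the left glue to a function mu. The Volterra equations say that mu equals
    A(lambda) (V mu) up to a multiple of e^{-sx} on the right and of e^{sx} on the
    left, and the matching of the Cauchy data says that both multiples are zero
    (evans_zero_eigenvalue). *)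

Set Implicit Arguments.
Unset Strict Implicit.
Unset Printing Implicit Defensive.

Import Order.TTheory GRing.Theory Num.Theory.
Import numFieldNormedType.Exports.

Local Open Scope classical_set_scope.
Local Open Scope ring_scope.
Local Open Scope complex_scope.

(** * Complex numbers and the complex exponential *)

Section ComplexBasics.
Variable R : realType.
Local Notation C := R[i].
Local Notation normc := (@Normc.normc R).
Implicit Types (z w : C) (f g : R -> C).

Lemma cReM z w : complex.Re (z * w) =
  complex.Re z * complex.Re w - complex.Im z * complex.Im w.
Proof. by case: z w => [a b] [c d]. Qed.

Lemma cImM z w : complex.Im (z * w) =
  complex.Re z * complex.Im w + complex.Im z * complex.Re w.
Proof. by case: z w => [a b] [c d]. Qed.

Lemma cReD z w : complex.Re (z + w) = complex.Re z + complex.Re w.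
Proof. by case: z w => [a b] [c d]. Qed.

Lemma cImD z w : complex.Im (z + w) = complex.Im z + complex.Im w.
Proof. by case: z w => [a b] [c d]. Qed.

Lemma cReN z : complex.Re (- z) = - complex.Re z.
Proof. by case: z. Qed.

Lemma cImN z : complex.Im (- z) = - complex.Im z.
Proof. by case: z. Qed.

Lemma complex_ext z w : complex.Re z = complex.Re w ->
  complex.Im z = complex.Im w -> z = w.
Proof. by case: z w => [a b] [c d] /= -> ->. Qed.

Lemma sqr_normc_sqnormc z : normc z ^+ 2 = sqnormc z.
Proof. by case: z => a b; rewrite /= sqr_sqrtr // addr_ge0 // sqr_ge0. Qed.

Lemma normc_ge0 z : 0 <= normc z.
Proof. by case: z => a b; exact: sqrtr_ge0. Qed.

Lemma normr_Re_le z : `|complex.Re z| <= normc z.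
Proof.
case: z => a b /=; rewrite -[leLHS]sqrtr_sqr ler_sqrt ?lerDl ?sqr_ge0 //.
by rewrite addr_ge0 // sqr_ge0.
Qed.

Lemma normr_Im_le z : `|complex.Im z| <= normc z.
Proof.
case: z => a b /=; rewrite -[leLHS]sqrtr_sqr ler_sqrt ?lerDr ?sqr_ge0 //.
by rewrite addr_ge0 // sqr_ge0.
Qed.

Lemma normcD_le z w : normc (z + w) <= normc z + normc w.
Proof. exact: (@le_normcD R). Qed.

Lemma normc_opp z : normc (- z) = normc z.
Proof. exact: (@complex.normcN R). Qed.

Lemma normcB_le z w : normc (z - w) <= normc z + normc w.
Proof. by rewrite -(normc_opp w); exact: normcD_le. Qed.

Lemma normc_real (x : R) : normc x%:C = `|x|.
Proof. by rewrite /= expr0n addr0 sqrtr_sqr. Qed.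

Lemma normc_gt0 z : (0 < normc z) = (z != 0).
Proof.
rewrite lt_def normc_ge0 andbT; apply/idP/idP; apply: contra => /eqP.
  by move=> ->; rewrite Normc.normc0.
by move/Normc.eq0_normc ->.
Qed.

Lemma normc_le_ReIm z : normc z <= `|complex.Re z| + `|complex.Im z|.
Proof.
rewrite {1}(complexE z); apply: (le_trans (normcD_le _ _)).
by rewrite Normc.normcM !normc_real [normc _]/= expr0n expr1n add0r sqrtr1 mul1r.
Qed.

Lemma normr_normc z : `|z| = (normc z)%:C.
Proof. by case: z. Qed.
End ComplexBasics.

Section ComplexExponential.
Variable R : realType.
Local Notation C := R[i].
Local Notation normc := (@Normc.normc R).
Implicit Types (z w : C) (f g : R -> C).

Lemma cexpD z w : cexp (z + w) = cexp z * cexp w.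
Proof.
apply: complex_ext; rewrite /cexp ?(cReM, cImM) cReD cImD /= expRD cosD sinD; ring.
Qed.

Lemma cexp0 : cexp (0 : C) = 1.
Proof. by rewrite /cexp /= expR0 cos0 sin0 mul1r. Qed.

Lemma cexpN_mul z : cexp (- z) * cexp z = 1.
Proof. by rewrite -cexpD addNr cexp0. Qed.

Lemma cexp_neq0 z : cexp z != 0.
Proof.
apply/eqP => h; have := cexpN_mul z; rewrite h mulr0 => /eqP.
by rewrite eq_sym oner_eq0.
Qed.

Lemma normc_cexp z : normc (cexp z) = expR (complex.Re z).
Proof.
rewrite /cexp Normc.normcM normc_real /= cos2Dsin2 sqrtr1 mulr1.
by rewrite ger0_norm // expR_ge0.
Qed.

Lemma is_cderive_cst (c : C) (x : R) : is_cderive (fun=> c) x 0.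
Proof. by split; exact: is_derive_cst. Qed.

Lemma is_cderive_real (x : R) : is_cderive (fun t : R => t%:C) x 1.
Proof. by split; [exact: is_derive_id | exact: is_derive_cst]. Qed.

Lemma is_cderiveD f g (x : R) l m : is_cderive f x l -> is_cderive g x m ->
  is_cderive (fun t => f t + g t) x (l + m).
Proof.
move=> [f1 f2] [g1 g2]; split; [rewrite cReD|rewrite cImD].
  by under eq_fun do rewrite cReD; exact: is_deriveD.
by under eq_fun do rewrite cImD; exact: is_deriveD.
Qed.

Lemma is_cderiveM f g (x : R) l m : is_cderive f x l -> is_cderive g x m ->
  is_cderive (fun t => f t * g t) x (l * g x + f x * m).
Proof.
move=> [f1 f2] [g1 g2]; split.
  under eq_fun do rewrite cReM.
  apply: (is_derive_eq (is_deriveB (is_deriveM f1 g1) (is_deriveM f2 g2))).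
  by rewrite /GRing.scale /= !(cReD, cReM); ring.
under eq_fun do rewrite cImM.
apply: (is_derive_eq (is_deriveD (is_deriveM f1 g2) (is_deriveM f2 g1))).
by rewrite /GRing.scale /= !(cImD, cImM); ring.
Qed.

Lemma is_cderiveZ f (c : C) (x : R) l : is_cderive f x l ->
  is_cderive (fun t => c * f t) x (c * l).
Proof.
by move=> fl; have := is_cderiveM (is_cderive_cst c x) fl; rewrite mul0r add0r.
Qed.

Lemma is_cderiveB f g (x : R) l m : is_cderive f x l -> is_cderive g x m ->
  is_cderive (fun t => f t - g t) x (l - m).
Proof.
move=> fl gm; have := is_cderiveD fl (is_cderiveZ (-1) gm).
by rewrite mulN1r; under eq_fun do rewrite mulN1r.
Qed.

Lemma is_cderive_cexp z (x : R) :
  is_cderive (fun t : R => cexp (z * t%:C)) x (z * cexp (z * x%:C)).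
Proof.
have Ez (t : R) : (complex.Re (z * t%:C) = complex.Re z * t) *
    (complex.Im (z * t%:C) = complex.Im z * t).
  by rewrite cReM cImM /= !mulr0 subr0 add0r.
have dR (c : R) : is_derive x 1 (fun t => c * t) c.
  apply: (is_derive_eq (is_deriveZ c (is_derive_id x 1))).
  by rewrite /GRing.scale /= mulr1.
have dE := is_derive1_comp (is_derive_expR _) (dR (complex.Re z)).
have dC := is_derive1_comp (is_derive_cos _) (dR (complex.Im z)).
have dS := is_derive1_comp (is_derive_sin _) (dR (complex.Im z)).
have ER : (fun t : R => complex.Re (cexp (z * t%:C))) =
    (expR \o *%R (complex.Re z)) * (cos \o *%R (complex.Im z)).
  by apply/funext => t; rewrite /cexp cReM !Ez /= mul0r subr0.
have EI : (fun t : R => complex.Im (cexp (z * t%:C))) =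
    (expR \o *%R (complex.Re z)) * (sin \o *%R (complex.Im z)).
  by apply/funext => t; rewrite /cexp cImM !Ez /= mul0r addr0.
split; rewrite ?ER ?EI.
  apply: (is_derive_eq (is_deriveM dE dC)).
  by rewrite /cexp !Ez !(cReM, cImM) /GRing.scale /=; ring.
apply: (is_derive_eq (is_deriveM dE dS)).
by rewrite /cexp !Ez !(cReM, cImM) /GRing.scale /=; ring.
Qed.

Lemma is_cderive_eq f (x : R) l m : is_cderive f x l -> l = m ->
  is_cderive f x m.
Proof. by move=> ? <-. Qed.

(** A complex function satisfies no mean value equality; the factor 2 comes from
    treating the real and imaginary parts separately. *)
Lemma is_cderive_unit_interval_le f (f' : R -> C) (M : R) :
  (forall x, is_cderive f x (f' x)) ->
  (forall x : R, 0 <= x <= 1 -> normc (f' x) <= M) ->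
  normc (f 1 - f 0) <= 2 * M.
Proof.
move=> df bf; apply: (le_trans (normc_le_ReIm _)); rewrite mulr_natl mulr2n.
have mvt (g g' : R -> R) : (forall x : R, is_derive x 1 g (g' x)) ->
    (forall x : R, 0 <= x <= 1 -> `|g' x| <= M) -> `|g 1 - g 0| <= M.
  move=> dg bg.
  have cg : {within `[0, 1], continuous g}.
    by apply: derivable_within_continuous => x _; have [] := dg x.
  have [c] := MVT_segment ler01 (fun x _ => dg x) cg.
  by rewrite in_itv /= subr0 mulr1 => c01 ->; exact: bg.
rewrite cReD cImD cReN cImN; apply: lerD.
  apply: (mvt (fun x => complex.Re (f x)) (fun x => complex.Re (f' x))) => x.
    by have [] := df x.
  by move=> /bf; apply: le_trans; exact: normr_Re_le.
apply: (mvt (fun x => complex.Im (f x)) (fun x => complex.Im (f' x))) => x.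
  by have [] := df x.
by move=> /bf; apply: le_trans; exact: normr_Im_le.
Qed.

Lemma normc_cexp_le z (t : R) : 0 <= t <= 1 ->
  normc (cexp (z * t%:C)) <= expR (normc z).
Proof.
move=> /andP[t0 t1]; rewrite normc_cexp ler_expR cReM /= mulr0 subr0.
apply: (le_trans (ler_norm _)); rewrite normrM (ger0_norm t0).
apply: (@le_trans _ _ (normc z * 1)); last by rewrite mulr1.
by apply: ler_pM => //; rewrite normr_Re_le.
Qed.

Lemma cexpB1_le z : normc (cexp z - 1) <= 2 * (normc z * expR (normc z)).
Proof.
have := @is_cderive_unit_interval_le (fun t => cexp (z * t%:C))
  (fun t => z * cexp (z * t%:C)) (normc z * expR (normc z)).
rewrite mulr1 mulr0 cexp0; apply; first by move=> x; exact: is_cderive_cexp.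
move=> x x01; rewrite Normc.normcM ler_wpM2l ?normc_ge0 //.
exact: normc_cexp_le.
Qed.

(** The mean value inequality applied twice along t |-> cexp (t z): the derivative of
    cexp (t z) - t z is z (cexp (t z) - 1), bounded by the previous lemma. *)
Lemma cexpB1B_le z :
  normc (cexp z - 1 - z) <= 4 * (normc z ^+ 2 * expR (normc z)).
Proof.
have := @is_cderive_unit_interval_le (fun t => cexp (z * t%:C) - z * t%:C)
  (fun t => z * (cexp (z * t%:C) - 1)) (2 * (normc z ^+ 2 * expR (normc z))).
rewrite !mulr1 !mulr0 cexp0 subr0.
rewrite (_ : 4 = 2 * 2 :> R); last by rewrite -natrM.
rewrite -[2 * 2 * _]mulrA.
rewrite (_ : cexp z - z - 1 = cexp z - 1 - z); last by ring.
apply => [x|x x01].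
  apply: is_cderive_eq.
    apply: is_cderiveB; first exact: is_cderive_cexp.
    apply: is_cderiveZ; exact: is_cderive_real.
  by rewrite mulr1 mulrBr mulr1.
rewrite Normc.normcM expr2 -mulrA mulrCA ler_wpM2l ?normc_ge0 //.
apply: (le_trans (cexpB1_le _)); rewrite ler_wpM2l //.
move: x01 => /andP[x0 x1].
have h : normc (z * x%:C) <= normc z.
  by rewrite Normc.normcM normc_real ger0_norm // ler_piMr // normc_ge0.
by apply: ler_pM; rewrite ?expR_ge0 ?normc_ge0 ?ler_expR.
Qed.

End ComplexExponential.

(** * Integration of complex-valued functions *)

Section ComplexMeasurability.
Context {R : realType} {d : measure_display} {T : measurableType d}.
Local Notation C := R[i].
Local Notation normc := (@Normc.normc R).
Implicit Types f g : T -> C.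

Definition complex_measurable f : Prop :=
  measurable_fun setT (fun x => complex.Re (f x)) /\
  measurable_fun setT (fun x => complex.Im (f x)).

Lemma complex_measurable_cst (c : C) : complex_measurable (fun=> c).
Proof. by split; exact: measurable_cst. Qed.

Lemma complex_measurable_real (h : T -> R) :
  measurable_fun setT h -> complex_measurable (fun x => (h x)%:C).
Proof. by split => //; exact: measurable_cst. Qed.

Lemma complex_measurableD f g : complex_measurable f -> complex_measurable g ->
  complex_measurable (fun x => f x + g x).
Proof.
move=> [f1 f2] [g1 g2]; split; [under eq_fun do rewrite cReD|
  under eq_fun do rewrite cImD]; exact: measurable_funD.
Qed.

Lemma complex_measurableM f g : complex_measurable f -> complex_measurable g ->
  complex_measurable (fun x => f x * g x).
Proof.
move=> [f1 f2] [g1 g2]; split.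
  under eq_fun do rewrite cReM.
  by apply: measurable_funB; exact: measurable_funM.
under eq_fun do rewrite cImM.
by apply: measurable_funD; exact: measurable_funM.
Qed.

Lemma complex_measurableB f g : complex_measurable f -> complex_measurable g ->
  complex_measurable (fun x => f x - g x).
Proof.
move=> mf mg; under eq_fun do rewrite -mulN1r.
by apply: complex_measurableD => //; apply: complex_measurableM => //.
Qed.

Lemma complex_measurable_cexp f :
  complex_measurable f -> complex_measurable (fun x => cexp (f x)).
Proof.
move=> [f1 f2]; apply: complex_measurableM.
  apply: complex_measurable_real; exact: measurableT_comp.
split => /=.
  have /continuous_measurable_fun mc := @continuous_cos R.
  exact: (measurableT_comp mc).
have /continuous_measurable_fun ms := @continuous_sin R.
exact: (measurableT_comp ms).
Qed.

Lemma complex_measurable_if (b : T -> bool) f g : measurable_fun setT b ->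
  complex_measurable f -> complex_measurable g ->
  complex_measurable (fun x => if b x then f x else g x).
Proof.
move=> mb [f1 f2] [g1 g2]; split.
  rewrite (_ : (fun x => _) = fun x =>
    if b x then complex.Re (f x) else complex.Re (g x)).
    by apply: measurable_fun_ifT.
  by apply/funext => x; case: (b x).
rewrite (_ : (fun x => _) = fun x =>
  if b x then complex.Im (f x) else complex.Im (g x)).
  by apply: measurable_fun_ifT.
by apply/funext => x; case: (b x).
Qed.

Lemma measurable_sqnormc f :
  complex_measurable f -> measurable_fun setT (fun x => sqnormc (f x)).
Proof.
by move=> [f1 f2]; apply: measurable_funD; apply: measurable_funX.
Qed.

Lemma measurable_normc f :
  complex_measurable f -> measurable_fun setT (fun x => normc (f x)).
Proof.
move=> mf; rewrite (_ : (fun _ => _) = Num.sqrt \o (fun x => sqnormc (f x))).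
  apply: measurableT_comp; last exact: measurable_sqnormc.
  by apply: continuous_measurable_fun; exact: sqrt_continuous.
by apply/funext => x /=; rewrite -sqr_normc_sqnormc sqrtr_sqr ger0_norm // normc_ge0.
Qed.

End ComplexMeasurability.

Section ComplexIntegral.
Variable R : realType.
Local Notation C := R[i].
Local Notation mu := (@lebesgue_measure R).
Local Notation normc := (@Normc.normc R).
Implicit Types (f g : R -> C) (D : set (measurableTypeR R)).

Definition cintegrable D f : Prop :=
  mu.-integrable D (EFin \o (fun x => complex.Re (f x))) /\
  mu.-integrable D (EFin \o (fun x => complex.Im (f x))).

Lemma integrable_scale D (h : R -> R) (r : R) : measurable D ->
  mu.-integrable D (EFin \o h) ->
  mu.-integrable D (EFin \o (fun x => r * h x)).
Proof. by move=> mD ih; exact: (integrableZl mD r ih). Qed.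

Lemma cintegrable_dominated D f (h : R -> R) : measurable D ->
  complex_measurable f -> mu.-integrable D (EFin \o h) ->
  (forall x, D x -> normc (f x) <= h x) -> cintegrable D f.
Proof.
move=> mD [f1 f2] ih fh; split; apply: (le_integrable mD _ _ ih) => //.
- by apply/measurable_EFinP; exact: measurable_funTS.
- move=> x Dx /=; rewrite lee_fin; apply: (le_trans (normr_Re_le _)).
  by rewrite (le_trans (fh _ Dx)) // ler_norm.
- by apply/measurable_EFinP; exact: measurable_funTS.
- move=> x Dx /=; rewrite lee_fin; apply: (le_trans (normr_Im_le _)).
  by rewrite (le_trans (fh _ Dx)) // ler_norm.
Qed.

Lemma cintegrableS D D' f : measurable D -> measurable D' -> D' `<=` D ->
  cintegrable D f -> cintegrable D' f.
Proof. by move=> mD mD' DD' [f1 f2]; split; exact: (integrableS mD). Qed.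

Lemma cintegrableZ D f (c : C) : measurable D -> cintegrable D f ->
  cintegrable D (fun x => c * f x).
Proof.
move=> mD [f1 f2]; split.
  rewrite (_ : _ \o _ =
    (fun x => (complex.Re c)%:E * (EFin \o (fun x => complex.Re (f x))) x) \-
    (fun x => (complex.Im c)%:E * (EFin \o (fun x => complex.Im (f x))) x))%E.
    by apply: integrableB => //; exact: integrableZl.
  by apply/funext => x /=; rewrite cReM.
rewrite (_ : _ \o _ =
  (fun x => (complex.Re c)%:E * (EFin \o (fun x => complex.Im (f x))) x) \+
  (fun x => (complex.Im c)%:E * (EFin \o (fun x => complex.Re (f x))) x))%E.
  by apply: integrableD => //; exact: integrableZl.
by apply/funext => x /=; rewrite cImM.
Qed.

Lemma cintegralD D f g : measurable D -> cintegrable D f -> cintegrable D g ->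
  cintegral D (fun x => f x + g x) = cintegral D f + cintegral D g.
Proof.
move=> mD [f1 f2] [g1 g2]; rewrite /cintegral.
under eq_Rintegral do rewrite cReD.
under [X in _ +i* X]eq_Rintegral do rewrite cImD.
by rewrite !RintegralD.
Qed.

Lemma cintegralZ D f (c : C) : measurable D -> cintegrable D f ->
  cintegral D (fun x => c * f x) = c * cintegral D f.
Proof.
move=> mD [f1 f2]; apply: complex_ext; rewrite ?(cReM, cImM) /cintegral /=.
  under eq_Rintegral do rewrite cReM.
  by rewrite RintegralB ?RintegralZl //=; exact: integrable_scale.
under eq_Rintegral do rewrite cImM.
by rewrite RintegralD ?RintegralZl //=; exact: integrable_scale.
Qed.

Lemma eq_cintegral D f g : (forall x, D x -> f x = g x) ->
  cintegral D f = cintegral D g.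
Proof.
by move=> fg; congr (_ +i* _); apply: eq_Rintegral => x /set_mem /fg ->.
Qed.

(** Rotation argument: with w the conjugate of z = int f, |z|^2 is the real part
    of int (w f), which is at most |z| int h. *)
Lemma cintegral_le D f (h : R -> R) : measurable D -> complex_measurable f ->
  mu.-integrable D (EFin \o h) -> (forall x, D x -> normc (f x) <= h x) ->
  normc (cintegral D f) <= Rintegral mu D h.
Proof.
move=> mD mf ih fh.
have if_ := cintegrable_dominated mD mf ih fh.
set z := cintegral D f; have [->|z0] := eqVneq z 0.
  rewrite Normc.normc0; apply: Rintegral_ge0 => x Dx.
  by rewrite (le_trans (normc_ge0 _) (fh _ Dx)).
have nz : 0 < normc z by rewrite normc_gt0.
pose w := complex.Re z -i* complex.Im z.
have nw : normc w = normc z by rewrite /w /z /= sqrrN.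
rewrite -(ler_pM2l nz).
have -> : normc z * normc z = complex.Re (cintegral D (fun x => w * f x)).
  rewrite cintegralZ // -/z -expr2 sqr_normc_sqnormc /w /sqnormc cReM /=.
  by rewrite -!expr2 mulNr opprK.
rewrite -RintegralZl //=; apply: le_Rintegral => //.
- by have [] := cintegrableZ w mD if_.
- exact: integrable_scale.
- move=> x Dx; apply: (le_trans (ler_norm _)).
  apply: (le_trans (normr_Re_le _)).
  by rewrite Normc.normcM nw ler_wpM2l // ?normc_ge0 // fh.
Qed.

Lemma cintegral_split f (x : R) : cintegrable setT f ->
  cintegral `]x, +oo[ f + cintegral `]-oo, x[ f = cintegral setT f.
Proof.
have E : setT = `]-oo, x[ `|` `[x, +oo[%classic.
  by rewrite -setCitvr setvU.
have spl (h : R -> R) : mu.-integrable setT (EFin \o h) ->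
    Rintegral mu `]x, +oo[ h + Rintegral mu `]-oo, x[ h = Rintegral mu setT h.
  move=> ih; rewrite [in RHS]E Rintegral_setU -?E //; last first.
    by rewrite -setCitvr; apply/disj_setPS; rewrite setICl.
  rewrite addrC Rintegral_itv_obnd_cbnd //.
  exact: (integrableS measurableT).
by move=> [f1 f2]; apply: complex_ext; rewrite ?(cReD, cImD) /=; exact: spl.
Qed.

End ComplexIntegral.

(** * Absolutely continuous functions *)

Section RealDerivatives.
Variable R : realType.
Local Notation mu := (@lebesgue_measure R).
Implicit Types (f : R -> R) (x l : R).

Lemma is_derive_epsP f x l : is_derive x 1 f l <->
  forall e, 0 < e -> exists2 eta, 0 < eta &
    forall y, `|y - x| < eta -> `|f y - f x - l * (y - x)| <= e * `|y - x|.
Proof.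
pose g h := h^-1 *: ((f \o shift x) (h *: 1) - f x).
have gE y : y != x -> g (y - x) = (f y - f x) / (y - x).
  by move=> _; rewrite /g /= /GRing.scale /= mulr1 subrK mulrC.
split=> [[dfx dfl] e e0|H].
  have gl : g @ 0^' --> l by rewrite -dfl; exact: dfx.
  move/cvgrPdist_le : gl => /(_ _ e0) [/= eta eta0 H].
  exists eta => // y yx; have [->|nyx] := eqVneq y x.
    by rewrite !subrr mulr0 subr0 normr0 mulr0.
  have yx0 : y - x != 0 by rewrite subr_eq0.
  have := H (y - x); rewrite /ball_ /= sub0r normrN => /(_ yx yx0).
  rewrite -/(g _) gE // distrC => h.
  rewrite (_ : f y - f x - l * (y - x) =
    ((f y - f x) / (y - x) - l) * (y - x)); last by field.
  by rewrite normrM ler_wpM2r.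
have gl : g @ 0^' --> l.
  apply/cvgrPdist_le => e e0; have [eta eta0 {}H] := H _ e0.
  exists eta => //= h; rewrite /ball_ /= sub0r normrN => heta h0.
  have := H (h + x); rewrite addrK => /(_ heta).
  rewrite -/(g h) /g /= /GRing.scale /= mulr1 => hh; rewrite distrC.
  rewrite (_ : h^-1 * (f (h + x) - f x) - l =
    h^-1 * (f (h + x) - f x - l * h)); last by field.
  by rewrite normrM normfV mulrC ler_pdivrMr // normr_gt0.
split; first by apply/cvg_ex; exists l.
by apply/cvg_lim.
Qed.

Lemma is_derive_local_lipschitz f x l (M e : R) : is_derive x 1 f l ->
  `|l| <= M -> 0 < e -> exists2 eta, 0 < eta &
  forall y, `|y - x| < eta -> `|f y - f x| <= (M + e) * `|y - x|.
Proof.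
move=> /is_derive_epsP df lM /df [eta eta0 H]; exists eta => // y /H h.
rewrite (_ : f y - f x = (f y - f x - l * (y - x)) + l * (y - x)); last by ring.
rewrite (le_trans (ler_normD _ _)) // normrM addrC mulrDl lerD //.
by rewrite ler_wpM2r.
Qed.

Lemma negligible_open_cover (Z : set R) (e : R) : mu.-negligible Z -> 0 < e ->
  exists O : set R, [/\ open O, Z `<=` O & (mu O < e%:E)%E].
Proof.
move=> [A [mA A0 ZA]] e0.
have [|O [oO AO OA]] := @lebesgue_regularity_outer R A e mA _ e0.
  by move: A0 => /= ->.
exists O; split => //; first exact: subset_trans ZA AO.
have mO : measurable (O : set (measurableTypeR R)) by exact: open_measurable.
rewrite (_ : O = A `|` (O `\` A)); last by rewrite setDUK.
apply: (le_lt_trans (measureU2 _ _ _)) => //; first exact: measurableD.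
by move: A0 OA => /= -> OA; rewrite add0e.
Qed.

End RealDerivatives.

Section AbsolutelyContinuousMeanValue.
Variable R : realType.
Local Notation mu := (@lebesgue_measure R).
Implicit Types (f : R -> R) (s : seq (R * R)).

(** Absolute continuity for families listed from left to right, the form in which
    abs_cont_ae_lipschitz builds its intervals one after the other. *)
Lemma loc_abs_cont_seq f (b c e : R) : locally_abs_continuous f -> 0 < e ->
  exists2 delta, 0 < delta & forall s,
    pairwise (fun p q : R * R => p.2 <= q.1) s ->
    (forall p, p \in s -> [/\ b <= p.1, p.1 <= p.2 & p.2 <= c]) ->
    \sum_(p <- s) (p.2 - p.1) < delta ->
    \sum_(p <- s) `|f p.2 - f p.1| < e.
Proof.
move=> acf e0; have [delta delta0 H] := acf b c e e0.
exists delta => // s sp sb; rewrite !(big_nth (0, 0)) !big_mkord => sd.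
apply: (H (size s) (fun i => (nth (0, 0) s i).1) (fun i => (nth (0, 0) s i).2)).
- by move=> i; apply: sb; exact: mem_nth.
- move=> i j ij; have /(pairwiseP (0, 0)) sp' := sp.
  have [lij|lji|/val_inj eij] := ltngtP i j; last by rewrite eij eqxx in ij.
    by left; exact: (sp' i j (ltn_ord i) (ltn_ord j) lij).
  by right; exact: (sp' j i (ltn_ord j) (ltn_ord i) lji).
- exact: sd.
Qed.

(** Mean value inequality for absolutely continuous functions. The points where
    the derivative bound fails lie in an open set U of small measure. Every x has
    a radius below which an interval around x either satisfies the Lipschitz
    bound or is contained in U. As in Cousin's lemma, a supremum argument covers
    [b, c] by such intervals; those inside U have small total length, so
    absolute continuity makes their contribution small. *)
Lemma abs_cont_ae_lipschitz f (M b c : R) : locally_abs_continuous f ->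
  b <= c -> 0 <= M ->
  {ae mu, forall x, b <= x <= c -> exists2 l, is_derive x 1 f l & `|l| <= M} ->
  `|f c - f b| <= M * (c - b).
Proof.
move=> acf bc M0 aeM.
suff H e : 0 < e -> `|f c - f b| <= (M + e) * (c - b) + e.
  apply/ler_addgt0Pr => e e0.
  have cb1 : 0 < c - b + 1 by rewrite ltr_wpDl // subr_ge0.
  have := H (e / (c - b + 1)); rewrite divr_gt0 // => /(_ isT) /le_trans; apply.
  rewrite mulrDl -addrA lerD2l -{2}[e / _]mulr1 -mulrDr.
  by rewrite divfK // gt_eqF.
move=> e0; have [delta delta0 smallsum] := loc_abs_cont_seq b c acf e0.
have [U [oO ZO Odelta]] := negligible_open_cover aeM delta0.
have mO : measurable (U : set (measurableTypeR R)) by exact: open_measurable.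
pose good u v := `|f v - f u| <= (M + e) * (v - u) \/
  (forall y, u <= y <= v -> U y).
have gauge x : b <= x <= c -> exists2 eta, 0 < eta &
    forall u v, u <= x <= v -> x - eta < u -> v < x + eta -> good u v.
  move=> bxc; have [Ox|nOx] := pselect (U x).
    move: (oO) => /(_ _ Ox) [eta /= eta0 xO]; exists eta => // u v.
    move=> /andP[ux xv] u1 v1; right => y /andP[uy yv]; apply: xO.
    by rewrite /ball_ /= ltr_norml; apply/andP; split; lra.
  have [l dl lM] : exists2 l, is_derive x 1 f l & `|l| <= M.
    by apply: contrapT => nd; apply: nOx; apply: ZO => /= /(_ bxc).
  have [eta eta0 {}H] := is_derive_local_lipschitz dl lM e0.
  exists eta => // u v /andP[ux xv] u1 v1; left.
  have hu : `|u - x| < eta by rewrite ltr_norml; apply/andP; split; lra.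
  have hv : `|v - x| < eta by rewrite ltr_norml; apply/andP; split; lra.
  have := H _ hu; have := H _ hv; rewrite (ger0_norm (_ : 0 <= v - x)); last lra.
  rewrite (ler0_norm (_ : u - x <= 0)); last lra.
  move=> h1 h2; rewrite (_ : f v - f u = (f v - f x) - (f u - f x)); last by ring.
  rewrite (le_trans (ler_normB _ _)) // (le_trans (lerD h1 h2)) //.
  by rewrite -mulrDr (_ : v - x + - (u - x) = v - u) //; ring.
pose covered t := exists s, [/\ pairwise (fun p q : R * R => p.2 <= q.1) s,
  forall p, p \in s -> [/\ b <= p.1, p.1 <= p.2 & p.2 <= t],
  `|f t - f b| <= (M + e) * (t - b) + \sum_(p <- s) `|f p.2 - f p.1| &
  ((\sum_(p <- s) (p.2 - p.1))%:E <= mu (U `&` `]b, t]))%E].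
have step u v : b <= u -> u <= v -> good u v -> covered u -> covered v.
  move=> bu uv guv [s [sp sb fs ms]].
  have fuv : `|f v - f b| <= `|f v - f u| + `|f u - f b|.
    by rewrite -(subrKA (f u)) ler_normD.
  case: guv => [guv|guv].
    exists s; split => //.
    - by move=> p /sb [? ? ?]; split => //; lra.
    - rewrite (le_trans fuv) // (le_trans (lerD guv fs)) // addrA lerD2r.
      by rewrite -mulrDr (_ : v - u + (u - b) = v - b) //; ring.
    - apply: (le_trans ms); apply: le_measure; rewrite ?inE; [exact: measurableI..|].
      by apply: setIS; apply: subset_itvl; rewrite bnd_simp.
  exists (rcons s (u, v)); split => //.
  - rewrite pairwise_rcons sp andbT; apply/allP => p /sb [_ _] /=; exact.
  - move=> p; rewrite mem_rcons inE => /orP[/eqP ->|/sb [? ? ?]] /=.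
      by split.
    by split => //; lra.
  - rewrite big_rcons /=; apply: (le_trans fuv).
    have : (M + e) * (u - b) <= (M + e) * (v - b).
      by rewrite ler_wpM2l ?lerD2r // addr_ge0 // ltW.
    by move: fs; set S := \sum_(p <- s) _ => *; lra.
  - rewrite big_rcons /=.
    have -> : U `&` `]b, v] = (U `&` `]b, u]) `|` `]u, v].
      rewrite predeqE => y /=; rewrite !in_itv /=; split.
        move=> [Oy /andP[by_ yv]]; have [yu|uy] := leP y u.
          by left; split => //; rewrite by_.
        by right.
      move=> [[Oy /andP[by_ yu]]|/andP[uy yv]].
        by split => //; rewrite by_ /=; lra.
      split; last by rewrite yv andbT; lra.
      by apply: guv; rewrite yv andbT ltW.
    rewrite measureU //=; [|exact: measurableI|].
      rewrite EFinD; apply: leeD => //.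
      have := lebesgue_measure_itv `]u, v]; rewrite /= lte_fin => ->.
      by case: ltP => // vu; rewrite lee_fin; lra.
    rewrite predeqE => y /=; rewrite !in_itv /=; split => //.
    by move=> [[_ /andP[_ yu]] /andP[uy _]]; lra.
pose S := [set t | b <= t <= c /\ covered t].
have Sb : S b.
  split; first by rewrite lexx.
  by exists [::]; split => //; rewrite ?big_nil ?(subrr (f b)) ?(subrr b) ?normr0 ?mulr0 ?addr0.
have hS : has_sup S.
  by split; [exists b|exists c => t [/andP[_ tc] _]].
set w := sup S.
have bw : b <= w by apply: sup_upper_bound.
have wc : w <= c.
  by apply: ge_sup; [exists b|move=> t [/andP[_ tc] _]].
have [eta eta0 ge] : exists2 eta, 0 < eta & forall u v,
    u <= w <= v -> w - eta < u -> v < w + eta -> good u v.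
  by apply: gauge; rewrite bw.
have [t [/andP[bt tc] ct] wt] := sup_adherent eta0 hS.
have tw : t <= w by apply: sup_upper_bound => //; split; rewrite ?bt.
pose v := Num.min c (w + eta / 2).
have vw : w <= v by rewrite /v le_min wc /=; lra.
have cv : covered v.
  apply: (step t) => //; first lra.
  apply: ge => //; first by rewrite tw.
  by rewrite /v gt_min; apply/orP; right; lra.
have vc : v <= c by rewrite /v ge_min lexx.
have wv : v <= w by apply: sup_upper_bound => //; split => //; rewrite vc andbT; lra.
have Evc : v = c.
  by move: wv; rewrite /v minEle; case: ifP => // _ wv; exfalso; lra.
move: cv; rewrite Evc => -[s [sp sb fs ms]].
have sd : \sum_(p <- s) (p.2 - p.1) < delta.
  rewrite -lte_fin; apply: (le_lt_trans ms); apply: le_lt_trans Odelta.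
  by apply: le_measure; rewrite ?inE //; exact: measurableI.
by rewrite (le_trans fs) // lerD2l ltW // smallsum.
Qed.

End AbsolutelyContinuousMeanValue.

Section AbsolutelyContinuousClosure.
Variable R : realType.
Local Notation mu := (@lebesgue_measure R).
Implicit Types (f g h : R -> R).

Lemma ae_mono (P Q : R -> Prop) : (forall x, P x -> Q x) ->
  {ae mu, forall x, P x} -> {ae mu, forall x, Q x}.
Proof.
move=> PQ; exact: (@filterS _ _ (ae_filter_ringOfSetsType mu) P Q PQ).
Qed.

Lemma ae_and (P Q : R -> Prop) : {ae mu, forall x, P x} ->
  {ae mu, forall x, Q x} -> {ae mu, forall x, P x /\ Q x}.
Proof. exact: (@filterI _ _ (ae_filter_ringOfSetsType mu) P Q). Qed.

(** The common source of the closure properties: increments of h are controlled by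
    those of f and g on each compact interval. *)
Lemma loc_abs_cont_dominated f g h :
  locally_abs_continuous f -> locally_abs_continuous g ->
  (forall b c, exists K, forall u v, b <= u <= c -> b <= v <= c ->
    `|h v - h u| <= K * (`|f v - f u| + `|g v - g u|)) ->
  locally_abs_continuous h.
Proof.
move=> acf acg H b c e e0; have [K HK] := H b c.
pose K1 := `|K| + 1; have K10 : 0 < K1 by rewrite ltr_wpDl.
have e2 : 0 < e / (2 * K1) by rewrite divr_gt0 // mulr_gt0.
have [d1 d10 H1] := acf b c _ e2; have [d2 d20 H2] := acg b c _ e2.
exists (Num.min d1 d2); first by rewrite lt_min d10.
move=> n u v uv dis; rewrite lt_min => /andP[s1 s2].
have {}H1 := H1 n u v uv dis s1; have {}H2 := H2 n u v uv dis s2.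
apply: (@le_lt_trans _ _ (K1 * (\sum_(i < n) `|f (v i) - f (u i)| +
    \sum_(i < n) `|g (v i) - g (u i)|))).
  rewrite -big_split /= mulr_sumr; apply: ler_sum => i _.
  have [bu uvi vc] := uv i; apply: (le_trans (HK _ _ _ _)).
  - by rewrite bu (le_trans uvi).
  - by rewrite vc (le_trans bu).
  - by rewrite ler_wpM2r ?addr_ge0 // /K1 (le_trans (ler_norm K)) // lerDl.
have -> : e = K1 * (e / (2 * K1) + e / (2 * K1)) by field; rewrite gt_eqF.
by rewrite ltr_pM2l // ltrD.
Qed.

Lemma loc_abs_cont_id : locally_abs_continuous (fun x : R => x).
Proof.
move=> b c e e0; exists e => // n u v uv _; apply: le_lt_trans.
apply: ler_sum => i _; have [_ uvi _] := uv i.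
by rewrite ger0_norm // subr_ge0.
Qed.

Lemma loc_abs_cont_lipschitz f :
  (forall b c, exists K, forall u v, b <= u <= c -> b <= v <= c ->
    `|f v - f u| <= K * `|v - u|) -> locally_abs_continuous f.
Proof.
move=> H; apply: (loc_abs_cont_dominated loc_abs_cont_id loc_abs_cont_id).
move=> b c; have [K HK] := H b c; exists `|K| => u v hu hv.
apply: (le_trans (HK u v hu hv)); rewrite mulrDr.
apply: (@le_trans _ _ (`|K| * `|v - u|)).
  by rewrite ler_wpM2r // ler_norm.
by rewrite lerDl mulr_ge0.
Qed.

Lemma loc_abs_cont_continuous f : locally_abs_continuous f -> continuous f.
Proof.
move=> acf x; apply/cvgrPdist_lt => e e0.
have [d d0 H] := acf (x - 1) (x + 1) e e0.
pose d' := Num.min d 1; have d'0 : 0 < d' by rewrite lt_min d0 /=.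
exists d' => //= y; rewrite /ball_ /= lt_min => /andP[yd y1].
have E p q : x - 1 <= p -> p <= q -> q <= x + 1 -> q - p < d ->
    `|f q - f p| < e.
  move=> xp pq qx qpd.
  have := H 1%N (fun=> p) (fun=> q); rewrite !big_ord_recl !big_ord0 !addr0.
  by apply => // i j; rewrite !ord1 eqxx.
have /andP[? ?] : - d < x - y < d by rewrite -ltr_norml.
have /andP[? ?] : - 1 < x - y < 1 by rewrite -ltr_norml.
have [xy|yx] := leP x y; first by rewrite distrC; apply: E; lra.
by apply: E; lra.
Qed.

Lemma continuous_locally_bounded f (b c : R) : continuous f ->
  exists2 B, 0 <= B & forall x, b <= x <= c -> `|f x| <= B.
Proof.
move=> cf; have [bc|cb] := leP b c; last first.
  by exists 0 => // x /andP[? ?]; exfalso; lra.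
have cn : {within `[b, c], continuous (fun x => `|f x|)}.
  apply: continuous_subspaceT => x; apply: cvg_norm; exact: cf.
have [m _ Hm] := EVT_max bc cn.
by exists `|f m| => // x bxc; apply: Hm; rewrite in_itv.
Qed.

Lemma loc_abs_contD f g : locally_abs_continuous f ->
  locally_abs_continuous g -> locally_abs_continuous (fun x => f x + g x).
Proof.
move=> acf acg; apply: (loc_abs_cont_dominated acf acg) => b c.
exists 1 => u v _ _; rewrite mul1r opprD addrACA; exact: ler_normD.
Qed.

Lemma loc_abs_contM f g : locally_abs_continuous f ->
  locally_abs_continuous g -> locally_abs_continuous (fun x => f x * g x).
Proof.
move=> acf acg; apply: (loc_abs_cont_dominated acf acg) => b c.
have [B B0 HB] := continuous_locally_bounded b c (loc_abs_cont_continuous acf).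
have [D D0 HD] := continuous_locally_bounded b c (loc_abs_cont_continuous acg).
exists (B + D) => u v hu hv.
rewrite (_ : f v * g v - f u * g u =
  f v * (g v - g u) + (f v - f u) * g u); last by ring.
rewrite (le_trans (ler_normD _ _)) // !normrM.
have h1 : `|f v| * `|g v - g u| <= (B + D) * `|g v - g u|.
  by rewrite ler_wpM2r // (le_trans (HB _ hv)) // lerDl.
have h2 : `|f v - f u| * `|g u| <= (B + D) * `|f v - f u|.
  by rewrite mulrC ler_wpM2r // (le_trans (HD _ hu)) // lerDr.
by rewrite mulrDr addrC lerD.
Qed.

Lemma loc_abs_cont_C1 f g : (forall x : R, is_derive x 1 f (g x)) ->
  continuous g -> locally_abs_continuous f.
Proof.
move=> df cg; apply: loc_abs_cont_lipschitz => b c.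
have [B B0 HB] := continuous_locally_bounded b c cg; exists B.
have H u v : b <= u -> u <= v -> v <= c -> `|f v - f u| <= B * `|v - u|.
  move=> bu uv vc.
  have cf : {within `[u, v], continuous f}.
    by apply: derivable_within_continuous => x _; have [] := df x.
  have [w] := MVT_segment uv (fun x _ => df x) cf.
  rewrite in_itv /= => /andP[uw wv] ->.
  by rewrite normrM ler_wpM2r // HB //; apply/andP; split; lra.
move=> u v /andP[bu uc] /andP[bv vc]; have [uv|vu] := leP u v; first exact: H.
by rewrite distrC [`|v - u|]distrC; apply: H => //; exact: ltW.
Qed.

(** Applied to f - p x * id near x, the mean value inequality bounds the difference
    quotient by the oscillation of p. *)
Lemma loc_abs_cont_ae_derive f (p : R -> R) : locally_abs_continuous f ->
  continuous p -> {ae mu, forall x : R, is_derive x 1 f (p x)} ->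
  forall x : R, is_derive x 1 f (p x).
Proof.
move=> acf cp aed x; apply/is_derive_epsP => e e0.
have /cvgrPdist_le /(_ _ e0) [/= eta eta0 H] := cp x.
exists eta => // y yx.
pose g z := f z - p x * z.
have acg : locally_abs_continuous g.
  apply: (loc_abs_contD acf); apply: loc_abs_cont_lipschitz => b c.
  exists `|p x| => u v _ _; rewrite -normrM le_eqVlt; apply/orP; left.
  by rewrite -normrN; apply/eqP; congr `| _ |; ring.
have K (b c : R) : b <= c -> (forall z, b <= z <= c -> `|z - x| < eta) ->
    `|g c - g b| <= e * (c - b).
  move=> bc hz; apply: abs_cont_ae_lipschitz => //; first exact: ltW.
  apply: ae_mono aed => z dz bzc; exists (p z - p x).
    have h2 : is_derive z 1 (fun t => p x * t) (p x).
      apply: (is_derive_eq (is_deriveZ (p x) (is_derive_id z 1))).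
      by rewrite /GRing.scale /= mulr1.
    exact: is_deriveB.
  by rewrite distrC; apply: H; rewrite /ball_ /= distrC; exact: hz.
rewrite (_ : f y - f x - p x * (y - x) = g y - g x); last by rewrite /g; ring.
move: yx; rewrite ltr_norml => /andP[? ?]; have [xy|yx] := leP x y.
  rewrite (ger0_norm (_ : 0 <= y - x)) ?subr_ge0 //; apply: K => // z /andP[? ?].
  by rewrite ltr_norml; apply/andP; split; lra.
rewrite distrC (ltr0_norm (_ : y - x < 0)) ?subr_lt0 // [- (y - x)]opprB.
apply: K; first exact: ltW.
move=> z /andP[? ?]; rewrite ltr_norml; apply/andP; split; lra.
Qed.

Lemma loc_abs_cont_ae_derive0 f : locally_abs_continuous f ->
  {ae mu, forall x : R, is_derive x 1 f 0} -> forall x y, f x = f y.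
Proof.
move=> acf aed.
have K (b c : R) : b <= c -> f b = f c.
  move=> bc; apply/eqP; rewrite eq_sym -subr_eq0 -normr_le0.
  rewrite -(mul0r (c - b)); apply: abs_cont_ae_lipschitz => //.
  by apply: ae_mono aed => z dz _; exists 0; rewrite ?normr0.
by move=> x y; have [/K|/ltW /K ->] := leP x y.
Qed.

Lemma loc_abs_cont_integral f : mu.-integrable setT (EFin \o f) ->
  locally_abs_continuous (fun x => \int[mu]_(y in `]-oo, x]) f y).
Proof.
move=> intf b c e e0.
have [d [d0 H]] := integral_normr_continuous intf e0.
exists d => // n u v uv dis sd.
pose I (i : 'I_n) : set (measurableTypeR R) := `]u i, v i]%classic.
have mI i : measurable (I i) by exact: measurable_itv.
have dI : trivIset [set: 'I_n] I.
  apply/trivIsetP => i j _ _ ij; rewrite -subset0 => y; rewrite /I /=.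
  rewrite !in_itv /= => -[/andP[? ?] /andP[? ?]].
  by have [?|?] := dis _ _ ij; lra.
have mA : measurable (\big[setU/set0]_(i < n) I i).
  exact: bigsetU_measurable.
have intA D : measurable D -> mu.-integrable D (EFin \o f).
  by move=> mD; exact: (integrableS measurableT).
apply: le_lt_trans (H _ mA _).
  have -> : Rintegral mu (\big[setU/set0]_(i < n) I i) (fun x => `|f x|) =
      \sum_(i < n) Rintegral mu (I i) (fun x => `|f x|).
    have absint D : measurable D -> mu.-integrable D (EFin \o (fun x => `|f x|)).
      by move=> mD; exact: (integrable_norm (intA D mD)).
    rewrite /Rintegral integral_bigsetU_EFin ?index_enum_uniq //.
    + by rewrite -sum_fine // => i _; exact: (integrable_fin_num (mI i) (absint _ (mI i))).
    + exact: sub_trivIset dI.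
    + exact: (measurable_int mu (absint _ mA)).
  apply: ler_sum => i _; have [_ uvi _] := uv i.
  have -> : \int[mu]_(y in `]-oo, v i]) f y - \int[mu]_(y in `]-oo, u i]) f y =
      \int[mu]_(y in `]u i, v i]) f y.
    by apply: Rintegral_itvB; rewrite ?bnd_simp //; apply: intA.
  by apply: le_normr_Rintegral; [exact: mI|exact: intA].
apply: (@le_lt_trans _ _ (\sum_(i < n) (v i - u i))%:E).
  rewrite le_eqVlt; apply/orP; left; apply/eqP.
  have E := @measure_bigsetU_ord _ _ _ mu n xpredT I mI dI.
  apply: (etrans E).
  rewrite -sumEFin; apply: eq_bigr => i _.
  have [_ uvi _] := uv i.
  have := lebesgue_measure_itv `]u i, v i]; rewrite /= lte_fin => ->.
  by case: ltP => // vu; congr EFin; lra.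
by rewrite lte_fin.
Qed.

End AbsolutelyContinuousClosure.

(** * Reflection and tail integrals *)

Section Reflection.
Variable R : realType.
Local Notation C := R[i].
Local Notation mu := (@lebesgue_measure R).
Implicit Types (D : set (measurableTypeR R)).

Let opp : measurableTypeR R -> measurableTypeR R := -%R.

Let measurable_opp : measurable_fun setT opp.
Proof. exact: measurable_funN. Qed.

Let pushforward_opp : {measure set (measurableTypeR R) -> \bar R} :=
  measure_function_pushforward__canonical__measure_function_Measure
    mu measurable_opp.

(** Lebesgue measure is determined by half-open intervals, and reflection only
    exchanges the endpoint that is included. *)
Lemma lebesgue_measure_opp D : measurable D -> mu (opp @^-1` D) = mu D.
Proof.
move=> mD; apply/esym.
apply: (lebesgue_measure_unique (mu := pushforward_opp)) => //.
move=> _ [[u v] _ <-] /=.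
rewrite /pushforward opp_preimage_itvbndbnd.
have -> := lebesgue_measure_itv `]u, v].
have -> := lebesgue_measure_itv `[- v, - u[.
rewrite /= !lte_fin ltrN2; case: ltP => // _.
by rewrite -?EFinD opprK addrC.
Qed.

Lemma ae_opp (P : R -> Prop) :
  {ae mu, forall x, P x} -> {ae mu, forall x, P (- x)}.
Proof.
move=> [A [mA A0 PA]]; exists (opp @^-1` A); split.
- by rewrite -[X in measurable X]setTI; exact: measurable_opp.
- by rewrite lebesgue_measure_opp.
- by move=> x /= nP; apply: PA.
Qed.

Lemma ge0_integral_opp D (f : R -> \bar R) : measurable D ->
  measurable_fun setT f -> (forall x, (0 <= f x)%E) ->
  (\int[mu]_(x in D) f x =
   \int[mu]_(x in (-%R : R -> R) @^-1` D) (f \o (-%R : R -> R)) x)%E.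
Proof.
move=> mD mf f0.
transitivity (\int[pushforward_opp]_(x in D) f x)%E.
  by apply: eq_measure_integral => A mA _; exact: (esym (lebesgue_measure_opp mA)).
apply: (ge0_integral_pushforward measurable_opp) => //.
exact: measurable_funTS.
Qed.

Lemma integral_opp D (f : R -> \bar R) : measurable D ->
  measurable_fun setT f ->
  (\int[mu]_(x in D) f x =
   \int[mu]_(x in (-%R : R -> R) @^-1` D) (f \o (-%R : R -> R)) x)%E.
Proof.
move=> mD mf; rewrite integralE [RHS]integralE.
congr (_ - _)%E.
  have := @ge0_integral_opp D (f^\+)%E mD (measurable_funepos mf)
    (@funepos_ge0 _ _ f).
  by move=> H; apply: (etrans H); apply: eq_integral => x _; rewrite /= !funeposE.
have := @ge0_integral_opp D (f^\-)%E mD (measurable_funeneg mf)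
  (@funeneg_ge0 _ _ f).
by move=> H; apply: (etrans H); apply: eq_integral => x _; rewrite /= !funenegE.
Qed.

Lemma cintegral_opp D (f : R -> C) : measurable D -> complex_measurable f ->
  cintegral D f = cintegral ((-%R : R -> R) @^-1` D) (fun x : R => f (- x)).
Proof.
move=> mD [/measurable_EFinP f1 /measurable_EFinP f2].
by apply: complex_ext; congr fine; [exact: (integral_opp mD f1)|
  exact: (integral_opp mD f2)].
Qed.

Lemma complex_measurable_opp (f : R -> C) : complex_measurable f ->
  complex_measurable (fun x : R => f (- x)).
Proof.
by move=> [f1 f2]; split; [exact: (measurableT_comp f1 measurable_opp)|
  exact: (measurableT_comp f2 measurable_opp)].
Qed.

Lemma is_cderive_opp (f : R -> C) (x : R) l : is_cderive f (- x) l ->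
  is_cderive (fun t => f (- t)) x (- l).
Proof.
have dN : is_derive x 1 (-%R : R -> R) (- 1) by exact: is_deriveNid.
move=> [f1 f2]; split.
  have := is_derive1_comp f1 dN; rewrite /comp cReN mulrN1; exact.
have := is_derive1_comp f2 dN; rewrite /comp cImN mulrN1; exact.
Qed.

Lemma loc_abs_cont_opp (f : R -> R) : locally_abs_continuous f ->
  locally_abs_continuous (fun x => f (- x)).
Proof.
move=> acf b c e e0; have [d d0 H] := acf (- c) (- b) e e0.
exists d => // n u v uv dis sd.
under eq_bigr do rewrite distrC.
apply: (H n (fun i => - v i) (fun i => - u i)).
- by move=> i; have [? ? ?] := uv i; split; rewrite lerN2.
- by move=> i j ij; rewrite !lerN2; have [?|?] := dis _ _ ij; [right|left].
- by under eq_bigr do rewrite opprK addrC.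
Qed.

End Reflection.

Section ComplexAbsoluteContinuity.
Variable R : realType.
Local Notation C := R[i].
Local Notation mu := (@lebesgue_measure R).
Local Notation normc := (@Normc.normc R).
Implicit Types f g : R -> C.

Lemma loc_abs_contC_D f g : locally_abs_continuousC f ->
  locally_abs_continuousC g -> locally_abs_continuousC (fun x => f x + g x).
Proof.
move=> [f1 f2] [g1 g2]; split.
  by under eq_fun do rewrite cReD; exact: (loc_abs_contD f1 g1).
by under eq_fun do rewrite cImD; exact: (loc_abs_contD f2 g2).
Qed.

Lemma loc_abs_contC_cst (c : C) : locally_abs_continuousC (fun=> c : C).
Proof.
by split; apply: loc_abs_cont_lipschitz => x y; exists 0 => *;
  rewrite subrr normr0 mul0r.
Qed.

Lemma loc_abs_contC_M f g : locally_abs_continuousC f ->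
  locally_abs_continuousC g -> locally_abs_continuousC (fun x => f x * g x).
Proof.
have aN (h : R -> R) : locally_abs_continuous h ->
    locally_abs_continuous (fun x => - h x).
  move=> ah; under eq_fun do rewrite -mulN1r.
  have [aN1 _] := loc_abs_contC_cst (- 1).
  exact: (loc_abs_contM aN1 ah).
move=> [f1 f2] [g1 g2]; split.
  under eq_fun do rewrite cReM.
  exact: (loc_abs_contD (loc_abs_contM f1 g1) (aN _ (loc_abs_contM f2 g2))).
under eq_fun do rewrite cImM.
exact: (loc_abs_contD (loc_abs_contM f1 g2) (loc_abs_contM f2 g1)).
Qed.

Lemma loc_abs_contC_Z (c : C) f : locally_abs_continuousC f ->
  locally_abs_continuousC (fun x => c * f x).
Proof. by apply: loc_abs_contC_M; exact: loc_abs_contC_cst. Qed.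

Lemma loc_abs_contC_B f g : locally_abs_continuousC f ->
  locally_abs_continuousC g -> locally_abs_continuousC (fun x => f x - g x).
Proof.
move=> af ag; under eq_fun do rewrite -mulN1r.
by apply: loc_abs_contC_D => //; exact: loc_abs_contC_Z.
Qed.

Lemma loc_abs_contC_C1 f g : (forall x, is_cderive f x (g x)) ->
  locally_abs_continuousC g -> locally_abs_continuousC f.
Proof.
move=> df [g1 g2]; split.
  by apply: (loc_abs_cont_C1 (fun x => (df x).1)); exact: loc_abs_cont_continuous.
by apply: (loc_abs_cont_C1 (fun x => (df x).2)); exact: loc_abs_cont_continuous.
Qed.

Lemma loc_abs_contC_cexp (z : C) :
  locally_abs_continuousC (fun x : R => cexp (z * x%:C)).
Proof.
have cont (h h' : R -> R) : (forall x : R, is_derive x 1 h (h' x)) ->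
    continuous h.
  move=> dh x; apply: differentiable_continuous.
  by apply/derivable1_diffP; have [] := dh x.
have dz x := is_cderive_cexp z x.
have dzz x := is_cderiveZ z (dz x).
split; [apply: (loc_abs_cont_C1 (fun x => (dz x).1))|
        apply: (loc_abs_cont_C1 (fun x => (dz x).2))].
  exact: (cont _ _ (fun x => (dzz x).1)).
exact: (cont _ _ (fun x => (dzz x).2)).
Qed.

(** Used to differentiate, at every point, functions obtained from integrals of V:
    the Lebesgue differentiation theorem only gives the derivative almost
    everywhere. *)
Lemma loc_abs_contC_ae_derive f p : locally_abs_continuousC f ->
  locally_abs_continuousC p -> {ae mu, forall x, is_cderive f x (p x)} ->
  forall x, is_cderive f x (p x).
Proof.
move=> [f1 f2] [/loc_abs_cont_continuous p1 /loc_abs_cont_continuous p2] aed x.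
split.
  apply: (loc_abs_cont_ae_derive f1 p1).
  by apply: ae_mono aed => y [].
apply: (loc_abs_cont_ae_derive f2 p2).
by apply: ae_mono aed => y [].
Qed.

Lemma loc_abs_contC_ae_derive0 f : locally_abs_continuousC f ->
  {ae mu, forall x, is_cderive f x 0} -> forall x y, f x = f y.
Proof.
move=> [f1 f2] aed x y; apply: complex_ext.
  by apply: (loc_abs_cont_ae_derive0 f1); apply: ae_mono aed => z [].
by apply: (loc_abs_cont_ae_derive0 f2); apply: ae_mono aed => z [].
Qed.

Lemma loc_abs_contC_opp f : locally_abs_continuousC f ->
  locally_abs_continuousC (fun x => f (- x)).
Proof. by move=> [f1 f2]; split; [exact: (loc_abs_cont_opp f1)|
  exact: (loc_abs_cont_opp f2)]. Qed.

End ComplexAbsoluteContinuity.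

Section TailIntegral.
Variable R : realType.
Local Notation C := R[i].
Local Notation mu := (@lebesgue_measure R).

Let tailE (h : R -> R) (x : R) : mu.-integrable setT (EFin \o h) ->
  \int[mu]_(y in `]x, +oo[) h y =
  \int[mu]_y h y - \int[mu]_(y in `]-oo, x]) h y.
Proof.
move=> ih; have := @Rintegral_itvB R h -oo%O +oo%O x.
by rewrite set_itvNyy => <-.
Qed.

Let tail_loc_abs_cont (h : R -> R) : mu.-integrable setT (EFin \o h) ->
  locally_abs_continuous (fun x => \int[mu]_(y in `]x, +oo[) h y).
Proof.
move=> ih; have acF := loc_abs_cont_integral ih.
apply: (loc_abs_cont_dominated acF acF) => b c; exists 1 => u v _ _.
have E (t p q : R) : t - p - (t - q) = q - p by ring.
by rewrite !tailE // mul1r E distrC lerDl.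
Qed.

Let tail_derive (h : R -> R) : mu.-integrable setT (EFin \o h) ->
  {ae mu, forall x : R,
    is_derive x 1 (fun x => \int[mu]_(y in `]x, +oo[) h y) (- h x)}.
Proof.
move=> ih; rewrite (_ : (fun x : R => _) =
  (fun x => \int[mu]_y h y - \int[mu]_(y in `]-oo, x]) h y)); last first.
  by apply/funext => x; exact: tailE.
have loc : locally_integrable setT h.
  by rewrite -(patch_setT (fun=> 0) h); exact: integrable_locally.
apply: ae_mono (FTC1Ny _ loc); last first.
  by move=> y; exact: (integrableS measurableT).
move=> x [dF FE]; rewrite -[- h x]add0r.
apply: is_deriveB; rewrite -FE derive1E; exact: DeriveDef.
Qed.

Lemma tail_cintegral_loc_abs_cont (f : R -> C) : cintegrable setT f ->
  locally_abs_continuousC (fun x => cintegral `]x, +oo[ f).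
Proof. by move=> [f1 f2]; split; [exact: (tail_loc_abs_cont f1)|
  exact: (tail_loc_abs_cont f2)]. Qed.

Lemma tail_cintegral_derive (f : R -> C) : cintegrable setT f ->
  {ae mu, forall x, is_cderive (fun x => cintegral `]x, +oo[ f) x (- f x)}.
Proof.
move=> [/tail_derive f1 /tail_derive f2]; apply: ae_mono (ae_and f1 f2) => x.
by move=> [d1 d2]; split; rewrite ?cReN ?cImN.
Qed.

End TailIntegral.

(** * A weight adapted to the potential *)

Section VolterraWeight.
Variable R : realType.
Local Notation C := R[i].
Local Notation mu := (@lebesgue_measure R).
Local Notation normc := (@Normc.normc R).

Definition inv_oneDsqr (x : R) : R := (1 + x ^+ 2)^-1.

Lemma inv_oneDsqr_gt0 x : 0 < inv_oneDsqr x.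
Proof. by rewrite /inv_oneDsqr invr_gt0 ltr_pwDl // sqr_ge0. Qed.

Lemma continuous_inv_oneDsqr : continuous inv_oneDsqr.
Proof. exact: continuous_oneDsqrV. Qed.

Lemma integrable_inv_oneDsqr : mu.-integrable setT (EFin \o inv_oneDsqr).
Proof.
apply/integrableP; split.
  apply/measurable_EFinP; apply: continuous_measurable_fun.
  exact: continuous_inv_oneDsqr.
under eq_integral => x _ do rewrite /= ger0_norm ?(ltW (inv_oneDsqr_gt0 x)) //.
rewrite (ge0_symfun_integralT (f := inv_oneDsqr)).
- rewrite -set_itvcy; have := integral0y_oneDsqr R.
  rewrite /oneDsqr /inv_oneDsqr => ->.
  by rewrite -EFinM ltry.
- by move=> x; exact/ltW/inv_oneDsqr_gt0.
- exact: continuous_inv_oneDsqr.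
- by move=> x; rewrite /inv_oneDsqr /= sqrrN.
Qed.

(** Since exp (d|x|) >= 1 + (d x)^2 / 2. *)
Lemma expR_Nabs_le (d : R) : 0 < d -> exists2 K, 0 < K &
  forall x, expR (- (d * `|x|)) <= K * inv_oneDsqr x.
Proof.
move=> d0; exists (1 + 2 / d ^+ 2).
  by rewrite ltr_pwDl // divr_ge0 // sqr_ge0.
move=> x; rewrite expRN /inv_oneDsqr ler_pdivlMr; last first.
  by rewrite ltr_pwDl // sqr_ge0.
rewrite mulrC ler_pdivrMr ?expR_gt0 // mulrDl mul1r; apply: lerD.
  by rewrite -expR0 ler_expR mulr_ge0 // ltW.
have := @expR_ge1Dxn _ (d * `|x|) 1 (mulr_ge0 (ltW d0) (normr_ge0 x)).
rewrite exprMn real_normK ?num_real // (_ : 2`!%:R = 2 :> R) // => H.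
rewrite {1}(_ : x ^+ 2 = 2 / d ^+ 2 * (d ^+ 2 * x ^+ 2 / 2)); last first.
  by field; rewrite gt_eqF.
by rewrite ler_wpM2l ?divr_ge0 ?sqr_ge0 // (le_trans _ H) // lerDr.
Qed.

(** The exponential has derivative - c / (1 + t^2) times itself, so the integral is a
    difference of its values divided by c: steep weights give small tails. *)
Lemma weight_tail_le (c : R) (x : R) : 0 < c ->
  Rintegral mu `[x, +oo[
    (fun t => inv_oneDsqr t * expR (c * (pi / 2 - atan t))) <=
  expR (c * (pi / 2 - atan x)) / c.
Proof.
move=> c0; pose sigma t := expR (c * (pi / 2 - atan t)).
rewrite (_ : (fun t => _) = fun t => inv_oneDsqr t * sigma t) // -/(sigma x).
have dsig (t : R) : is_derive t 1 (fun t => - (sigma t / c)) (inv_oneDsqr t * sigma t).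
  have datan : is_derive t 1 (fun t => c * (pi / 2 - atan t)) (- (c * inv_oneDsqr t)).
    have -> : - (c * inv_oneDsqr t) = c *: (0 - inv_oneDsqr t).
      by rewrite /GRing.scale /= sub0r mulrN.
    apply: is_deriveZ; apply: is_deriveB; exact: is_derive1_atan.
  have d := is_derive1_comp (is_derive_expR _) datan.
  rewrite (_ : (fun _ => _) = (- c^-1) \*: (expR \o (fun t => c * (pi / 2 - atan t)))).
    apply: (is_derive_eq (is_deriveZ (- c^-1) d)).
    by rewrite /GRing.scale /= /sigma; field; rewrite gt_eqF.
  apply/funext => z.
  by rewrite -[RHS]/(- c^-1 * sigma z) mulNr mulrC.
have csig : continuous (fun t => inv_oneDsqr t * sigma t).
  move=> t; apply: cvgM; first exact: continuous_inv_oneDsqr.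
  apply: (@continuous_comp _ _ _ (fun t => c * (pi / 2 - atan t)) expR);
    last exact: continuous_expR.
  apply: cvgM; first exact: cvg_cst.
  apply: cvgB; [exact: cvg_cst|exact: continuous_atan].
have f0 (t : R) : 0 <= inv_oneDsqr t * sigma t.
  by rewrite mulr_ge0 ?expR_ge0 // ltW // inv_oneDsqr_gt0.
have siglim : (fun t => - (sigma t / c)) @ +oo --> - (1 / c).
  apply: cvgN; apply: cvgM; last exact: cvg_cst.
  have lim0 : c * (pi / 2 - atan t) @[t --> +oo] --> (0 : R).
    rewrite -(mulr0 c); apply: cvgM; first exact: cvg_cst.
    rewrite -(subrr (pi / 2 : R)); apply: cvgB; [exact: cvg_cst|].
    exact: cvgy_atan.
  rewrite -[1]expR0.
  exact: (cvg_comp (fun t => c * (pi / 2 - atan t)) expR lim0 (@continuous_expR R 0)).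
have csig' : {within `[x, +oo[, continuous (fun t => inv_oneDsqr t * sigma t)}.
  exact: continuous_subspaceT.
have E := @ge0_continuous_FTC2y R (fun t => inv_oneDsqr t * sigma t)
  (fun t => - (sigma t / c)) x (- (1 / c)) (fun t _ => f0 t) csig' siglim.
have {}E : (\int[mu]_(t in `[x, +oo[) (inv_oneDsqr t * sigma t)%:E =
    (- (1 / c))%:E - (- (sigma x / c))%:E)%E.
  apply: E.
  - by move=> t _; have [] := dsig t.
  - have : {for x, continuous (fun t => - (sigma t / c))}.
      apply: differentiable_continuous.
      by apply/derivable1_diffP; have [] := dsig x.
    exact: cvg_at_right_filter.
  - by move=> t _; rewrite derive1E; have [] := dsig t.
rewrite /Rintegral E -EFinB /= opprK addrC lerBlDr lerDl divr_ge0 //.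
exact: ltW.
Qed.

End VolterraWeight.

Section Weight.
Variable R : realType.
Local Notation C := R[i].
Local Notation mu := (@lebesgue_measure R).
Local Notation normc := (@Normc.normc R).
Implicit Types (V : R -> C).

(** The hypothesis on V, with |V|^2 e^{4a|x|} integrable. *)
Definition potential (a : R) V : Prop := complex_measurable V /\
  mu.-integrable setT (EFin \o (fun x => sqnormc (V x) * expR (4 * a * `|x|))).

Lemma potential_in_L2 (a : R) V :
  in_L2 (fun _ => 1) (fun x => (expR (2 * a * `|x|))%:C * V x) -> potential a V.
Proof.
have mexp (c : R) : measurable_fun setT (fun x : R => expR (c * `|x|)).
  by apply: measurableT_comp => //; exact: measurable_funM.
move=> [mV fV]; have {}mV : complex_measurable V.
  rewrite (_ : V = fun x => (expR (- (2 * a) * `|x|))%:C *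
      ((expR (2 * a * `|x|))%:C * V x)).
    by apply: complex_measurableM => //; apply: complex_measurable_real.
  apply/funext => x; rewrite mulrA -[X in X * _]rmorphM /= -expRD.
  by rewrite mulNr addNr expR0 mul1r.
split => //; apply/integrableP; split.
  apply/measurable_EFinP; apply: measurable_funM; last exact: mexp.
  exact: measurable_sqnormc.
apply: le_lt_trans fV; rewrite le_eqVlt; apply/orP; left; apply/eqP.
apply: eq_integral => x _; rewrite /= mulr1 ger0_norm; last first.
  by rewrite mulr_ge0 ?expR_ge0 // -sqr_normc_sqnormc sqr_ge0.
rewrite -!sqr_normc_sqnormc Normc.normcM normc_real exprMn mulrC.
rewrite (ger0_norm (expR_ge0 _)) -expRM_natl; congr (expR _ * _)%:E.
by ring.
Qed.

Lemma potential_opp (a : R) V : potential a V -> potential a (fun x => V (- x)).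
Proof.
move=> [mV iV]; split; first exact: complex_measurable_opp.
have mf := measurable_int _ iV.
case/integrableP: iV => _ fV; apply/integrableP; split.
  have mopp : measurable_fun setT (-%R : measurableTypeR R -> measurableTypeR R).
    exact: measurable_funN.
  rewrite (_ : _ \o _ = (EFin \o (fun x => sqnormc (V x) * expR (4 * a * `|x|))) \o
    (-%R : R -> R)); first exact: (measurableT_comp mf mopp).
  by apply/funext => x /=; rewrite normrN.
move: fV; rewrite (integral_opp measurableT); last exact: measurableT_comp.
rewrite preimage_setT; congr (_ < _)%E; apply: eq_integral => x _ /=.
by rewrite normrN.
Qed.

(** With a weight satisfying this inequality, the Volterra operators below have
    small norm for the weighted sup norm, on the whole line at once. Take rho^2 =
    sigma with sigma = exp (c (pi / 2 - atan x)). The function |V| e^{2b|y|} rho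
    is a product P Q with P^2 = |V|^2 e^{4a|y|} integrable and Q^2 at most
    K sigma / (1 + y^2), whose tail integral is at most K sigma(x) / c. Instead
    of the Cauchy-Schwarz inequality, P Q <= eta P^2 / 2 + Q^2 / (2 eta) is used
    with the value of eta that suits the point x. *)
Lemma exists_volterra_weight (a b eps : R) V : potential a V -> b < a ->
  0 < eps -> exists (rho : R -> R) (B : R), [/\ measurable_fun setT rho,
    forall x, 1 <= rho x <= B,
    mu.-integrable setT
      (EFin \o (fun y => normc (V y) * expR (2 * b * `|y|) * rho y)) &
    forall x, Rintegral mu `]x, +oo[
      (fun y => normc (V y) * expR (2 * b * `|y|) * rho y) <= eps * rho x].
Proof.
move=> [mV iq] ba eps0.
set q := (fun x => sqnormc (V x) * expR (4 * a * `|x|)) in iq.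
have q0 x : 0 <= q x.
  by rewrite mulr_ge0 ?expR_ge0 // -sqr_normc_sqnormc sqr_ge0.
have d0 : 0 < 4 * (a - b) by rewrite mulr_gt0 // subr_gt0.
have [K K0 HK] := expR_Nabs_le d0.
pose M := Rintegral mu setT q + 1.
have M0 : 0 < M by rewrite ltr_wpDl //; apply: Rintegral_ge0 => x _; exact: q0.
pose c := K * M / eps ^+ 2.
have c0 : 0 < c by rewrite divr_gt0 ?mulr_gt0 // exprn_gt0.
pose sigma t := expR (c * (pi / 2 - atan t)).
pose rho t := expR (c / 2 * (pi / 2 - atan t)).
have rho_sqr t : rho t ^+ 2 = sigma t.
  by rewrite /rho -expRM_natl; congr expR; field.
have crho : continuous rho.
  move=> t; apply: (@continuous_comp _ _ _ (fun t => c / 2 * (pi / 2 - atan t)) expR);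
    last exact: continuous_expR.
  apply: cvgM; first exact: cvg_cst.
  apply: cvgB; [exact: cvg_cst|exact: continuous_atan].
have mrho : measurable_fun setT rho by exact: continuous_measurable_fun.
have rho1 t : 1 <= rho t.
  rewrite -expR0 ler_expR; apply: mulr_ge0; first by rewrite divr_ge0 // ltW.
  by rewrite subr_ge0; exact/ltW/atan_ltpi2.
have rhoB t : rho t <= expR (c / 2 * pi).
  rewrite ler_expR; apply: ler_wpM2l; first by rewrite divr_ge0 // ltW.
  by have := atan_gtNpi2 t; lra.
pose g y := normc (V y) * expR (2 * b * `|y|) * rho y.
have mg : measurable_fun setT g.
  apply: measurable_funM => //; apply: measurable_funM.
    exact: measurable_normc.
  by apply: measurableT_comp => //; exact: measurable_funM.
have g0 y : 0 <= g y by rewrite !mulr_ge0 ?expR_ge0 ?normc_ge0.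
pose w y := inv_oneDsqr y * sigma y.
have gle eta y : 0 < eta -> g y <= eta / 2 * q y + K / (2 * eta) * w y.
  move=> eta0.
  pose P := normc (V y) * expR (2 * a * `|y|).
  pose Q := expR (- (2 * (a - b) * `|y|)) * rho y.
  have -> : g y = P * Q.
    have e : expR (2 * b * `|y|) =
        expR (2 * a * `|y|) * expR (- (2 * (a - b) * `|y|)).
      by rewrite -expRD; congr expR; ring.
    by rewrite /g /P /Q e; ring.
  have -> : q y = P ^+ 2.
    rewrite /q /P exprMn sqr_normc_sqnormc -expRM_natl.
    by congr (_ * expR _); ring.
  have Qw : Q ^+ 2 <= K * w y.
    rewrite /Q exprMn rho_sqr /w mulrA ler_pM2r ?expR_gt0 // -expRM_natl.
    rewrite (le_trans _ (HK y)) // ler_expR le_eqVlt; apply/orP; left.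
    by apply/eqP; ring.
  have Qw' : Q ^+ 2 / (2 * eta) <= K * w y / (2 * eta).
    by rewrite ler_pM2r // invr_gt0 mulr_gt0.
  rewrite [K / _ * _]mulrAC; apply: le_trans (_ : _ <= eta / 2 * P ^+ 2 + Q ^+ 2 / (2 * eta)) _.
    rewrite -subr_ge0 (_ : _ - _ = (eta * P - Q) ^+ 2 / (2 * eta)).
      by rewrite divr_ge0 ?sqr_ge0 // mulr_ge0 // ltW.
    by field; rewrite gt_eqF.
  by rewrite lerD2l.
have iw : mu.-integrable setT (EFin \o w).
  apply: (le_integrable measurableT _ _
    (integrable_scale (expR (c * pi)) measurableT (@integrable_inv_oneDsqr R))).
  - apply/measurable_EFinP; apply: measurable_funM.
      by apply: continuous_measurable_fun; exact: continuous_inv_oneDsqr.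
    rewrite (_ : sigma = fun t => rho t ^+ 2); first exact: measurable_funX.
    by apply/funext => t.
  - move=> y _ /=; rewrite lee_fin /w mulrC !normrM.
    rewrite ler_pM2r ?normr_gt0 ?gt_eqF ?inv_oneDsqr_gt0 //.
    rewrite !ger0_norm ?expR_ge0 // ler_expR; apply: ler_wpM2l; first exact: ltW.
    by have := atan_gtNpi2 y; lra.
have ih eta : mu.-integrable setT
    (EFin \o (fun y => eta / 2 * q y + K / (2 * eta) * w y)).
  have := integrableD measurableT (integrable_scale (eta / 2) measurableT iq)
    (integrable_scale (K / (2 * eta)) measurableT iw).
  by [].
have ig : mu.-integrable setT (EFin \o g).
  apply: (le_integrable measurableT _ _ (ih 1)).
  - exact/measurable_EFinP.
  - move=> y _ /=; rewrite lee_fin ger0_norm // (le_trans (gle 1 y _)) //.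
    exact: ler_norm.
exists rho, (expR (c / 2 * pi)); split => //; first by move=> x; rewrite rho1 rhoB.
move=> x.
have rx : 0 < rho x by exact: expR_gt0.
pose eta := eps * rho x / M.
have eta0 : 0 < eta by rewrite divr_gt0 // mulr_gt0.
have mx : measurable (`]x, +oo[%classic : set (measurableTypeR R)).
  exact: measurable_itv.
apply: (@le_trans _ _ (Rintegral mu `]x, +oo[
    (fun y => eta / 2 * q y + K / (2 * eta) * w y))).
  apply: le_Rintegral => //.
  - exact: (integrableS measurableT).
  - exact: (integrableS measurableT).
  - by move=> y _; exact: gle.
have iqx : mu.-integrable (`]x, +oo[%classic : set (measurableTypeR R)) (EFin \o q).
  exact: (integrableS measurableT).
have iwx : mu.-integrable (`]x, +oo[%classic : set (measurableTypeR R)) (EFin \o w).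
  exact: (integrableS measurableT).
rewrite RintegralD //; [|exact: integrable_scale..].
rewrite !RintegralZl //.
have h1 : Rintegral mu `]x, +oo[ q <= M.
  apply: (@le_trans _ _ (Rintegral mu setT q)); last by rewrite lerDl.
  rewrite /Rintegral fine_le //.
  + exact: (integrable_fin_num mx iqx).
  + exact: (integrable_fin_num measurableT iq).
  + apply: ge0_subset_integral => //.
      exact: (measurable_int _ iq).
    by move=> y _; rewrite lee_fin.
have h2 : Rintegral mu `]x, +oo[ w <= sigma x / c.
  by rewrite Rintegral_itv_obnd_cbnd //; exact: (weight_tail_le x c0).
have e1 : eta / 2 * Rintegral mu `]x, +oo[ q <= eta / 2 * M.
  by rewrite ler_pM2l // divr_gt0.
have e2 : K / (2 * eta) * Rintegral mu `]x, +oo[ w <= K / (2 * eta) * (sigma x / c).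
  by rewrite ler_pM2l // divr_gt0 // mulr_gt0.
apply: (le_trans (lerD e1 e2)); rewrite le_eqVlt; apply/orP; left; apply/eqP.
rewrite -rho_sqr /eta /c; field.
by rewrite !gt_eqF //= mulr_gt0.
Qed.

End Weight.

(** * Contractions for a weighted sup norm *)

Section WeightedContraction.
Variable R : realType.
Local Notation C := R[i].
Local Notation normc := (@Normc.normc R).

Lemma halfpow_small (c e : R) : 0 < e -> exists n, c * 2^-1 ^+ n < e.
Proof.
move=> e0; have : geometric c (2^-1 : R) @ \oo --> 0.
  by apply: cvg_geometric; rewrite ger0_norm // invf_lt1 // ltr1n.
move=> /cvgrPdist_lt /(_ _ e0) [n _ /(_ n (leqnn n))].
rewrite sub0r normrN => h; exists n; apply: le_lt_trans h.
exact: ler_norm.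
Qed.

Lemma le0_halfpow (x c : R) : (forall n, x <= c * 2^-1 ^+ n) -> x <= 0.
Proof.
move=> H; apply/ler_addgt0Pr => e e0; rewrite add0r.
have [n hn] := halfpow_small c e0.
exact: (le_trans (H n) (ltW hn)).
Qed.

(** u n -+ 2c 2^{-n} are monotone sequences enclosing the limit. *)
Lemma halfpow_limit (u : nat -> R) (c : R) : 0 <= c ->
  (forall n, `|u n.+1 - u n| <= c * 2^-1 ^+ n) ->
  exists l, forall n, `|u n - l| <= 2 * c * 2^-1 ^+ n.
Proof.
move=> c0 Hu.
pose lo n := u n - 2 * c * 2^-1 ^+ n; pose hi n := u n + 2 * c * 2^-1 ^+ n.
have h n : 2 * c * 2^-1 ^+ n.+1 = c * 2^-1 ^+ n.
  by rewrite exprS; field.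
have p n : 0 <= c * 2^-1 ^+ n by rewrite mulr_ge0 // exprn_ge0.
have lohi n : lo n <= hi n.
  by rewrite /lo /hi; have := p n; lra.
have loS n : lo n <= lo n.+1.
  have := Hu n; rewrite ler_norml => /andP[? ?]; rewrite /lo h.
  have := p n; lra.
have hiS n : hi n.+1 <= hi n.
  have := Hu n; rewrite ler_norml => /andP[? ?]; rewrite /hi h.
  have := p n; lra.
have lomono i j : (i <= j)%N -> lo i <= lo j.
  move=> /subnK <-; elim: (j - i)%N => [|k IH]; first by rewrite add0n.
  by rewrite addSn (le_trans IH).
have himono i j : (i <= j)%N -> hi j <= hi i.
  move=> /subnK <-; elim: (j - i)%N => [|k IH]; first by rewrite add0n.
  by rewrite addSn (le_trans _ IH).
have lh i j : lo i <= hi j.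
  rewrite (le_trans (lomono i (maxn i j) _)) ?leq_maxl //.
  by rewrite (le_trans (lohi _)) // himono // leq_maxr.
have hs : has_sup (range lo).
  by split; [exists (lo 0%N), 0%N|exists (hi 0%N) => _ [i _ <-]].
exists (sup (range lo)) => n; rewrite ler_distl; apply/andP; split.
  rewrite lerBlDr; apply: ge_sup; first by exists (lo 0%N), 0%N.
  by move=> _ [i _ <-]; exact: lh.
by rewrite -lerBlDr; apply: sup_upper_bound => //; exists n.
Qed.

Variable W : R -> R.
Hypothesis W0 : forall x, 0 <= W x.

Definition wbounded (N : R) (f : R -> C) : Prop :=
  complex_measurable f /\ forall x, normc (f x) <= N * W x.

Lemma wboundedB N N' f g : wbounded N f -> wbounded N' g ->
  wbounded (N + N') (fun x => f x - g x).
Proof.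
move=> [mf bf] [mg bg]; split; first exact: complex_measurableB.
by move=> x; rewrite (le_trans (normcB_le _ _)) // mulrDl lerD.
Qed.

Lemma wboundedD N N' f g : wbounded N f -> wbounded N' g ->
  wbounded (N + N') (fun x => f x + g x).
Proof.
move=> [mf bf] [mg bg]; split; first exact: complex_measurableD.
by move=> x; rewrite (le_trans (normcD_le _ _)) // mulrDl lerD.
Qed.

Variable T : (R -> C) -> R -> C.
Hypothesis T_half : forall N f, 0 <= N -> wbounded N f -> wbounded (N / 2) (T f).
Hypothesis TB : forall N f g x, 0 <= N -> wbounded N f -> wbounded N g ->
  T (fun y => f y - g y) x = T f x - T g x.

(** Each substitution of the bound into the equation halves its excess over 2 N. *)
Lemma contraction_apriori N N' g m : 0 <= N -> 0 <= N' ->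
  (forall x, normc (g x) <= N * W x) -> wbounded N' m ->
  (forall x, m x = g x + T m x) -> wbounded (2 * N) m.
Proof.
move=> N0 N'0 bg mN' mE.
have step n : wbounded (2 * N + N' * 2^-1 ^+ n) m.
  elim: n => [|n IH].
    split; first by case: mN'.
    move=> x; have [_ /(_ x) h] := mN'; rewrite (le_trans h) // ler_wpM2r //.
    by rewrite expr0 mulr1 lerDr mulr_ge0.
  have pos : 0 <= 2 * N + N' * 2^-1 ^+ n.
    by rewrite addr_ge0 ?mulr_ge0 ?exprn_ge0.
  have [_ Tm] := T_half pos IH; split; first by case: mN'.
  move=> x; rewrite mE (le_trans (normcD_le _ _)) //.
  rewrite (le_trans (lerD (bg x) (Tm x))) // -mulrDl ler_wpM2r //.
  by rewrite exprS le_eqVlt; apply/orP; left; apply/eqP; field.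
split; first by case: mN'.
move=> x; rewrite -subr_le0; apply: (@le0_halfpow _ (N' * W x)) => n.
have [_ /(_ x) h] := step n; rewrite lerBlDl (le_trans h) //.
by rewrite le_eqVlt; apply/orP; left; apply/eqP; ring.
Qed.

(** Banach's fixed point theorem, by the iterates u (n+1) = g + T (u n) from 0.
    Convergence is pointwise, so that the limit is measurable. *)
Lemma contraction_exists N g : 0 <= N -> wbounded N g ->
  exists m, wbounded (2 * N) m /\ forall x, m x = g x + T m x.
Proof.
move=> N0 bg; pose u := fix u n : R -> C :=
  if n is n'.+1 then fun x => g x + T (u n') x else fun=> 0.
have b0 : wbounded 0 (fun=> 0).
  by split; [exact: complex_measurable_cst|move=> x; rewrite Normc.normc0 mul0r].
have T0 x : T (fun=> 0) x = 0.
  have [_ /(_ x)] := T_half (lexx 0) b0; rewrite !mul0r => h.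
  by apply: Normc.eq0_normc; apply/eqP; rewrite eq_le h normc_ge0.
have p n : 0 <= N * 2^-1 ^+ n by rewrite mulr_ge0 // exprn_ge0.
have bu n : wbounded (2 * N) (u n).
  elim: n => [|n IH] /=.
    by have [? h] := b0; split => // x; rewrite Normc.normc0 mulr_ge0 // mulr_ge0.
  have N20 : 0 <= 2 * N by rewrite mulr_ge0.
  rewrite (_ : 2 * N = N + 2 * N / 2); last by field.
  by apply: wboundedD => //; exact: T_half.
have du n : wbounded (N * 2^-1 ^+ n) (fun x => u n.+1 x - u n x).
  elim: n => [|n IH].
    rewrite expr0 mulr1 (_ : (fun x => _) = g) //.
    by apply/funext => x /=; rewrite T0 addr0 subr0.
  have := T_half (p n) IH; rewrite exprSr mulrA.
  congr (wbounded _ _); apply/funext => x /=.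
  have N20 : 0 <= 2 * N by rewrite mulr_ge0.
  by rewrite (TB x N20 (bu n.+1) (bu n)) /=; ring.
have lim x : exists l : C,
    forall n, normc (u n x - l) <= 4 * N * 2^-1 ^+ n * W x.
  have c0 : 0 <= N * W x by rewrite mulr_ge0.
  have [|lr Hr] := @halfpow_limit (fun n => complex.Re (u n x)) (N * W x) c0.
    move=> n; have [_ /(_ x) h] := du n.
    by rewrite -cReN -cReD (le_trans (normr_Re_le _)) // (le_trans h) // mulrAC.
  have [|li Hi] := @halfpow_limit (fun n => complex.Im (u n x)) (N * W x) c0.
    move=> n; have [_ /(_ x) h] := du n.
    by rewrite -cImN -cImD (le_trans (normr_Im_le _)) // (le_trans h) // mulrAC.
  exists (lr +i* li) => n; rewrite (le_trans (normc_le_ReIm _)) //.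
  rewrite cReD cImD cReN cImN /= (le_trans (lerD (Hr n) (Hi n))) //.
  by rewrite le_eqVlt; apply/orP; left; apply/eqP; ring.
pose m x := projT1 (cid (lim x)).
have Hm n x : normc (u n x - m x) <= 4 * N * 2^-1 ^+ n * W x.
  by rewrite /m; case: cid => l /=.
have cv (phi : C -> R) : (forall z w, `|phi z - phi w| <= normc (z - w)) ->
    (forall n, measurable_fun setT (fun x => phi (u n x))) ->
    measurable_fun setT (fun x => phi (m x)).
  move=> lip mphi; apply: (measurable_fun_cvg (fun n => mphi n)) => x _.
  apply/cvgrPdist_lt => e e0.
  have [k hk] := halfpow_small (4 * N * W x) e0.
  exists k => // n /= kn; rewrite distrC (le_lt_trans (lip _ _)) //.
  rewrite (le_lt_trans (Hm n x)) // (le_lt_trans _ hk) //.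
  rewrite mulrAC ler_wpM2l ?mulr_ge0 //.
  by rewrite ler_wiXn2l // invf_le1 // ler1n.
have mm : complex_measurable m.
  split; apply: cv => [z w|n].
  - by rewrite -cReN -cReD normr_Re_le.
  - by have [[]] := bu n.
  - by rewrite -cImN -cImD normr_Im_le.
  - by have [[]] := bu n.
have wm : wbounded (4 * N) m.
  split => // x; have := Hm 0%N x; rewrite expr0 mulr1 /= sub0r.
  by rewrite normc_opp.
have mE x : m x = g x + T m x.
  apply/eqP; rewrite -subr_eq0; apply/eqP; apply: Normc.eq0_normc.
  apply/eqP; rewrite eq_le normc_ge0 andbT.
  apply: (@le0_halfpow _ (4 * N * W x)) => n.
  have N40 : 0 <= 4 * N by rewrite mulr_ge0.
  have bun : wbounded (4 * N) (u n).
    have [? h] := bu n; split => // y; rewrite (le_trans (h y)) //.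
    by rewrite ler_wpM2r // ler_wpM2r // ler_nat.
  have pn : 0 <= 4 * N * 2^-1 ^+ n by rewrite mulr_ge0 // exprn_ge0.
  have dn : wbounded (4 * N * 2^-1 ^+ n) (fun x => u n x - m x).
    by split; [apply: complex_measurableB => //; case: (bu n)|exact: Hm].
  have [_ /(_ x)] := T_half pn dn.
  rewrite (TB x N40 bun wm) => h1; have h2 := Hm n.+1 x.
  rewrite (_ : m x - _ = - (u n.+1 x - m x) + (T (u n) x - T m x)); last first.
    by rewrite /=; ring.
  rewrite (le_trans (normcD_le _ _)) // normc_opp (le_trans (lerD h2 h1)) //.
  by rewrite le_eqVlt exprS; apply/orP; left; apply/eqP; field.
exists m; split => //.
by apply: (contraction_apriori N0 _ _ wm mE); [rewrite mulr_ge0|case: bg].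
Qed.

End WeightedContraction.

(** * Volterra operators and their kernels *)

Section VolterraOperator.
Variable R : realType.
Local Notation C := R[i].
Local Notation mu := (@lebesgue_measure R).
Local Notation normc := (@Normc.normc R).

Definition volterra (V k f : R -> C) (x : R) : C :=
  cintegral `]x, +oo[ (fun y => k (y - x) * (V y * f y)).

(** Tonelli's theorem for the positive and negative parts. *)
Lemma measurable_parameter_integral
    (h : measurableTypeR R * measurableTypeR R -> R) :
  measurable_fun setT h ->
  measurable_fun setT (fun x : measurableTypeR R =>
    Rintegral mu setT (fun y => h (x, y))).
Proof.
move=> mh; have meh : measurable_fun setT (EFin \o h) by exact/measurable_EFinP.
have mp := @measurable_fun_fubini_tonelli_F _ _ _ _ _ mu _
  (measurable_funepos meh) (@funepos_ge0 _ _ (EFin \o h)).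
have mn := @measurable_fun_fubini_tonelli_F _ _ _ _ _ mu _
  (measurable_funeneg meh) (@funeneg_ge0 _ _ (EFin \o h)).
rewrite (_ : (fun x => _) = fine \o
  (fubini_F mu (EFin \o h)^\+ \- fubini_F mu (EFin \o h)^\-)%E).
  apply: measurableT_comp => //.
  exact: emeasurable_funB.
apply/funext => x; rewrite /Rintegral /= integralE; congr fine.
by congr (_ - _)%E; apply: eq_integral => y _; rewrite /= ?funeposE ?funenegE.
Qed.

Lemma measurable_volterra (V k f : R -> C) : complex_measurable V ->
  complex_measurable k -> complex_measurable f ->
  complex_measurable (volterra V k f).
Proof.
move=> mV mk mf.
pose T2 := (measurableTypeR R * measurableTypeR R)%type.
have m1 : measurable_fun setT (fun p : T2 => p.1 : R) by exact: measurable_fst.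
have m2 : measurable_fun setT (fun p : T2 => p.2 : R) by exact: measurable_snd.
have comp (g : R -> C) (q : T2 -> R) : complex_measurable g ->
    measurable_fun setT q -> complex_measurable (fun p => g (q p)).
  by move=> [g1 g2] mq; split; [exact: (measurableT_comp g1 mq)|
    exact: (measurableT_comp g2 mq)].
have mif : complex_measurable (fun p : T2 => if p.1 < p.2
    then k (p.2 - p.1) * (V p.2 * f p.2) else 0).
  apply: complex_measurable_if; last exact: complex_measurable_cst.
    exact: measurable_fun_ltr.
  apply: complex_measurableM; last by apply: complex_measurableM; exact: comp.
  by apply: comp => //; exact: measurable_funB.
case: mif => [/measurable_parameter_integral h1 /measurable_parameter_integral h2].
split.
  rewrite (_ : (fun x => _) = fun x => Rintegral mu setT (fun y =>
    complex.Re (if x < y then k (y - x) * (V y * f y) else 0))) //.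
  apply/funext => x; rewrite /volterra /cintegral /= Rintegral_mkcond.
  apply: eq_Rintegral => y _; rewrite patchE; case: ifP => [/set_mem|/negbT].
    by rewrite /= in_itv /= andbT => ->.
  by move=> /negP; rewrite inE /= in_itv /= andbT => /negP/negbTE ->.
rewrite (_ : (fun x => _) = fun x => Rintegral mu setT (fun y =>
  complex.Im (if x < y then k (y - x) * (V y * f y) else 0))) //.
apply/funext => x; rewrite /volterra /cintegral /= Rintegral_mkcond.
apply: eq_Rintegral => y _; rewrite patchE; case: ifP => [/set_mem|/negbT].
  by rewrite /= in_itv /= andbT => ->.
by move=> /negP; rewrite inE /= in_itv /= andbT => /negP/negbTE ->.
Qed.

Definition volterra_weight (V : R -> C) (b eps : R) (rho : R -> R) : Prop :=
  [/\ measurable_fun setT rho,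
    forall x, 1 <= rho x,
    mu.-integrable setT
      (EFin \o (fun y => normc (V y) * expR (2 * b * `|y|) * rho y)) &
    forall x, Rintegral mu `]x, +oo[
      (fun y => normc (V y) * expR (2 * b * `|y|) * rho y) <= eps * rho x].

(** This is 1 for x >= 0 and e^{2b|x|} for x <= 0. When Re s is negative,
    m = e^{sx} mu_+ may grow in this way at - oo; for b = 0 the bound is
    uniform on the line. *)
Definition growth (b x : R) : R := expR (b * (`|x| - x)).

Definition exp_kernel (b c : R) (k : R -> C) : Prop :=
  complex_measurable k /\ forall t, 0 < t -> normc (k t) <= c * expR (2 * b * t).

Section Bounds.
Variables (V : R -> C) (b eps : R) (rho : R -> R).
Hypothesis b0 : 0 <= b.
Hypothesis mV : complex_measurable V.
Hypothesis Vrho : volterra_weight V b eps rho.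

Let W x := growth b x * rho x.

(** Why one weight serves the whole line: the growth of the kernel and of f is paid
    by the factor e^{2b|y|}, which V absorbs. *)
Lemma growth_kernel_le x y : x < y ->
  expR (2 * b * (y - x)) * growth b y <= growth b x * expR (2 * b * `|y|).
Proof.
move=> xy; rewrite /growth -!expRD ler_expR.
have h : y - x <= `|y| + `|x|.
  by rewrite (le_trans (ler_norm _)) // ler_normB.
rewrite -subr_ge0 (_ : _ - _ = b * (`|y| + `|x| - (y - x))); last by ring.
by rewrite mulr_ge0 // subr_ge0.
Qed.

Let dom (c : R) y := c * (normc (V y) * expR (2 * b * `|y|) * rho y).

Let dom_ge c N k f x y : 0 <= c -> 0 <= N -> exp_kernel b c k ->
  wbounded W N f -> x < y ->
  normc (k (y - x) * (V y * f y)) <= dom (c * N * growth b x) y.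
Proof.
move=> c0 N0 [mk bk] [mf bf] xy; rewrite !Normc.normcM /dom.
have h1 : normc (k (y - x)) <= c * expR (2 * b * (y - x)).
  by apply: bk; rewrite subr_gt0.
have [_ /(_ y) rho1 _ _] := Vrho.
have rho0 : 0 <= rho y by rewrite (le_trans _ rho1).
apply: (@le_trans _ _ (c * expR (2 * b * (y - x)) *
    (normc (V y) * (N * (growth b y * rho y))))).
  apply: ler_pM; rewrite ?normc_ge0 ?mulr_ge0 ?normc_ge0 //.
  by rewrite ler_wpM2l ?normc_ge0 // bf.
have h2 := growth_kernel_le xy.
rewrite -subr_ge0 (_ : _ - _ = c * N * normc (V y) * rho y *
  (growth b x * expR (2 * b * `|y|) - expR (2 * b * (y - x)) * growth b y)).
  by rewrite mulr_ge0 ?subr_ge0 // !mulr_ge0 // normc_ge0.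
by ring.
Qed.

Lemma volterra_integrable c N k f x : 0 <= c -> 0 <= N -> exp_kernel b c k ->
  wbounded W N f ->
  cintegrable `]x, +oo[ (fun y => k (y - x) * (V y * f y)).
Proof.
move=> c0 N0 hk hf; have [_ _ iw _] := Vrho.
apply: (@cintegrable_dominated _ _ _ (dom (c * N * growth b x))) => //.
- apply: complex_measurableM.
    have [[k1 k2] _] := hk.
    have ms : measurable_fun setT (fun y : R => y - x) by exact: measurable_funB.
    by split; [exact: (measurableT_comp k1 ms)|exact: (measurableT_comp k2 ms)].
  by apply: complex_measurableM => //; case: hf.
- by apply: integrable_scale => //; exact: (integrableS measurableT).
- by move=> y /=; rewrite in_itv /= andbT; exact: dom_ge.
Qed.

Lemma volterra_le c N k f x : 0 <= c -> 0 <= N -> exp_kernel b c k ->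
  wbounded W N f -> normc (volterra V k f x) <= c * N * eps * W x.
Proof.
move=> c0 N0 hk hf; have [_ _ iw tw] := Vrho.
have iwx : mu.-integrable (`]x, +oo[%classic : set (measurableTypeR R))
    (EFin \o (fun y => normc (V y) * expR (2 * b * `|y|) * rho y)).
  exact: (integrableS measurableT).
apply: (@le_trans _ _ (Rintegral mu `]x, +oo[ (dom (c * N * growth b x)))).
  apply: cintegral_le => //.
  - apply: complex_measurableM.
      have [[k1 k2] _] := hk.
      have ms : measurable_fun setT (fun y : R => y - x) by exact: measurable_funB.
      by split; [exact: (measurableT_comp k1 ms)|exact: (measurableT_comp k2 ms)].
    by apply: complex_measurableM => //; case: hf.
  - exact: integrable_scale.
  - by move=> y /=; rewrite in_itv /= andbT; exact: dom_ge.
rewrite RintegralZl //.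
rewrite (_ : c * N * eps * W x = c * N * growth b x * (eps * rho x)); last first.
  by rewrite /W; ring.
by rewrite ler_wpM2l // !mulr_ge0 // expR_ge0.
Qed.

Lemma volterraD c N k f g x : 0 <= c -> 0 <= N -> exp_kernel b c k ->
  wbounded W N f -> wbounded W N g ->
  volterra V k (fun y => f y + g y) x = volterra V k f x + volterra V k g x.
Proof.
move=> c0 N0 hk hf hg; rewrite -cintegralD //; last 2 first.
- exact: (volterra_integrable _ c0 N0 hk hf).
- exact: (volterra_integrable _ c0 N0 hk hg).
by apply: eq_cintegral => y _; rewrite !mulrDr.
Qed.

Lemma volterraZ c N k f z x : 0 <= c -> 0 <= N -> exp_kernel b c k ->
  wbounded W N f ->
  volterra V k (fun y => z * f y) x = z * volterra V k f x.
Proof.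
move=> c0 N0 hk hf; rewrite -cintegralZ //; last first.
  exact: (volterra_integrable _ c0 N0 hk hf).
by apply: eq_cintegral => y _; ring.
Qed.

Lemma volterra_kernelD c N k l f x : 0 <= c -> 0 <= N -> exp_kernel b c k ->
  exp_kernel b c l -> wbounded W N f ->
  volterra V (fun t => k t + l t) f x = volterra V k f x + volterra V l f x.
Proof.
move=> c0 N0 hk hl hf; rewrite -cintegralD //; last 2 first.
- exact: (volterra_integrable _ c0 N0 hk hf).
- exact: (volterra_integrable _ c0 N0 hl hf).
by apply: eq_cintegral => y _; rewrite !mulrDl.
Qed.

Lemma volterra_kernelZ c N k f z x : 0 <= c -> 0 <= N -> exp_kernel b c k ->
  wbounded W N f ->
  volterra V (fun t => z * k t) f x = z * volterra V k f x.
Proof.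
move=> c0 N0 hk hf; rewrite -cintegralZ //; last first.
  exact: (volterra_integrable _ c0 N0 hk hf).
by apply: eq_cintegral => y _; rewrite !mulrA.
Qed.

End Bounds.
End VolterraOperator.

Section Kernels.
Variable R : realType.
Local Notation C := R[i].
Local Notation normc := (@Normc.normc R).

Definition decay_kernel (s : C) (t : R) : C := cexp (- (2 * s) * t%:C).

(** The solution vanishing at t = 0 with derivative 1 of K'' + 2 s K' = 0. *)
Definition free_kernel (s : C) (t : R) : C := (2 * s)^-1 * (1 - decay_kernel s t).

Lemma normc_decay_kernel (s : C) t :
  normc (decay_kernel s t) = expR (- (2 * complex.Re s) * t).
Proof.
rewrite normc_cexp; congr expR; rewrite cReM /= mulr0 subr0.
by case: s => x y /=; ring.
Qed.

Lemma normc2 : normc 2 = 2.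
Proof. by rewrite -(rmorph_nat (real_complex R)) normc_real ger0_norm. Qed.

Lemma complex_measurable_cexp_real (z : C) :
  complex_measurable (fun t : R => cexp (z * t%:C)).
Proof.
apply: complex_measurable_cexp; apply: complex_measurableM.
  exact: complex_measurable_cst.
exact: complex_measurable_real.
Qed.

Lemma exp_kernel_le b c c' (k : R -> C) : c <= c' -> exp_kernel b c k ->
  exp_kernel b c' k.
Proof.
move=> cc [mk bk]; split=> // t t0; rewrite (le_trans (bk t t0)) //.
by rewrite ler_wpM2r // expR_ge0.
Qed.

Lemma exp_kernelD b c c' (k l : R -> C) : exp_kernel b c k ->
  exp_kernel b c' l -> exp_kernel b (c + c') (fun t => k t + l t).
Proof.
move=> [mk bk] [ml bl]; split; first exact: complex_measurableD.
move=> t t0; rewrite (le_trans (normcD_le _ _)) // mulrDl.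
by rewrite lerD ?bk ?bl.
Qed.

Lemma exp_kernelZ b c (k : R -> C) (z : C) : exp_kernel b c k ->
  exp_kernel b (normc z * c) (fun t => z * k t).
Proof.
move=> [mk bk]; split.
  by apply: complex_measurableM => //; exact: complex_measurable_cst.
move=> t t0; rewrite Normc.normcM -[leRHS]mulrA.
by apply: ler_wpM2l; [exact: normc_ge0|exact: bk].
Qed.

Lemma exp_kernel_ext b c (k l : R -> C) : (forall t, k t = l t) ->
  exp_kernel b c k -> exp_kernel b c l.
Proof. by move=> /funext ->. Qed.

Lemma exp_kernel_cst1 b : 0 <= b -> exp_kernel b 1 (fun=> 1 : C).
Proof.
move=> b0; split; first exact: complex_measurable_cst.
move=> t t0; rewrite Normc.normc1 mul1r -expR0 ler_expR.
by rewrite !mulr_ge0 // ltW.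
Qed.

Lemma decay_kernel_exp b (s : C) : - b <= complex.Re s ->
  exp_kernel b 1 (decay_kernel s).
Proof.
move=> bs; split; first exact: complex_measurable_cexp_real.
move=> t t0; rewrite normc_decay_kernel mul1r ler_expR ler_pM2r //.
by lra.
Qed.

Lemma free_kernel_exp b (s : C) : 0 <= b -> - b <= complex.Re s -> s != 0 ->
  exp_kernel b (normc s)^-1 (free_kernel s).
Proof.
move=> b0 bs s0.
have h := exp_kernelZ ((2 * s)^-1) (exp_kernelD (exp_kernel_cst1 b0)
  (exp_kernelZ (- 1) (decay_kernel_exp bs))).
apply: exp_kernel_ext (exp_kernel_le _ h).
  by move=> t; rewrite mulN1r.
rewrite normc_opp Normc.normc1 mulr1 Normc.normcV Normc.normcM.
rewrite normc2.
by rewrite invfM mulrC mulrA mulfV // mul1r.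
Qed.

(** Differentiability of the family k in its parameter, with derivative k' at s0 and
    a remainder of second order that is uniform for the bound c e^{2bt}. *)
Definition kernel_diff (b c eta : R) (k : C -> R -> C) (s0 : C) (k' : R -> C) :=
  [/\ exp_kernel b c k' & forall h, normc h < eta ->
   [/\ exp_kernel b c (k (s0 + h)),
       exp_kernel b (c * normc h) (fun t => k (s0 + h) t - k s0 t) &
       exp_kernel b (c * normc h ^+ 2)
         (fun t => k (s0 + h) t - k s0 t - h * k' t) ] ].

Lemma id_le_expR (kap t : R) : 0 < kap -> 0 <= t -> t <= kap^-1 * expR (kap * t).
Proof.
move=> k0 t0; rewrite ler_pdivlMl //.
by rewrite (le_trans _ (expR_ge1Dx _)) // lerDr.
Qed.

Lemma sqr_le_expR (kap t : R) : 0 < kap -> 0 <= t ->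
  t ^+ 2 <= (2 / kap) ^+ 2 * expR (kap * t).
Proof.
move=> k0 t0; have k20 : 0 < kap / 2 by rewrite divr_gt0.
have h := id_le_expR k20 t0; rewrite invf_div in h.
rewrite (_ : kap * t = 2%:R * (kap / 2 * t)); last by field.
rewrite expRM_natl -exprMn ler_pXn2r // nnegrE.
by rewrite mulr_ge0 ?expR_ge0 // divr_ge0 // ltW.
Qed.

(** The margin kap = b + Re s0 > 0 absorbs both the powers of t produced by
    differentiating e^{-2st} and the factor e^{2|h|t} of the Taylor remainder,
    as long as |h| <= kap / 2. *)
Lemma decay_kernel_diff b (s0 : C) : - b < complex.Re s0 ->
  exists c eta, [/\ 0 <= c, 0 < eta & kernel_diff b c eta decay_kernel s0
    (fun t => - (2 * t%:C) * decay_kernel s0 t)].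
Proof.
move=> bs; pose beta := - complex.Re s0; pose kap := b - beta.
have kap0 : 0 < kap by rewrite /kap /beta; lra.
pose c := 1 + 4 / kap + 16 * (2 / kap) ^+ 2.
have p1 : 0 <= 4 / kap by rewrite divr_ge0 // ltW.
have p2 : 0 <= 16 * (2 / kap) ^+ 2 by rewrite mulr_ge0 // sqr_ge0.
have c0 : 0 <= c by rewrite /c; lra.
have ne0 t : normc (decay_kernel s0 t) = expR (2 * beta * t).
  by rewrite normc_decay_kernel; congr expR; rewrite /beta; ring.
have ne h t : decay_kernel (s0 + h) t = decay_kernel s0 t * cexp (- (2 * h) * t%:C).
  by rewrite /decay_kernel -cexpD; congr cexp; ring.
have nht h t : 0 < t -> normc (- (2 * h) * t%:C) = 2 * normc h * t.
  move=> t0; rewrite Normc.normcM normc_opp Normc.normcM normc_real gtr0_norm //.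
  by rewrite normc2.
have me z : complex_measurable (decay_kernel z).
  exact: complex_measurable_cexp_real.
have mk' : complex_measurable (fun t : R => - (2 * t%:C) * decay_kernel s0 t).
  apply: complex_measurableM => //.
  rewrite (_ : (fun x : R => _) = fun t : R => (- (2 * t))%:C); last first.
    by apply/funext => t; rewrite rmorphN rmorphM /= rmorph_nat.
  by apply: complex_measurable_real; apply: measurableT_comp => //; exact: measurable_funM.
have expB t (hn : R) : 0 < t -> hn <= kap / 2 ->
    expR (kap * t) * (expR (2 * beta * t) * expR (2 * hn * t)) <= expR (2 * b * t).
  move=> t0 hk; rewrite -!expRD ler_expR -!mulrDl ler_pM2r //.
  by move: hk; rewrite /kap; lra.
have expB0 t (hn : R) : 0 < t -> hn <= kap / 2 ->
    expR (2 * beta * t) * expR (2 * hn * t) <= expR (2 * b * t).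
  move=> t0 hk; rewrite -!expRD ler_expR -!mulrDl ler_pM2r //.
  by move: hk kap0; rewrite /kap; lra.
exists c, (kap / 2); split => //; first by rewrite divr_gt0.
split.
  split => // t t0; rewrite Normc.normcM ne0.
  rewrite (_ : - (2 * t%:C) = - (2 * 1) * t%:C); last by ring.
  rewrite nht // Normc.normc1 mulr1.
  have h1 := id_le_expR kap0 (ltW t0).
  have h2 := expB t 0 t0 (ltW (divr_gt0 kap0 (ltr0Sn _ 1))).
  rewrite mulr0 mul0r expR0 mulr1 in h2.
  have h3 : 2 * t * expR (2 * beta * t) <=
      2 * (kap^-1 * expR (kap * t)) * expR (2 * beta * t).
    by rewrite ler_pM2r ?expR_gt0 // ler_pM2l.
  rewrite (le_trans h3) //.
  rewrite (_ : 2 * _ * _ = 2 / kap * (expR (kap * t) * expR (2 * beta * t))); last by ring.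
  apply: (@le_trans _ _ (2 / kap * expR (2 * b * t))).
    by rewrite ler_wpM2l // divr_ge0 // ltW.
  rewrite ler_wpM2r ?expR_ge0 // /c.
  have : 2 / kap <= 4 / kap by rewrite ler_pM2r ?invr_gt0 // ler_nat.
  lra.
move=> h /ltW hk; split.
- split => // t t0; rewrite ne Normc.normcM ne0 normc_cexp.
  have h1 : complex.Re (- (2 * h) * t%:C) <= 2 * normc h * t.
    by rewrite -nht // (le_trans (ler_norm _)) // normr_Re_le.
  apply: (@le_trans _ _ (expR (2 * beta * t) * expR (2 * normc h * t))).
    by rewrite ler_pM2l ?expR_gt0 // ler_expR.
  rewrite (le_trans (expB0 _ _ t0 hk)) // ler_peMl ?expR_ge0 // /c.
  lra.
- split; first exact: complex_measurableB.
  move=> t t0; rewrite ne -{2}[decay_kernel s0 t]mulr1 -mulrBr Normc.normcM ne0.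
  have h1 := cexpB1_le (- (2 * h) * t%:C); rewrite nht // in h1.
  have h2 := id_le_expR kap0 (ltW t0).
  have h3 := expB _ _ t0 hk.
  apply: (@le_trans _ _ (expR (2 * beta * t) *
     (2 * (2 * normc h * t * expR (2 * normc h * t))))).
    by rewrite ler_pM2l ?expR_gt0.
  rewrite (_ : _ * (2 * _) = 4 * normc h *
    (t * (expR (2 * beta * t) * expR (2 * normc h * t)))); last by ring.
  have h4 : t * (expR (2 * beta * t) * expR (2 * normc h * t)) <=
      kap^-1 * expR (2 * b * t).
    apply: (le_trans _ (ler_wpM2l _ h3)); last by rewrite invr_ge0 ltW.
    by rewrite [leRHS]mulrA ler_wpM2r // mulr_ge0 // expR_ge0.
  have h5 : 4 * normc h * (t * (expR (2 * beta * t) * expR (2 * normc h * t))) <=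
      4 * normc h * (kap^-1 * expR (2 * b * t)).
    by rewrite ler_wpM2l // mulr_ge0 // normc_ge0.
  rewrite (le_trans h5) //.
  rewrite (_ : 4 * _ * _ = 4 / kap * normc h * expR (2 * b * t)); last by ring.
  rewrite ler_wpM2r ?expR_ge0 // ler_wpM2r ?normc_ge0 // /c.
  lra.
- split.
    apply: complex_measurableB; first exact: complex_measurableB.
    by apply: complex_measurableM => //; exact: complex_measurable_cst.
  move=> t t0; rewrite ne.
  rewrite (_ : _ - _ - _ = decay_kernel s0 t *
    (cexp (- (2 * h) * t%:C) - 1 - (- (2 * h) * t%:C))); last by ring.
  rewrite Normc.normcM ne0.
  have h1 := cexpB1B_le (- (2 * h) * t%:C); rewrite nht // in h1.
  have h2 := sqr_le_expR kap0 (ltW t0).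
  have h3 := expB _ _ t0 hk.
  apply: (@le_trans _ _ (expR (2 * beta * t) *
     (4 * ((2 * normc h * t) ^+ 2 * expR (2 * normc h * t))))).
    by rewrite ler_pM2l ?expR_gt0.
  rewrite (_ : _ * (4 * _) = 16 * normc h ^+ 2 *
    (t ^+ 2 * (expR (2 * beta * t) * expR (2 * normc h * t)))); last by ring.
  have h4 : t ^+ 2 * (expR (2 * beta * t) * expR (2 * normc h * t)) <=
      (2 / kap) ^+ 2 * expR (2 * b * t).
    apply: (le_trans _ (ler_wpM2l (sqr_ge0 _) h3)).
    by rewrite [leRHS]mulrA ler_wpM2r // mulr_ge0 // expR_ge0.
  have h5 : 16 * normc h ^+ 2 * (t ^+ 2 * (expR (2 * beta * t) * expR (2 * normc h * t))) <=
      16 * normc h ^+ 2 * ((2 / kap) ^+ 2 * expR (2 * b * t)).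
    by rewrite ler_wpM2l // mulr_ge0 // sqr_ge0.
  rewrite (le_trans h5) //.
  rewrite (_ : 16 * _ * _ = 16 * (2 / kap) ^+ 2 * normc h ^+ 2 * expR (2 * b * t)); last by ring.
  rewrite ler_wpM2r ?expR_ge0 // ler_wpM2r ?sqr_ge0 // /c.
  lra.
Qed.

End Kernels.

Section FreeKernelDiff.
Variable R : realType.
Local Notation C := R[i].
Local Notation normc := (@Normc.normc R).

(** A product of r = (2s)^-1 and 1 - e^{-2st}: q, the remainder of r, is
    h^2 / (2 s0^2 (s0 + h)), and that of e^{-2st} is decay_kernel_diff. *)
Lemma free_kernel_diff b (s0 : C) : 0 <= b -> - b < complex.Re s0 -> s0 != 0 ->
  exists k' c eta, [/\ 0 <= c, 0 < eta & kernel_diff b c eta (@free_kernel R) s0 k'].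
Proof.
move=> b0 bs s00; have [c [eta [c0 eta0 [Hk' H]]]] := decay_kernel_diff bs.
have ns0 : 0 < normc s0 by rewrite normc_gt0.
set e' := fun t : R => _ in Hk' H.
pose r := (2 * s0)^-1; pose r' := - (2 * s0 ^+ 2)^-1.
pose k' t := r' * (1 - decay_kernel s0 t) + (- r) * e' t.
have e1 h : normc h < eta -> exp_kernel b (1 + c) (fun t => 1 - decay_kernel (s0 + h) t).
  move=> hh; have [h1 _ _] := H h hh.
  have := exp_kernelD (exp_kernel_cst1 b0) (exp_kernelZ (- 1) h1).
  rewrite normc_opp Normc.normc1 mul1r; apply: exp_kernel_ext => t.
  by rewrite mulN1r.
pose A := normc r' * (1 + c) + normc r * c.
pose B := (normc s0 ^+ 3)^-1 * (1 + c) + normc r' * c + normc r * c.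
pose c1 := A + (normc s0)^-1 * 2 * (1 + c) + B + A + B * eta.
have A0 : 0 <= A by rewrite !addr_ge0 ?mulr_ge0 ?normc_ge0 ?addr_ge0.
have B0 : 0 <= B.
  by rewrite !addr_ge0 ?mulr_ge0 ?normc_ge0 ?invr_ge0 ?exprn_ge0 ?normc_ge0 ?addr_ge0.
have D0 : 0 <= (normc s0)^-1 * 2 * (1 + c).
  by rewrite !mulr_ge0 ?invr_ge0 ?normc_ge0 // addr_ge0.
have BE0 : 0 <= B * eta by rewrite mulr_ge0 // ltW.
have hk' : exp_kernel b A k'.
  apply: exp_kernelD; apply: (exp_kernel_ext (fun t => erefl)).
    apply: exp_kernelZ; have := e1 0; rewrite Normc.normc0 addr0; exact.
  by have := exp_kernelZ (- r) Hk'; rewrite normc_opp.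
pose eta1 := Num.min eta (normc s0 / 2).
have eta10 : 0 < eta1 by rewrite lt_min eta0 divr_gt0.
exists k', c1, eta1; split=> //; first by rewrite /c1; lra.
split; first by apply: exp_kernel_le hk'; rewrite /c1; lra.
move=> h; rewrite lt_min => /andP[he hs].
have nh0 : 0 <= normc h by exact: normc_ge0.
have nsh : normc s0 / 2 <= normc (s0 + h).
  have : normc s0 <= normc (s0 + h) + normc h.
    by rewrite -{1}[s0](addrK h) normcB_le.
  lra.
have sh0 : s0 + h != 0 by rewrite -normc_gt0 (lt_le_trans _ nsh) // divr_gt0.
have [h1 h2 h3] := H h he.
have d2 : exp_kernel b (B * normc h ^+ 2)
    (fun t => free_kernel (s0 + h) t - free_kernel s0 t - h * k' t).
  pose q := (2 * (s0 + h))^-1 - r - h * r'.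
  have qE : q = h ^+ 2 / (2 * s0 ^+ 2 * (s0 + h)).
    by rewrite /q /r /r'; field; rewrite s00 sh0.
  have nq : normc q <= (normc s0 ^+ 3)^-1 * normc h ^+ 2.
    rewrite qE Normc.normcM Normc.normcV !Normc.normcM normc2 -!expr2 mulrC.
    rewrite ler_wpM2r ?sqr_ge0 // lef_pV2 ?posrE ?exprn_gt0 //.
      rewrite (_ : normc s0 ^+ 3 = 2 * normc s0 ^+ 2 * (normc s0 / 2)); last by field.
      by rewrite ler_wpM2l // mulr_ge0 // sqr_ge0.
    by rewrite !mulr_gt0 ?exprn_gt0 // normc_gt0.
  have H3 := exp_kernelD (exp_kernelD (exp_kernelZ q (e1 h he))
    (exp_kernelZ (- (h * r')) h2)) (exp_kernelZ (- r) h3).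
  apply: exp_kernel_ext (exp_kernel_le _ H3).
    by move=> t; rewrite /free_kernel -/r /q /k' /e'; ring.
  rewrite !normc_opp Normc.normcM /B !mulrDl; apply: lerD; first apply: lerD.
  - rewrite [leRHS]mulrAC; apply: ler_wpM2r => //; first by rewrite addr_ge0.
  - by rewrite le_eqVlt; apply/orP; left; apply/eqP; ring.
  - by rewrite le_eqVlt; apply/orP; left; apply/eqP; ring.
split.
- have := exp_kernelZ ((2 * (s0 + h))^-1) (e1 h he).
  apply: exp_kernel_le; rewrite Normc.normcV Normc.normcM normc2.
  apply: (@le_trans _ _ ((normc s0)^-1 * 2 * (1 + c))); last by rewrite /c1; lra.
  rewrite ler_wpM2r ?addr_ge0 //.
  rewrite (_ : (normc s0)^-1 * 2 = (normc s0 / 2)^-1); last by rewrite invf_div mulrC.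
  rewrite lef_pV2 ?posrE ?divr_gt0 //; last by rewrite mulr_gt0 // normc_gt0.
  by rewrite (le_trans nsh) // ler_peMl ?normc_ge0 // ler1n.
- have := exp_kernelD d2 (exp_kernelZ h hk').
  move=> H4; apply: exp_kernel_ext (exp_kernel_le _ H4).
    by move=> t; rewrite subrK.
  have : B * normc h ^+ 2 <= B * eta * normc h.
    by rewrite expr2 mulrA ler_wpM2r // ler_wpM2l // ltW.
  have m1 : 0 <= A * normc h by rewrite mulr_ge0.
  have m2 : 0 <= B * normc h by rewrite mulr_ge0.
  have m3 : 0 <= (normc s0)^-1 * 2 * (1 + c) * normc h by rewrite mulr_ge0.
  by rewrite /c1; lra.
- apply: exp_kernel_le d2; rewrite ler_wpM2r ?sqr_ge0 // /c1; lra.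
Qed.

End FreeKernelDiff.

(** * The Jost function and its dependence on s *)

Section JostSolution.
Variable R : realType.
Local Notation C := R[i].
Local Notation mu := (@lebesgue_measure R).
Local Notation normc := (@Normc.normc R).

(** The Volterra equation of m = e^{sx} mu_+. The growth bound is part of the
    notion because it is what makes the solution unique. *)
Definition jost_sol (V : R -> C) (b : R) (s : C) (m : R -> C) : Prop :=
  [/\ complex_measurable m,
    exists N, forall x, normc (m x) <= N * growth b x &
    forall x, m x = 1 + volterra V (free_kernel s) m x].

Lemma growth_ge1 b (x : R) : 0 <= b -> 1 <= growth b x.
Proof.
by move=> b0; rewrite /growth -expR0 ler_expR mulr_ge0 // subr_ge0 ler_norm.
Qed.

Lemma jost_sol_mono (V : R -> C) (b b' : R) (s : C) (m : R -> C) :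
  b <= b' -> jost_sol V b s m -> jost_sol V b' s m.
Proof.
move=> bb [mm [N HN] mE]; split => //; exists N => x; rewrite (le_trans (HN x)) //.
have N0 : 0 <= N.
  rewrite -(@pmulr_lge0 _ (growth b x)) ?expR_gt0 //.
  exact: (le_trans (normc_ge0 _) (HN x)).
by rewrite ler_wpM2l // ler_expR ler_wpM2r // subr_ge0 ler_norm.
Qed.

Section FixedWeight.
Variables (V : R -> C) (b eps : R) (rho : R -> R).
Hypothesis b0 : 0 <= b.
Hypothesis mV : complex_measurable V.
Hypothesis Vrho : volterra_weight V b eps rho.

Let W x := growth b x * rho x.

Lemma weight_ge1 x : 1 <= W x.
Proof.
have [_ /(_ x) r1 _ _] := Vrho; rewrite -[1]mulr1.
by apply: ler_pM => //; exact: growth_ge1.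
Qed.

Lemma weight_ge0 x : 0 <= W x.
Proof. exact: (le_trans ler01 (weight_ge1 x)). Qed.

Lemma wbounded1 : wbounded W 1 (fun=> 1 : C).
Proof.
split; first exact: complex_measurable_cst.
by move=> x; rewrite Normc.normc1 mul1r weight_ge1.
Qed.

Lemma wbounded_le N N' f : N <= N' -> wbounded W N f -> wbounded W N' f.
Proof.
move=> NN [mf bf]; split => // x; rewrite (le_trans (bf x)) //.
by rewrite ler_wpM2r // weight_ge0.
Qed.

Lemma wboundedZ N f (z : C) : wbounded W N f ->
  wbounded W (normc z * N) (fun x => z * f x).
Proof.
move=> [mf bf]; split.
  by apply: complex_measurableM => //; exact: complex_measurable_cst.
by move=> x; rewrite Normc.normcM -[leRHS]mulrA ler_wpM2l ?normc_ge0.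
Qed.

Lemma growth_wbounded N f : complex_measurable f ->
  (forall x, normc (f x) <= N * growth b x) -> wbounded W `|N| f.
Proof.
move=> mf bf; split => // x; rewrite (le_trans (bf x)) // /W mulrA.
have [_ /(_ x) r1 _ _] := Vrho.
apply: (@le_trans _ _ (`|N| * growth b x)).
  by rewrite ler_wpM2r ?expR_ge0 // ler_norm.
by rewrite ler_peMr // mulr_ge0 // expR_ge0.
Qed.

Lemma volterraB c N k f g x : 0 <= c -> 0 <= N -> exp_kernel b c k ->
  wbounded W N f -> wbounded W N g ->
  volterra V k (fun y => f y - g y) x = volterra V k f x - volterra V k g x.
Proof.
move=> c0 N0 hk hf hg; rewrite -mulN1r.
have hg' : wbounded W N (fun y => -1 * g y).
  by have := wboundedZ (-1) hg; rewrite normc_opp Normc.normc1 mul1r.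
rewrite -(volterraZ b0 mV Vrho (-1) x c0 N0 hk hg).
rewrite -(volterraD b0 mV Vrho x c0 N0 hk hf hg').
by congr (volterra V k _ x); apply/funext => y; rewrite mulN1r.
Qed.

Lemma volterra_wbounded c N k f : 0 <= c -> 0 <= N -> exp_kernel b c k ->
  wbounded W N f -> wbounded W (c * N * eps) (volterra V k f).
Proof.
move=> c0 N0 hk hf; split.
  by apply: measurable_volterra => //; [case: hk|case: hf].
by move=> x; apply: (volterra_le b0 mV Vrho _ c0 N0 hk hf).
Qed.

Variables (c : R) (k : R -> C).
Hypothesis c0 : 0 <= c.
Hypothesis hk : exp_kernel b c k.
Hypothesis ceps : c * eps <= 2^-1.

Let T_half N f : 0 <= N -> wbounded W N f -> wbounded W (N / 2) (volterra V k f).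
Proof.
move=> N0 hf; apply: wbounded_le (volterra_wbounded c0 N0 hk hf).
by rewrite mulrAC mulrC ler_wpM2l.
Qed.

Let TB N f g x : 0 <= N -> wbounded W N f -> wbounded W N g ->
  volterra V k (fun y => f y - g y) x = volterra V k f x - volterra V k g x.
Proof. by move=> N0 hf hg; exact: volterraB c0 N0 hk hf hg. Qed.

Lemma volterra_apriori N N' g m : 0 <= N -> 0 <= N' ->
  (forall x, normc (g x) <= N * W x) -> wbounded W N' m ->
  (forall x, m x = g x + volterra V k m x) -> wbounded W (2 * N) m.
Proof. exact: (contraction_apriori weight_ge0 T_half). Qed.

Lemma volterra_solve N g : 0 <= N -> wbounded W N g ->
  exists m, wbounded W (2 * N) m /\ forall x, m x = g x + volterra V k m x.
Proof. exact: (contraction_exists weight_ge0 T_half TB). Qed.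

End FixedWeight.

Lemma potential_weight (a b eps : R) (V : R -> C) : potential a V -> b < a -> 0 < eps ->
  exists rho B, volterra_weight V b eps rho /\ forall x, rho x <= B.
Proof.
move=> pV ba e0; have [rho [B [m1 m2 m3 m4]]] := exists_volterra_weight pV ba e0.
exists rho, B; split; last by move=> x; have /andP[] := m2 x.
by split => // x; have /andP[] := m2 x.
Qed.

(** The kernel is bounded by e^{2bt} / |s|; a weight with eps = |s| / 2 makes the
    operator a contraction of ratio 1/2. *)
Lemma jost_exists (a b : R) (s : C) (V : R -> C) : potential a V -> 0 <= b -> b < a ->
  - b <= complex.Re s -> s != 0 -> exists m, jost_sol V b s m.
Proof.
move=> pV b0 ba bs s0; have ns0 : 0 < normc s by rewrite normc_gt0.
have [rho [B [hr rB]]] := potential_weight pV ba (divr_gt0 ns0 (ltr0Sn _ 1)).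
have mV : complex_measurable V by case: pV.
have hk := free_kernel_exp b0 bs s0.
have ce : (normc s)^-1 * (normc s / 2) <= 2^-1 by rewrite mulKf // gt_eqF.
have c0 : 0 <= (normc s)^-1 by rewrite invr_ge0 ltW.
have [m [[mm bm] mE]] := volterra_solve b0 mV hr c0 hk ce ler01 (wbounded1 b0 hr).
exists m; split => //; exists (2 * B) => x; rewrite (le_trans (bm x)) //.
rewrite mulr1 -[leRHS]mulrA ler_pM2l // mulrC ler_wpM2r //.
by rewrite expR_ge0.
Qed.

Lemma jost_unique (a b : R) (s : C) (V m m' : R -> C) :
  potential a V -> 0 <= b -> b < a ->
  - b <= complex.Re s -> s != 0 -> jost_sol V b s m -> jost_sol V b s m' ->
  m = m'.
Proof.
move=> pV b0 ba bs s0 [mm [N HN] mE] [mm' [N' HN'] mE'].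
have ns0 : 0 < normc s by rewrite normc_gt0.
have [rho [B [hr rB]]] := potential_weight pV ba (divr_gt0 ns0 (ltr0Sn _ 1)).
have mV : complex_measurable V by case: pV.
have hk := free_kernel_exp b0 bs s0.
have ce : (normc s)^-1 * (normc s / 2) <= 2^-1 by rewrite mulKf // gt_eqF.
have c0 : 0 <= (normc s)^-1 by rewrite invr_ge0 ltW.
have w0 x := weight_ge0 b0 hr x.
have hm : wbounded (fun x => growth b x * rho x) (`|N| + `|N'|) m.
  by apply: (wbounded_le b0 hr _ (growth_wbounded hr mm HN)); rewrite lerDl.
have hm' : wbounded (fun x => growth b x * rho x) (`|N| + `|N'|) m'.
  by apply: (wbounded_le b0 hr _ (growth_wbounded hr mm' HN')); rewrite lerDr.
have NN : 0 <= `|N| + `|N'| by rewrite addr_ge0.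
have NN2 : 0 <= `|N| + `|N'| + (`|N| + `|N'|) by rewrite addr_ge0.
have hd := wboundedB hm hm'.
have z0 (x : R) : normc (0 : C) <= 0 * (growth b x * rho x).
  by rewrite Normc.normc0 mul0r.
have hE x : m x - m' x = 0 + volterra V (free_kernel s) (fun y => m y - m' y) x.
  rewrite add0r (volterraB b0 mV hr x c0 NN hk hm hm') {1}mE {1}mE'; ring.
have [_ h] := volterra_apriori b0 mV hr c0 hk ce (lexx 0) NN2 z0 hd hE.
apply/funext => x; apply/eqP; rewrite -subr_eq0; apply/eqP.
apply: Normc.eq0_normc; apply/eqP; rewrite eq_le normc_ge0 andbT.
by rewrite (le_trans (h x)) // mulr0 mul0r.
Qed.

End JostSolution.

Section JostDifferentiable.
Variable R : realType.
Local Notation C := R[i].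
Local Notation normc := (@Normc.normc R).

Section Expansion.
Variables (V : R -> C) (b eps : R) (rho : R -> R).
Hypothesis b0 : 0 <= b.
Hypothesis mV : complex_measurable V.
Hypothesis Vrho : volterra_weight V b eps rho.
Let W x := growth b x * rho x.

Lemma volterra_kernelB c N k l f x : 0 <= c -> 0 <= N -> exp_kernel b c k ->
  exp_kernel b c l -> wbounded W N f ->
  volterra V (fun t => k t - l t) f x = volterra V k f x - volterra V l f x.
Proof.
move=> c0 N0 hk hl hf; rewrite -mulN1r.
have hl' : exp_kernel b c (fun t => -1 * l t).
  by have := exp_kernelZ (-1) hl; rewrite normc_opp Normc.normc1 mul1r.
rewrite -(volterra_kernelZ b0 mV Vrho (-1) x c0 N0 hl hf).
rewrite -(volterra_kernelD b0 mV Vrho x c0 N0 hk hl' hf).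
by congr (volterra V _ f x); apply/funext => y; rewrite mulN1r.
Qed.

(** The product rule for volterra k_s m_s with its exact remainder; k1, m1 are the
    kernel and the function at s0 + h, and n stands for the derivative of m. *)
Lemma volterra_expand c N k0 k1 k' m0 m1 n h x : 0 <= c -> 0 <= N ->
  exp_kernel b c k0 -> exp_kernel b c k1 -> exp_kernel b c k' ->
  wbounded W N m0 -> wbounded W N m1 -> wbounded W N n ->
  volterra V k1 m1 x - volterra V k0 m0 x
    - h * (volterra V k' m0 x + volterra V k0 n x) =
  volterra V k0 (fun y => m1 y - m0 y - h * n y) x +
  volterra V (fun t => k1 t - k0 t - h * k' t) m1 x +
  h * volterra V k' (fun y => m1 y - m0 y) x.
Proof.
move=> c0 N0 hk0 hk1 hk' hm0 hm1 hn.
have h0 : 0 <= normc h by exact: normc_ge0.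
pose N2 := N + N + normc h * N; pose c2 := c + c + normc h * c.
have NN2 : N <= N2 by rewrite /N2 -addrA lerDl addr_ge0 // mulr_ge0.
have cc2 : c <= c2 by rewrite /c2 -addrA lerDl addr_ge0 // mulr_ge0.
have N20 : 0 <= N2 by exact: le_trans NN2.
have c20 : 0 <= c2 by exact: le_trans cc2.
have Wle := wbounded_le b0 Vrho.
have hd : wbounded W N2 (fun y => m1 y - m0 y).
  by apply: (Wle _ _ _ _ (wboundedB hm1 hm0)); rewrite /N2 lerDl mulr_ge0.
have hhn : wbounded W N2 (fun y => h * n y).
  by apply: (Wle _ _ _ _ (wboundedZ h hn)); rewrite /N2 lerDr addr_ge0.
have kd : exp_kernel b c2 (fun t => k1 t - k0 t).
  have := exp_kernelD hk1 (exp_kernelZ (-1) hk0).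
  rewrite normc_opp Normc.normc1 mul1r => kd.
  apply: exp_kernel_ext (exp_kernel_le _ kd); first by move=> t; rewrite mulN1r.
  by rewrite /c2 lerDl mulr_ge0.
have khk : exp_kernel b c2 (fun t => h * k' t).
  by apply: exp_kernel_le (exp_kernelZ h hk'); rewrite /c2 lerDr addr_ge0.
have hm1' := Wle _ _ _ NN2 hm1; have hm0' := Wle _ _ _ NN2 hm0.
rewrite (volterraB b0 mV Vrho x c0 N20 hk0 hd hhn).
rewrite (volterraB b0 mV Vrho x c0 N0 hk0 hm1 hm0).
rewrite (volterraZ b0 mV Vrho h x c0 N0 hk0 hn).
rewrite (volterra_kernelB x c20 N0 kd khk hm1).
rewrite (volterra_kernelB x c0 N0 hk1 hk0 hm1).
rewrite (volterra_kernelZ b0 mV Vrho h x c0 N0 hk' hm1).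
rewrite (volterraB b0 mV Vrho x c0 N0 hk' hm1 hm0).
ring.
Qed.

Lemma volterra_expand_le c N k0 k1 k' m0 m1 n h x M : 0 <= c -> 0 <= N ->
  0 <= M -> 0 <= eps ->
  exp_kernel b c k0 -> exp_kernel b c k1 -> exp_kernel b c k' ->
  exp_kernel b (c * normc h ^+ 2) (fun t => k1 t - k0 t - h * k' t) ->
  wbounded W N m0 -> wbounded W N m1 -> wbounded W N n ->
  wbounded W (M * normc h) (fun y => m1 y - m0 y) ->
  normc (volterra V k1 m1 x - volterra V k0 m0 x
    - h * (volterra V k' m0 x + volterra V k0 n x)
    - volterra V k0 (fun y => m1 y - m0 y - h * n y) x) <=
  c * (N + M) * eps * normc h ^+ 2 * W x.
Proof.
move=> c0 N0 M0 eps0 hk0 hk1 hk' hk2 hm0 hm1 hn hd.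
rewrite (volterra_expand h x c0 N0 hk0 hk1 hk' hm0 hm1 hn).
rewrite [X in normc X](_ : _ = volterra V (fun t => k1 t - k0 t - h * k' t) m1 x +
  h * volterra V k' (fun y => m1 y - m0 y) x); last by ring.
have h0 : 0 <= normc h by exact: normc_ge0.
have l1 := volterra_le b0 mV Vrho x (mulr_ge0 c0 (sqr_ge0 _)) N0 hk2 hm1.
have l2 := volterra_le b0 mV Vrho x c0 (mulr_ge0 M0 h0) hk' hd.
rewrite (le_trans (normcD_le _ _)) // Normc.normcM.
rewrite (le_trans (lerD l1 (ler_wpM2l h0 l2))) //.
by rewrite le_eqVlt; apply/orP; left; apply/eqP; rewrite /W; ring.
Qed.

End Expansion.

(** Complex differentiability of m_s(x), and of the integral giving - m_s'(x),
    with respect to s. All comparisons are a priori bounds for the Volterra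
    equation at s0: m_{s0+h} - m_{s0} has a source of order h, and subtracting
    h n leaves a source of order h^2. *)
Lemma jost_differentiable (a b eta : R) (s0 : C) (V : R -> C)
    (m : C -> R -> C) (x : R) :
  potential a V -> 0 <= b -> b < a -> - b < complex.Re s0 -> s0 != 0 ->
  0 < eta -> (forall h, normc h < eta -> jost_sol V b (s0 + h) (m (s0 + h))) ->
  exists (n0 n1 : C) (K eta' : R), 0 < eta' /\ forall h, normc h < eta' ->
    normc (m (s0 + h) x - m s0 x - h * n0) <= K * normc h ^+ 2 /\
    normc (volterra V (decay_kernel (s0 + h)) (m (s0 + h)) x
           - volterra V (decay_kernel s0) (m s0) x - h * n1)
      <= K * normc h ^+ 2.
Proof.
move=> pV b0 ba bs s00 eta0 hm.
have mV : complex_measurable V by case: pV.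
have [k' [cK [etaK [cK0 etaK0 [hk' HK]]]]] := free_kernel_diff b0 bs s00.
have [cE [etaE [cE0 etaE0 [he' HE]]]] := decay_kernel_diff bs.
set e' := fun t : R => _ in he' HE.
pose eps := (2 * (cK + 1))^-1.
have cK1 : 0 < cK + 1 by rewrite ltr_wpDl.
have eps0 : 0 < eps by rewrite invr_gt0 mulr_gt0.
have ce : cK * eps <= 2^-1.
  rewrite /eps invfM mulrCA ler_piMr // ?invr_ge0 //.
  by rewrite ler_pdivrMr // mul1r lerDl.
have [rho [B [hr _]]] := potential_weight pV ba eps0.
pose W y := growth b y * rho y.
have W0 y : 0 <= W y := weight_ge0 b0 hr y.
have Wle := wbounded_le b0 hr.
pose etam := Num.min eta (Num.min etaK (Num.min etaE 1)).
have etam0 : 0 < etam by rewrite !lt_min eta0 etaK0 etaE0 ltr01.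
have hm2 h : normc h < etam -> wbounded W 2 (m (s0 + h)).
  rewrite !lt_min => /and4P[h1 h2 _ _].
  have [mm [N HN] mE] := hm h h1; have [hk _ _] := HK h h2.
  have := volterra_apriori b0 mV hr cK0 hk ce ler01 (normr_ge0 N) _
    (growth_wbounded hr mm HN) mE.
  by rewrite mulr1; apply => y; have [_ /(_ y)] := wbounded1 b0 hr.
have z0 : normc (0 : C) < etam by rewrite Normc.normc0.
have m0 : wbounded W 2 (m s0) by have := hm2 0 z0; rewrite addr0.
have mE0 y : m s0 y = 1 + volterra V (free_kernel s0) (m s0) y.
  have zeta : normc (0 : C) < eta by rewrite Normc.normc0.
  by have [_ _ mE] := hm 0 zeta; rewrite addr0 in mE; exact: mE.
have hk0 : exp_kernel b cK (free_kernel s0).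
  have zetaK : normc (0 : C) < etaK by rewrite Normc.normc0.
  by have [h1 _ _] := HK 0 zetaK; rewrite addr0 in h1.
have he0 : exp_kernel b cE (decay_kernel s0).
  have zetaE : normc (0 : C) < etaE by rewrite Normc.normc0.
  by have [h1 _ _] := HE 0 zetaE; rewrite addr0 in h1.
(* n is the candidate derivative: it solves the equation of m differentiated
   formally in s *)
pose Ng := cK * 2 * eps.
have Ng0 : 0 <= Ng by rewrite !mulr_ge0 // ltW.
have hg : wbounded W Ng (volterra V k' (m s0)).
  exact: (volterra_wbounded b0 mV hr cK0 _ hk' m0).
have [n [hn nE]] := volterra_solve b0 mV hr cK0 hk0 ce Ng0 hg.
pose N := 2 + 2 * Ng.
have N0 : 0 <= N by rewrite addr_ge0 // mulr_ge0.
have N2 : 2 <= N by rewrite /N lerDl mulr_ge0.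
have {}hn : wbounded W N n by apply: Wle hn; rewrite /N lerDr.
pose M := 2 * (cK * 2 * eps).
have M0 : 0 <= M by rewrite mulr_ge0.
have lip h : normc h < etam -> wbounded W (M * normc h) (fun y => m (s0 + h) y - m s0 y).
  move=> hh; have hm1 := hm2 h hh; move: hh; rewrite !lt_min => /and4P[h1 h2 _ _].
  have [_ _ mE1] := hm h h1; have [hk1 hkd _] := HK h h2.
  have h0 : 0 <= normc h by exact: normc_ge0.
  have cN0 : 0 <= cK * normc h * 2 * eps by rewrite !mulr_ge0 // ltW.
  rewrite (_ : M * normc h = 2 * (cK * normc h * 2 * eps)); last by rewrite /M; ring.
  apply: (volterra_apriori b0 mV hr cK0 hk0 ce cN0 _ _ (wboundedB hm1 m0)
    (g := volterra V (fun t => free_kernel (s0 + h) t - free_kernel s0 t) (m (s0 + h)))).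
  - by rewrite addr_ge0.
  - by move=> y; apply: (volterra_le b0 mV hr y (mulr_ge0 cK0 h0) _ hkd hm1).
  - move=> y; rewrite (volterra_kernelB b0 mV hr y cK0 _ hk1 hk0 hm1) //.
    rewrite (volterraB b0 mV hr y cK0 _ hk0 hm1 m0) // mE1 mE0; ring.
pose K1 := 2 * (cK * (N + M) * eps).
have K10 : 0 <= K1 by rewrite !mulr_ge0 ?addr_ge0 // ltW.
(* the remainder r solves a Volterra equation with the kernel at s0, whose
   source r - volterra r is the O(h^2) term of the expansion *)
have rem h : normc h < etam ->
    wbounded W (K1 * normc h ^+ 2) (fun y => m (s0 + h) y - m s0 y - h * n y).
  move=> hh; have hm1 := hm2 h hh; have hl := lip h hh.
  move: hh; rewrite !lt_min => /and4P[h1 h2 _ _].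
  have [_ _ mE1] := hm h h1; have [hk1 hkd hkd2] := HK h h2.
  have h0 : 0 <= normc h by exact: normc_ge0.
  have cN0 : 0 <= cK * (N + M) * eps * normc h ^+ 2.
    by rewrite !mulr_ge0 ?addr_ge0 ?sqr_ge0 // ltW.
  rewrite (_ : K1 * _ = 2 * (cK * (N + M) * eps * normc h ^+ 2)); last by rewrite /K1; ring.
  pose r y := m (s0 + h) y - m s0 y - h * n y.
  apply: (volterra_apriori b0 mV hr cK0 hk0 ce cN0 _ _
    (wboundedB hl (wboundedZ h hn)) (g := fun y =>
      r y - volterra V (free_kernel s0) r y)).
  - by rewrite addr_ge0 // mulr_ge0.
  - move=> y; have := volterra_expand_le b0 mV hr (h := h) y cK0 N0 M0 (ltW eps0)
      hk0 hk1 hk' hkd2 (Wle _ _ _ N2 m0) (Wle _ _ _ N2 hm1) hn hl.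
    congr (normc _ <= _); rewrite -/r; congr (_ - _).
    by rewrite /r mE1 (mE0 y) (nE y); ring.
  - by move=> y; rewrite subrK.
pose K2 := cE * (N + M) * eps + cE * K1 * eps.
exists (n x), (volterra V e' (m s0) x + volterra V (decay_kernel s0) n x).
exists (K1 * W x + K2 * W x), etam; split=> // h hh.
have hr1 := rem h hh; have hl := lip h hh; have hm1 := hm2 h hh.
have h0 : 0 <= normc h by exact: normc_ge0.
have K20 : 0 <= K2.
  by rewrite addr_ge0 // ?mulr_ge0 ?addr_ge0 // ltW.
split.
  have [_ /(_ x) h1] := hr1; rewrite (le_trans h1) //.
  by rewrite mulrAC ler_wpM2r ?sqr_ge0 // lerDl mulr_ge0.
move: hh; rewrite !lt_min => /and4P[_ _ h3 _].
have [he1 _ hed2] := HE h h3.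
have l1 := volterra_expand_le b0 mV hr (h := h) x cE0 N0 M0 (ltW eps0)
  he0 he1 he' hed2 (Wle _ _ _ N2 m0) (Wle _ _ _ N2 hm1) hn hl.
have l2 := volterra_le b0 mV hr x cE0 (mulr_ge0 K10 (sqr_ge0 (normc h))) he0 hr1.
rewrite -[X in normc X](subrK (volterra V (decay_kernel s0)
  (fun y => m (s0 + h) y - m s0 y - h * n y) x)).
rewrite (le_trans (normcD_le _ _)) // (le_trans (lerD l1 l2)) //.
rewrite -/(W x) mulrDl.
apply: (@le_trans _ _ (K2 * W x * normc h ^+ 2)).
  by rewrite le_eqVlt; apply/orP; left; apply/eqP; rewrite /K2; ring.
by rewrite lerDr mulr_ge0 ?sqr_ge0 // mulr_ge0.
Qed.

End JostDifferentiable.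

(** * Jost solutions of the Schrodinger equation *)

Section LocalTransfer.
Variable R : realType.
Local Notation C := R[i].
Local Notation mu := (@lebesgue_measure R).

Lemma loc_abs_cont_local (f : R -> R) :
  (forall b, exists2 g, locally_abs_continuous g & forall x, b <= x -> f x = g x) ->
  locally_abs_continuous f.
Proof.
move=> H b c e e0; have [g acg fg] := H b; have [d d0 Hd] := acg b c e e0.
exists d => // n u v uv dis sd; have := Hd n u v uv dis sd.
under eq_bigr => i _.
  have [bu uvi _] := uv i; rewrite -fg; last exact: (le_trans bu).
  by rewrite -fg //; over.
by [].
Qed.

Lemma loc_abs_contC_local (f : R -> C) :
  (forall b, exists2 g, locally_abs_continuousC g & forall x, b <= x -> f x = g x) ->
  locally_abs_continuousC f.
Proof.
move=> H; split; apply: loc_abs_cont_local => b; have [g [g1 g2] fg] := H b.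
  by exists (fun x => complex.Re (g x)) => // x /fg ->.
by exists (fun x => complex.Im (g x)) => // x /fg ->.
Qed.

Lemma is_derive_local (f g : R -> R) (b x l : R) : b < x ->
  (forall y, b <= y -> f y = g y) -> is_derive x 1 g l -> is_derive x 1 f l.
Proof.
move=> bx fg /is_derive_epsP dg; apply/is_derive_epsP => e e0.
have [eta eta0 H] := dg e e0; exists (Num.min eta (x - b)).
  by rewrite lt_min eta0 subr_gt0.
move=> y; rewrite lt_min => /andP[h1]; rewrite ltr_distl => /andP[h2 _].
by rewrite !fg ?H //; [exact: ltW|lra].
Qed.

Lemma is_cderive_local (f g : R -> C) (b x : R) l : b < x ->
  (forall y, b <= y -> f y = g y) -> is_cderive g x l -> is_cderive f x l.
Proof.
move=> bx fg [d1 d2]; split.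
  by apply: (is_derive_local bx _ d1) => y /fg ->.
by apply: (is_derive_local bx _ d2) => y /fg ->.
Qed.

Variable f : R -> C.
Hypothesis mf : complex_measurable f.
Hypothesis intf : forall x, cintegrable `]x, +oo[ f.

Let cut (n : nat) y := if - n%:R < y then f y else 0.

Let cut_integrable n : cintegrable setT (cut n).
Proof.
have [i1 i2] := intf (- n%:R).
have mD : measurable (`](- n%:R), +oo[%classic : set (measurableTypeR R)).
  exact: measurable_itv.
have E (phi : C -> R) : phi 0 = 0 -> EFin \o (fun y => phi (cut n y)) =
    (EFin \o (fun y => phi (f y))) \_ `](- n%:R), +oo[%classic.
  move=> p0; apply/funext => y; rewrite patchE /cut /=.
  by rewrite mem_setE in_itv /= andbT; case: ifP => //=; rewrite p0.
split; rewrite E //; exact/(integrable_mkcond _ mD).1.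
Qed.

Let cut_tail n x : - n%:R <= x -> cintegral `]x, +oo[ f = cintegral `]x, +oo[ (cut n).
Proof.
move=> nx; apply: eq_cintegral => y /=; rewrite in_itv /= andbT => xy.
by rewrite /cut (le_lt_trans nx xy).
Qed.

Let exists_nat_lt (b : R) : exists n : nat, - n%:R < b.
Proof.
have := archi_boundP (normr_ge0 b) => h; exists (Num.bound `|b|).
by rewrite ltrNl (le_lt_trans _ h) // -normrN ler_norm.
Qed.

Lemma local_tail_loc_abs_cont :
  locally_abs_continuousC (fun x => cintegral `]x, +oo[ f).
Proof.
apply: loc_abs_contC_local => b; have [n nb] := exists_nat_lt b.
exists (fun x => cintegral `]x, +oo[ (cut n)).
  exact: tail_cintegral_loc_abs_cont.
by move=> x bx; apply: cut_tail; rewrite (le_trans (ltW nb)).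
Qed.

(** For s with large real part e^{-2sy} V m need not be integrable near - oo, hence
    the local version of tail_cintegral_derive, by cutting f off at - n. *)
Lemma local_tail_derive :
  {ae mu, forall x, is_cderive (fun x => cintegral `]x, +oo[ f) x (- f x)}.
Proof.
have := ae_foralln (fun n => tail_cintegral_derive (cut_integrable n)).
apply: ae_mono => x H; have [n nx] := exists_nat_lt x.
apply: (is_cderive_local nx (cut_tail (n := n))).
have -> : - f x = - cut n x by rewrite /cut nx.
exact: H.
Qed.

End LocalTransfer.

Section JostODE.
Variable R : realType.
Local Notation C := R[i].
Local Notation mu := (@lebesgue_measure R).
Local Notation normc := (@Normc.normc R).

Variables (a b : R) (s : C) (V m : R -> C).
Hypothesis pV : potential a V.
Hypothesis b0 : 0 <= b.
Hypothesis ba : b < a.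
Hypothesis bs : - b <= complex.Re s.
Hypothesis s0 : s != 0.
Hypothesis hm : jost_sol V b s m.

(* J is - m', see jost_derive *)
Let J := volterra V (decay_kernel s) m.

Let mV : complex_measurable V. Proof. by case: pV. Qed.

Lemma jost_bounded : exists2 N, 0 <= N &
  forall x, normc (m x) <= N * growth b x /\ normc (J x) <= N * growth b x.
Proof.
have [rho [B [hr rB]]] := potential_weight pV ba ltr01.
have [mm [N HN] _] := hm; have hmm := growth_wbounded hr mm HN.
have hk := decay_kernel_exp bs.
have B0 : 0 <= B.
  by have [_ /(_ 0) h _ _] := hr; rewrite (le_trans _ (rB 0)) // (le_trans _ h).
exists (`|N| * (1 + B)); first by rewrite mulr_ge0 // addr_ge0.
move=> x; split.
  rewrite (le_trans (HN x)) // ler_wpM2r ?expR_ge0 // (le_trans (ler_norm _)) //.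
  by rewrite ler_peMr // lerDl.
rewrite (le_trans (volterra_le b0 mV hr x ler01 (normr_ge0 N) hk hmm)) //.
rewrite mul1r mulr1 -[leRHS]mulrA ler_wpM2l // mulrC ler_wpM2r ?expR_ge0 //.
by rewrite (le_trans (rB x)) // lerDr.
Qed.

(** With b < b' < a, the kernel bound e^{2b(y-x)} leaves a factor e^{-2(b'-b)x}
    in front of the integral of |V| e^{2b'|y|}. *)
Lemma jost_decay : exists K kap, 0 < kap /\ forall x, 0 <= x ->
  normc (m x - 1) <= K * expR (- kap * x) /\ normc (J x) <= K * expR (- kap * x).
Proof.
have [b' bb' b'a] : exists2 b', b < b' & b' < a.
  by exists ((a + b) / 2); move: ba => ?; lra.
have [rho [B [hr rB]]] := potential_weight pV b'a ltr01.
have [N N0 HN] := jost_bounded.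
have [mm _ mE] := hm.
have [_ r1 ir tr] := hr.
pose q y := normc (V y) * expR (2 * b' * `|y|) * rho y.
have q0 y : 0 <= q y.
  rewrite !mulr_ge0 ?normc_ge0 ?expR_ge0 //; exact: (le_trans ler01 (r1 y)).
pose kap := 2 * (b' - b); have kap0 : 0 < kap by rewrite mulr_gt0 // subr_gt0.
have key c k x : 0 <= c -> 0 <= x -> exp_kernel b c k ->
    normc (volterra V k m x) <= c * N * B * expR (- kap * x).
  move=> c0 x0 [mk bk].
  have iq : mu.-integrable (`]x, +oo[%classic : set (measurableTypeR R))
    (EFin \o (fun y => c * N * expR (- kap * x) * q y)).
    by apply: integrable_scale => //; exact: (integrableS measurableT).
  apply: (@le_trans _ _ (Rintegral mu `]x, +oo[
      (fun y => c * N * expR (- kap * x) * q y))).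
    apply: cintegral_le => //.
      apply: complex_measurableM; last exact: complex_measurableM.
      have ms : measurable_fun setT (fun y : R => y - x) by exact: measurable_funB.
      by case: mk => k1 k2; split; [exact: (measurableT_comp k1 ms)|
        exact: (measurableT_comp k2 ms)].
    move=> y /=; rewrite in_itv /= andbT => xy.
    have y0 : 0 < y by exact: le_lt_trans xy.
    rewrite !Normc.normcM.
    have h1 : normc (k (y - x)) <= c * expR (2 * b * (y - x)).
      by apply: bk; rewrite subr_gt0.
    have h2 : normc (m y) <= N.
      have [+ _] := HN y; rewrite /growth gtr0_norm // subrr mulr0 expR0 mulr1; exact.
    apply: (@le_trans _ _ (c * expR (2 * b * (y - x)) * (normc (V y) * N))).
      apply: ler_pM; rewrite ?normc_ge0 ?mulr_ge0 ?normc_ge0 //.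
      by rewrite ler_wpM2l // normc_ge0.
    have h3 : expR (2 * b * (y - x)) <= expR (- kap * x) * expR (2 * b' * `|y|).
      rewrite -expRD ler_expR gtr0_norm // -subr_ge0.
      rewrite (_ : _ - _ = kap * (y - x) + 2 * b * x); last by rewrite /kap; ring.
      by rewrite addr_ge0 ?mulr_ge0 // ?subr_ge0 ltW.
    apply: (@le_trans _ _ (c * (expR (- kap * x) * expR (2 * b' * `|y|)) *
        (normc (V y) * N))).
      by rewrite ler_wpM2r ?mulr_ge0 ?normc_ge0 // ler_wpM2l.
    rewrite /q (_ : c * (expR (- kap * x) * expR (2 * b' * `|y|)) * _ =
      c * N * expR (- kap * x) * (normc (V y) * expR (2 * b' * `|y|) * 1)); last by ring.
    apply: ler_wpM2l; first by rewrite !mulr_ge0 // expR_ge0.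
    by rewrite ler_wpM2l ?mulr_ge0 ?normc_ge0 ?expR_ge0.
  rewrite RintegralZl //; last exact: (integrableS measurableT).
  rewrite [leRHS]mulrAC; apply: ler_wpM2l; first by rewrite !mulr_ge0 // expR_ge0.
  by rewrite (le_trans (tr x)) // mul1r.
have hf := free_kernel_exp b0 bs s0; have hd := decay_kernel_exp bs.
have i0 : 0 <= (normc s)^-1 by rewrite invr_ge0 normc_ge0.
have B0 : 0 <= B by rewrite (le_trans _ (rB 0)) // (le_trans _ (r1 0)).
exists ((normc s)^-1 * N * B + 1 * N * B), kap; split=> // x x0.
have p1 : 0 <= (normc s)^-1 * N * B * expR (- kap * x).
  by rewrite !mulr_ge0 // expR_ge0.
have p2 : 0 <= 1 * N * B * expR (- kap * x) by rewrite !mulr_ge0 // expR_ge0.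
have k1 := key _ _ x i0 x0 hf; have k2 := key _ _ x ler01 x0 hd.
rewrite mulrDl; split.
  by rewrite {1}mE addrAC subrr add0r (le_trans k1) // lerDl.
by rewrite (le_trans k2) // lerDr.
Qed.

Let g0 y := V y * m y.
Let g1 y := cexp (- (2 * s) * y%:C) * g0 y.

Lemma jost_g0_integrable x : cintegrable `]x, +oo[ g0.
Proof.
have [rho [B [hr rB]]] := potential_weight pV ba ltr01.
have [mm [N HN] _] := hm; have hmm := growth_wbounded hr mm HN.
have := volterra_integrable b0 mV hr x ler01 (normr_ge0 N)
  (exp_kernel_cst1 b0) hmm.
by congr (cintegrable _ _); apply/funext => y; rewrite mul1r.
Qed.

Lemma jost_g1_integrable x : cintegrable `]x, +oo[ g1.
Proof.
have [rho [B [hr rB]]] := potential_weight pV ba ltr01.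
have [mm [N HN] _] := hm; have hmm := growth_wbounded hr mm HN.
have h := volterra_integrable b0 mV hr x ler01 (normr_ge0 N)
  (decay_kernel_exp bs) hmm.
have := cintegrableZ (cexp (- (2 * s) * x%:C)) (measurable_itv `]x, +oo[) h.
congr (cintegrable _ _); apply/funext => y; rewrite /g1 /decay_kernel mulrA -cexpD.
by congr (cexp _ * _); rewrite rmorphB /=; ring.
Qed.

Lemma jost_JE x : J x = cexp (2 * s * x%:C) * cintegral `]x, +oo[ g1.
Proof.
rewrite -cintegralZ //; last exact: jost_g1_integrable.
apply: eq_cintegral => y _; rewrite /g1 /decay_kernel [RHS]mulrA -cexpD.
by congr (cexp _ * _); rewrite rmorphB /=; ring.
Qed.

(** Splitting the kernel isolates two integrals over ]x, +oo[ of functions that do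
    not depend on x, which can be differentiated. *)
Lemma jost_mE x : m x = 1 + (2 * s)^-1 * (cintegral `]x, +oo[ g0 - J x).
Proof.
have [rho [B [hr rB]]] := potential_weight pV ba ltr01.
have [mm [N HN] mE] := hm; have hmm := growth_wbounded hr mm HN.
rewrite {1}mE; congr (1 + _).
have k2 : exp_kernel b 2 (fun t => 1 - decay_kernel s t).
  have := exp_kernelD (exp_kernel_cst1 b0) (exp_kernelZ (-1) (decay_kernel_exp bs)).
  rewrite normc_opp Normc.normc1 mulr1 -[1 + 1]/(2%:R).
  by apply: exp_kernel_ext => t; rewrite mulN1r.
have k1 : exp_kernel b 2 (fun=> 1 : C).
  by apply: exp_kernel_le (exp_kernel_cst1 b0); rewrite ler1n.
have k3 : exp_kernel b 2 (decay_kernel s).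
  by apply: exp_kernel_le (decay_kernel_exp bs); rewrite ler1n.
rewrite (volterra_kernelZ b0 mV hr ((2 * s)^-1) x (ler0n _ _) (normr_ge0 N) k2 hmm).
rewrite (volterra_kernelB b0 mV hr x (ler0n _ _) (normr_ge0 N) k1 k3 hmm).
by congr (_ * (_ - _)); apply: eq_cintegral => y _; rewrite mul1r.
Qed.

Let acJ : locally_abs_continuousC J.
Proof.
rewrite (_ : J = fun x => cexp (2 * s * x%:C) * cintegral `]x, +oo[ g1).
  apply: loc_abs_contC_M; first exact: loc_abs_contC_cexp.
  by apply: local_tail_loc_abs_cont; exact: jost_g1_integrable.
by apply/funext => x; exact: jost_JE.
Qed.

Let acm : locally_abs_continuousC m.
Proof.
rewrite (_ : m = fun x => 1 + (2 * s)^-1 * (cintegral `]x, +oo[ g0 - J x)).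
  apply: loc_abs_contC_D; first exact: loc_abs_contC_cst.
  apply: loc_abs_contC_Z; apply: loc_abs_contC_B => //.
  by apply: local_tail_loc_abs_cont; exact: jost_g0_integrable.
by apply/funext => x; exact: jost_mE.
Qed.

Let J_derive :
  {ae mu, forall x, is_cderive J x (2 * s * J x - g0 x)}.
Proof.
have d1 := local_tail_derive jost_g1_integrable.
apply: ae_mono d1 => x d1.
rewrite (_ : J = fun x => cexp (2 * s * x%:C) * cintegral `]x, +oo[ g1); last first.
  by apply/funext => z; exact: jost_JE.
apply: (is_cderive_eq (is_cderiveM (is_cderive_cexp _ _) d1)).
have e1 : cexp (2 * s * x%:C) * g1 x = g0 x.
  by rewrite /g1 mulrA -cexpD mulNr subrr cexp0 mul1r.
by rewrite -mulrA mulrN e1.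
Qed.

Let m_ae_derive : {ae mu, forall x, is_cderive m x (- J x)}.
Proof.
have d0 := local_tail_derive jost_g0_integrable.
apply: ae_mono (ae_and d0 J_derive) => x [d dJ].
rewrite (_ : m = fun x => 1 + (2 * s)^-1 * (cintegral `]x, +oo[ g0 - J x)); last first.
  by apply/funext => z; exact: jost_mE.
apply: (is_cderive_eq (is_cderiveD (is_cderive_cst 1 x)
  (is_cderiveZ ((2 * s)^-1) (is_cderiveB d dJ)))).
rewrite add0r; field; exact: s0.
Qed.

(** m is absolutely continuous and m' = - J almost everywhere; as J is continuous,
    this holds everywhere. *)
Lemma jost_derive x : is_cderive m x (- J x).
Proof.
apply: (loc_abs_contC_ae_derive acm _ m_ae_derive).
have := loc_abs_contC_Z (-1) acJ.
by under eq_fun do rewrite mulN1r.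
Qed.

(** The solution mu_+ and its derivative: m = e^{sx} mu_+ and m' = - J. *)
Definition jost_mu x := cexp (- s * x%:C) * m x.
Definition jost_mu' x := cexp (- s * x%:C) * (- J x - s * m x).

(** From m' = - J and J' = 2 s J - V m one gets m'' - 2 s m' = V m, which is
    mu'' = (s^2 + V) mu for mu = e^{-sx} m. *)
Lemma jost_is_solution : is_solution V (- s ^+ 2) jost_mu jost_mu'.
Proof.
split.
- move=> x; apply: (is_cderive_eq (is_cderiveM (is_cderive_cexp _ _) (jost_derive x))).
  by rewrite /jost_mu'; ring.
- apply: loc_abs_contC_M; first exact: loc_abs_contC_cexp.
  apply: loc_abs_contC_B; last exact: loc_abs_contC_Z.
  have := loc_abs_contC_Z (-1) acJ.
  by under eq_fun do rewrite mulN1r.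
- exists (fun x => (s ^+ 2 + V x) * jost_mu x).
  apply: ae_mono J_derive => x dJ; split; last by ring.
  have dE := is_cderive_cexp (- s) x.
  have dJ' := is_cderiveZ (-1) dJ.
  have := is_cderiveM dE (is_cderiveB dJ' (is_cderiveZ s (jost_derive x))).
  rewrite /jost_mu' /jost_mu /g0; under eq_fun do rewrite mulN1r.
  by move=> h; apply: (is_cderive_eq h); ring.
Qed.

End JostODE.

(** * Analyticity in the spectral parameter *)

Section ComplexLimits.
Variable R : realType.
Local Notation C := R[i].
Local Notation normc := (@Normc.normc R).

Lemma posc_real (e : C) : 0 < e -> exists2 r : R, 0 < r & e = r%:C.
Proof.
case: e => x y; rewrite ltcE /= => /andP[/eqP -> x0].
by exists x.
Qed.

Lemma cvg_pinfty_normcP (f : R -> C) (l : C) :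
  ((f : R -> C^o) @ +oo --> (l : C^o)) <->
  forall e, 0 < e -> exists X, forall x, X < x -> normc (f x - l) <= e.
Proof.
split=> [/cvgrPdist_le H e e0|H].
  have e0' : 0 < e%:C :> C by rewrite ltcR.
  have [X [_ HX]] := H _ e0'; exists X => x /HX.
  by rewrite normr_normc lecR -normc_opp opprB.
apply/cvgrPdist_le => e /posc_real [r r0 ->]; have [X HX] := H r r0.
exists X; split; first exact: num_real.
by move=> x /HX h; rewrite normr_normc lecR -normc_opp opprB.
Qed.

Lemma cvg_ninfty_normcP (f : R -> C) (l : C) :
  ((f : R -> C^o) @ -oo --> (l : C^o)) <->
  forall e, 0 < e -> exists X, forall x, x < X -> normc (f x - l) <= e.
Proof.
split=> [/cvgrPdist_le H e e0|H].
  have e0' : 0 < e%:C :> C by rewrite ltcR.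
  have [X [_ HX]] := H _ e0'; exists X => x /HX.
  by rewrite normr_normc lecR -normc_opp opprB.
apply/cvgrPdist_le => e /posc_real [r r0 ->]; have [X HX] := H r r0.
exists X; split; first exact: num_real.
by move=> x /HX h; rewrite normr_normc lecR -normc_opp opprB.
Qed.

Lemma exp_decay_small (K kap e : R) : 0 < kap -> 0 < e ->
  exists X, forall x, X < x -> 0 <= x /\ K * expR (- kap * x) <= e.
Proof.
move=> k0 e0; pose K1 := `|K| + 1.
have K10 : 0 < K1 by rewrite ltr_wpDl.
exists (K1 / (kap * e)) => x Xx.
have x0 : 0 < x by rewrite (le_lt_trans _ Xx) // divr_ge0 ?mulr_ge0 // ltW.
split; first exact: ltW.
rewrite mulNr expRN ler_pdivrMr ?expR_gt0 //.
have h : K1 <= e * (kap * x).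
  move: Xx; rewrite ltr_pdivrMr ?mulr_gt0 // => /ltW h.
  by rewrite (le_trans h) // le_eqVlt; apply/orP; left; apply/eqP; ring.
have h2 : e * (kap * x) <= e * expR (kap * x).
  by rewrite ler_pM2l // (le_trans _ (expR_ge1Dx _)) // lerDr.
apply: (le_trans _ h2); apply: (le_trans _ h).
by rewrite /K1 (le_trans (ler_norm K)) // lerDl.
Qed.

(** C^o has complex-valued norms, hence the passage through real radii. *)
Lemma quadratic_derivable (f : C -> C) (s n : C) (K eta : R) : 0 < eta ->
  (forall h, normc h < eta -> normc (f (s + h) - f s - h * n) <= K * normc h ^+ 2) ->
  derivable (f : C^o -> C^o) s 1.
Proof.
move=> eta0 H; apply/cvg_ex; exists n.
apply/cvgrPdist_le => e /posc_real [r r0 ->].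
pose K1 := `|K| + 1; have K10 : 0 < K1 by rewrite ltr_wpDl.
pose d := Num.min eta (r / K1).
have d0 : 0 < d by rewrite lt_min eta0 divr_gt0.
exists (d%:C) => /=; first by rewrite ltcR.
move=> h; rewrite /ball_ /= sub0r normrN normr_normc ltcR lt_min => /andP[h1 h2] h0.
have nh : 0 < normc h by rewrite normc_gt0.
rewrite normr_normc lecR /GRing.scale /= mulr1 [h + s]addrC -normc_opp opprB.
rewrite (_ : h^-1 * (f (s + h) - f s) - n =
  h^-1 * (f (s + h) - f s - h * n)); last by field.
rewrite Normc.normcM Normc.normcV mulrC ler_pdivrMr // (le_trans (H h h1)) //.
rewrite expr2 mulrA ler_wpM2r ?normc_ge0 //.
move: h2; rewrite ltr_pdivlMr // => /ltW h2; apply: (le_trans _ h2).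
by rewrite mulrC ler_wpM2l ?normc_ge0 // /K1 (le_trans (ler_norm K)) // lerDl.
Qed.

End ComplexLimits.

Section GlobalJost.
Variable R : realType.
Local Notation C := R[i].
Local Notation normc := (@Normc.normc R).

(** The choice does not depend on b, by jostP; this makes it a single function of s
    to which jost_differentiable applies near each point. *)
Definition jost (a : R) (V : R -> C) (s : C) : R -> C :=
  xget (fun=> 0) [set m | exists b,
    [/\ 0 <= b, b < a, - b <= complex.Re s & jost_sol V b s m]].

Lemma jostP (a b : R) (V : R -> C) (s : C) : potential a V -> 0 <= b -> b < a ->
  - b <= complex.Re s -> s != 0 -> jost_sol V b s (jost a V s).
Proof.
move=> pV b0 ba bs s0; have [m hm] := jost_exists pV b0 ba bs s0.
have := @xgetI _ (fun=> 0 : C) [set m | exists b,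
    [/\ 0 <= b, b < a, - b <= complex.Re s & jost_sol V b s m]] m.
case; first by exists b.
move=> b1 [b10 b1a b1s]; rewrite -/(jost a V s) => hm1.
pose c := Num.max b b1.
have bc : b <= c by rewrite le_max lexx.
have b1c : b1 <= c by rewrite le_max lexx orbT.
have ca : c < a by rewrite gt_max ba.
have c0 : 0 <= c by exact: le_trans bc.
have cs : - c <= complex.Re s by rewrite (le_trans _ bs) // lerN2.
by rewrite -(jost_unique pV c0 ca cs s0 (jost_sol_mono bc hm)
  (jost_sol_mono b1c hm1)).
Qed.

(** The Cauchy data at 0 of mu_+ = e^{-sx} m_s, extended to all Re s > - a. *)
Definition jost_value (a : R) (V : R -> C) (s : C) : C := jost a V s 0.
Definition jost_slope (a : R) (V : R -> C) (s : C) : C :=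
  - volterra V (decay_kernel s) (jost a V s) 0 - s * jost a V s 0.

(** In the coordinate k, with s = i k: multiplication by i is an isometry, so the
    second-order remainder in s is one in k. *)
Lemma jost_derivable (a : R) (V : R -> C) (k : C) : potential a V -> 0 < a ->
  complex.Im k < a -> k != 0 ->
  derivable ((fun z : C => jost_value a V ('i%C * z)) : C^o -> C^o) k 1 /\
  derivable ((fun z : C => volterra V (decay_kernel ('i%C * z))
    (jost a V ('i%C * z)) 0) : C^o -> C^o) k 1.
Proof.
move=> pV a0 ka k0.
have Res (z : C) : complex.Re ('i%C * z) = - complex.Im z.
  by case: z => x y /=; ring.
have ni (z : C) : normc ('i%C * z) = normc z.
  by rewrite Normc.normcM /= expr0n expr1n add0r sqrtr1 mul1r.
have i0 : 'i%C != 0 :> C by rewrite -normc_gt0 -[X in normc X]mulr1 ni Normc.normc1.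
have s0 : 'i%C * k != 0 by rewrite mulf_neq0.
have [b [b0 ba bk]] : exists b, [/\ 0 <= b, b < a & complex.Im k < b].
  exists ((Num.max 0 (complex.Im k) + a) / 2).
  have m1 : 0 <= Num.max 0 (complex.Im k) by rewrite le_max lexx.
  have m2 : complex.Im k <= Num.max 0 (complex.Im k) by rewrite le_max lexx orbT.
  have m3 : Num.max 0 (complex.Im k) < a by rewrite gt_max a0.
  by split; lra.
have bs : - b < complex.Re ('i%C * k) by rewrite Res ltrN2.
pose eta := Num.min (b - complex.Im k) (normc k).
have eta0 : 0 < eta by rewrite lt_min subr_gt0 bk normc_gt0.
have near h : normc h < eta -> jost_sol V b ('i%C * k + h) (jost a V ('i%C * k + h)).
  rewrite lt_min => /andP[h1 h2]; apply: jostP => //.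
    rewrite cReD Res; have := normr_Re_le h; rewrite ler_norml => /andP[? _].
    lra.
  apply: contraTneq h2 => e; rewrite -leNgt.
  have -> : h = - ('i%C * k) by apply/eqP; rewrite -addr_eq0 addrC e.
  by rewrite normc_opp ni.
have [n0 [n1 [K [eta' [eta'0 H]]]]] :=
  jost_differentiable 0 pV b0 ba bs s0 eta0 near.
split.
  apply: (@quadratic_derivable _ _ _ ('i%C * n0) K eta' eta'0) => h hh.
  have := (H ('i%C * h) _).1; rewrite ni => /(_ hh).
  rewrite -mulrDr /jost_value; congr (normc (_ - _) <= _); ring.
apply: (@quadratic_derivable _ _ _ ('i%C * n1) K eta' eta'0) => h hh.
have := (H ('i%C * h) _).2; rewrite ni => /(_ hh).
rewrite -mulrDr; congr (normc (_ - _) <= _); ring.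
Qed.

End GlobalJost.

(** * The Evans function on the first sheet *)

Section Evans.
Variable R : realType.
Local Notation C := R[i].
Local Notation mu := (@lebesgue_measure R).
Local Notation normc := (@Normc.normc R).
Implicit Types (V u v : R -> C) (k lambda : C).

(** The Wronskian is absolutely continuous and its derivative vanishes wherever both
    equations hold. *)
Lemma wronskian_constant V lambda u u' v v' : is_solution V lambda u u' ->
  is_solution V lambda v v' ->
  forall x y, u x * v' x - u' x * v x = u y * v' y - u' y * v y.
Proof.
move=> [du acu' [u'' aeu]] [dv acv' [v'' aev]].
have acu := loc_abs_contC_C1 du acu'; have acv := loc_abs_contC_C1 dv acv'.
apply: loc_abs_contC_ae_derive0.
  by apply: loc_abs_contC_B; exact: loc_abs_contC_M.
apply: ae_mono (ae_and aeu aev) => x [[du' eu] [dv' ev]].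
apply: (is_cderive_eq (is_cderiveB (is_cderiveM (du x) dv') (is_cderiveM du' (dv x)))).
have -> : u'' x = - ((lambda - V x) * u x) by apply/eqP; rewrite -addr_eq0 eu.
have -> : v'' x = - ((lambda - V x) * v x) by apply/eqP; rewrite -addr_eq0 ev.
ring.
Qed.

Lemma is_solution_opp V lambda u u' : is_solution V lambda u u' ->
  is_solution (fun x => V (- x)) lambda (fun x => u (- x)) (fun x => - u' (- x)).
Proof.
move=> [du acu' [u'' aeu]]; split.
- by move=> x; apply: is_cderive_opp.
- have := loc_abs_contC_Z (-1) (loc_abs_contC_opp acu').
  by under eq_fun do rewrite mulN1r.
- exists (fun x => u'' (- x)); apply: ae_mono (ae_opp aeu) => x [du' eu]; split => //.
  have := is_cderiveZ (-1) (is_cderive_opp du').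
  under eq_fun do rewrite mulN1r.
  by rewrite mulN1r opprK.
Qed.

Lemma is_mu_minus_opp V k u u' : is_mu_minus V k u u' ->
  is_mu_plus (fun x => V (- x)) k (fun x => u (- x)) (fun x => - u' (- x)).
Proof.
move=> [su /cvg_ninfty_normcP u1 /cvg_ninfty_normcP u2]; split.
- exact: is_solution_opp.
- apply/cvg_pinfty_normcP => e e0; have [X HX] := u1 e e0; exists (- X) => x xX.
  have := HX (- x); rewrite ltrNl => /(_ xX); rewrite rmorphN mulrNN; exact.
- apply/cvg_pinfty_normcP => e e0; have [X HX] := u2 e e0; exists (- X) => x xX.
  have := HX (- x); rewrite ltrNl => /(_ xX); rewrite rmorphN mulrNN.
  by rewrite mulNr opprK -normc_opp opprB addrC.
Qed.

Lemma is_mu_plus_opp V k u u' : is_mu_plus (fun x => V (- x)) k u u' ->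
  is_mu_minus V k (fun x => u (- x)) (fun x => - u' (- x)).
Proof.
move=> [su /cvg_pinfty_normcP u1 /cvg_pinfty_normcP u2]; split.
- by have := is_solution_opp su; under [X in is_solution X]eq_fun do rewrite opprK.
- apply/cvg_ninfty_normcP => e e0; have [X HX] := u1 e e0; exists (- X) => x xX.
  have := HX (- x); rewrite ltrNr => /(_ xX); rewrite rmorphN mulrN mulNr; exact.
- apply/cvg_ninfty_normcP => e e0; have [X HX] := u2 e e0; exists (- X) => x xX.
  have := HX (- x); rewrite ltrNr => /(_ xX); rewrite rmorphN mulrN mulNr.
  by rewrite mulNr opprK -normc_opp opprD.
Qed.

Lemma jost_mu_at0 s (m : R -> C) : jost_mu s m 0 = m 0.
Proof. by rewrite /jost_mu mulr0 cexp0 mul1r. Qed.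

Lemma jost_mu'_at0 s V (m : R -> C) :
  jost_mu' s V m 0 = - volterra V (decay_kernel s) m 0 - s * m 0.
Proof. by rewrite /jost_mu' mulr0 cexp0 mul1r. Qed.

(** The bound by e^{-sx} holds on the whole line, hence also at the end where
    mu_+ is not normalized. *)
Definition tame_mu_plus V k u u' : Prop := is_mu_plus V k u u' /\
  exists N, forall x,
    normc (u x * cexp (sqrt_opp_lambda k * x%:C)) <= N /\
    normc (u' x * cexp (sqrt_opp_lambda k * x%:C)) <= N.

Lemma jost_tame (a : R) V k : potential a V -> 0 < a -> first_sheet R k ->
  let s := sqrt_opp_lambda k in
  tame_mu_plus V k (jost_mu s (jost a V s)) (jost_mu' s V (jost a V s)).
Proof.
move=> pV a0 k0 s.
have Res : 0 < complex.Re s.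
  by rewrite /s /sqrt_opp_lambda cReM /= mul0r mul1r sub0r oppr_gt0.
have s0 : s != 0 by apply: contraTneq Res => ->; rewrite ltxx.
have bs : - 0 <= complex.Re s by rewrite oppr0 ltW.
have hm := jostP pV (lexx 0) a0 bs s0; set m := jost a V s in hm *.
have E x : cexp (- s * x%:C) * cexp (s * x%:C) = 1 by rewrite mulNr cexpN_mul.
have E1 x : jost_mu s m x * cexp (s * x%:C) = m x.
  by rewrite /jost_mu mulrAC E mul1r.
have E2 x : jost_mu' s V m x * cexp (s * x%:C) =
    - volterra V (decay_kernel s) m x - s * m x.
  by rewrite /jost_mu' mulrAC E mul1r.
have [N N0 HN] := jost_bounded pV (lexx 0) a0 bs hm.
have [K [kap [kap0 HK]]] := jost_decay pV (lexx 0) a0 bs s0 hm.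
split; last first.
  exists (N + normc s * N) => x; rewrite E1 E2.
  have [h1 h2] := HN x; rewrite /growth mul0r expR0 mulr1 in h1 h2.
  have p : 0 <= normc s * N by rewrite mulr_ge0 // normc_ge0.
  split; first by rewrite (le_trans h1) // lerDl.
  rewrite (le_trans (normcB_le _ _)) // normc_opp Normc.normcM lerD //.
  by rewrite ler_wpM2l // normc_ge0.
split.
- have := jost_is_solution pV (lexx 0) a0 bs s0 hm.
  congr (is_solution _ _ _ _); rewrite /lambda_of /s /sqrt_opp_lambda exprMn.
  by rewrite sqr_i mulN1r opprK.
- apply/cvg_pinfty_normcP => e e0; have [X HX] := exp_decay_small K kap0 e0.
  exists X => x /HX [x0 h]; rewrite E1.
  by have [h1 _] := HK x x0; exact: le_trans h1 h.
- apply/cvg_pinfty_normcP => e e0.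
  have [X HX] := exp_decay_small (K + normc s * K) kap0 e0.
  exists X => x /HX [x0 h]; rewrite E2.
  have [h1 h2] := HK x x0; apply: le_trans h; rewrite -/s.
  rewrite (_ : _ - _ - _ = - volterra V (decay_kernel s) m x - s * (m x - 1)); last by ring.
  rewrite (le_trans (normcB_le _ _)) // normc_opp Normc.normcM mulrDl lerD //.
  by rewrite -mulrA ler_wpM2l // normc_ge0.
Qed.

Lemma small_eq0 (z : C) (B : R) :
  (forall e, 0 < e -> normc z <= e * B) -> z = 0.
Proof.
move=> H; apply: Normc.eq0_normc; apply/eqP; rewrite eq_le normc_ge0 andbT.
apply/ler_addgt0Pr => e e0; rewrite add0r.
have B1 : 0 < `|B| + 1 by rewrite ltr_wpDl.
apply: (le_trans (H (e / (`|B| + 1)) _)); first by rewrite divr_gt0.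
rewrite mulrAC ler_pdivrMr // ler_pM2l //.
by rewrite (le_trans (ler_norm B)) // lerDl.
Qed.

(** The Wronskian of the difference u - w with v is constant, and it tends to 0 at
    + oo: u - w and its derivative are o(e^{-sx}), while v and its derivative are
    O(e^{sx}). *)
Lemma wronskian_plus_unique V k u u' w w' v v' (N X0 : R) :
  is_mu_plus V k u u' -> is_mu_plus V k w w' ->
  is_solution V (lambda_of k) v v' ->
  (forall x, X0 < x -> normc (v x * cexp (- sqrt_opp_lambda k * x%:C)) <= N /\
    normc (v' x * cexp (- sqrt_opp_lambda k * x%:C)) <= N) ->
  forall x, u x * v' x - u' x * v x = w x * v' x - w' x * v x.
Proof.
move=> [su /cvg_pinfty_normcP u1 /cvg_pinfty_normcP u2].
move=> [sw /cvg_pinfty_normcP w1 /cvg_pinfty_normcP w2] sv bv x.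
set s := sqrt_opp_lambda k in u1 u2 w1 w2 bv *.
apply/eqP; rewrite -subr_eq0; apply/eqP; apply: (@small_eq0 _ (4 * N)) => e e0.
have [X1 H1] := u1 e e0; have [X2 H2] := u2 e e0.
have [X3 H3] := w1 e e0; have [X4 H4] := w2 e e0.
pose M := Num.max X0 (Num.max (Num.max X1 X2) (Num.max X3 X4)) + 1.
have : Num.max X0 (Num.max (Num.max X1 X2) (Num.max X3 X4)) < M by rewrite ltrDl.
rewrite !gt_max => /and3P[h0 /andP[h1 h2] /andP[h3 h4]].
rewrite (wronskian_constant su sv x M) (wronskian_constant sw sv x M).
have [v1 v2] := bv M h0.
have {H1}h1 := H1 M h1; have {H2}h2 := H2 M h2.
have {H3}h3 := H3 M h3; have {H4}h4 := H4 M h4.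
have E : cexp (s * M%:C) * cexp (- s * M%:C) = 1 by rewrite mulNr mulrC cexpN_mul.
set ep := cexp (s * M%:C) in E h1 h2 h3 h4 *.
set em := cexp (- s * M%:C) in E v1 v2 *.
rewrite (_ : u M * v' M - u' M * v M - (w M * v' M - w' M * v M) =
  ((u M * ep - 1) - (w M * ep - 1)) * (v' M * em) -
  ((u' M * ep - - s) - (w' M * ep - - s)) * (v M * em)); last first.
  transitivity ((u M * v' M - u' M * v M - (w M * v' M - w' M * v M)) * (ep * em)).
    by rewrite E mulr1.
  by ring.
have N0 : 0 <= N by exact: le_trans (normc_ge0 _) v1.
have ee : 0 <= e + e by rewrite addr_ge0 // ltW.
rewrite (_ : e * (4 * N) = (e + e) * N + (e + e) * N); last by ring.
have prod_le z1 z2 z3 : normc z1 <= e -> normc z2 <= e -> normc z3 <= N ->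
    normc ((z1 - z2) * z3) <= (e + e) * N.
  move=> l1 l2 l3; rewrite Normc.normcM; apply: ler_pM; rewrite ?normc_ge0 //.
  by rewrite (le_trans (normcB_le _ _)) // lerD.
by rewrite (le_trans (normcB_le _ _)) // lerD // prod_le.
Qed.

(** The Wronskian of arbitrary mu_+ = u and mu_- = v is that of the tame solutions
    p and r. By wronskian_plus_unique, also after reflection, W(u, r) = W(p, r),
    W(p, v) = W(p, r) and W(u, p) = 0. At a point where p does not vanish, these
    relations give W(u, v) = W(p, r), because p W(u, v) = u W(p, v) + v W(u, p). *)
Lemma tame_evans V k p p' q q' : first_sheet R k ->
  tame_mu_plus V k p p' -> tame_mu_plus (fun x => V (- x)) k q q' ->
  is_Evans V k (- (p 0 * q' 0) - p' 0 * q 0).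
Proof.
move=> k0 [hp [N HN]] [hq [N' HN']].
set s := sqrt_opp_lambda k in HN HN'.
have Res : 0 < complex.Re s.
  by rewrite /s /sqrt_opp_lambda cReM /= mul0r mul1r sub0r oppr_gt0.
pose r x := q (- x); pose r' x := - q' (- x).
have hr : is_mu_minus V k r r' by exact: is_mu_plus_opp.
have [sp /cvg_pinfty_normcP p1 _] := hp; have [sr _ _] := hr.
have br x : normc (r x * cexp (- s * x%:C)) <= N' /\
    normc (r' x * cexp (- s * x%:C)) <= N'.
  have [h1 h2] := HN' (- x); rewrite rmorphN mulrN -mulNr in h1 h2.
  by split => //; rewrite /r' mulNr normc_opp.
have W0 x : - (p 0 * q' 0) - p' 0 * q 0 = p x * r' x - p' x * r x.
  rewrite (wronskian_constant sp sr x 0) /r /r' oppr0; ring.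
split; [by exists p, p'|by exists r, r'|].
move=> u u' v v' hu hv x; have [su _ _] := hu; have [sv _ _] := hv.
have Wur y : u y * r' y - u' y * r y = p y * r' y - p' y * r y.
  by apply: (wronskian_plus_unique (X0 := 0) hu hp sr) => z _; exact: br.
have Wup y : u y * p' y - u' y * p y = 0.
  rewrite (wronskian_plus_unique (X0 := 0) (N := N) hu hp sp); first by ring.
  move=> z z0; have [h1 h2] := HN z.
  have le1 : normc (cexp (- s * z%:C)) <= normc (cexp (s * z%:C)).
    rewrite !normc_cexp ler_expR mulNr cReN cReM /= mulr0 subr0.
    by have := mulr_ge0 (ltW Res) (ltW z0); lra.
  rewrite Normc.normcM in h1; rewrite Normc.normcM in h2.
  split; rewrite Normc.normcM.
    by apply: le_trans h1; apply: ler_wpM2l le1; exact: normc_ge0.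
  by apply: le_trans h2; apply: ler_wpM2l le1; exact: normc_ge0.
have Wpv y : p y * v' y - p' y * v y = p y * r' y - p' y * r y.
  have hv' := is_mu_minus_opp hv; have hr' := is_mu_minus_opp hr.
  have sp' := is_solution_opp sp.
  have bnd x0 : 0 < x0 ->
      normc (p (- x0) * cexp (- sqrt_opp_lambda k * x0%:C)) <= N /\
      normc (- p' (- x0) * cexp (- sqrt_opp_lambda k * x0%:C)) <= N.
    move=> _; have [h1 h2] := HN (- x0).
    rewrite rmorphN mulrN -mulNr in h1 h2.
    by split => //; rewrite mulNr normc_opp.
  have := wronskian_plus_unique hv' hr' sp' bnd (- y).
  rewrite !opprK.
  move=> h; transitivity (v y * - p' y - - v' y * p y); first by ring.
  by rewrite h /r'; ring.
have [X HX] : exists X, forall y, X < y -> normc (p y * cexp (s * y%:C) - 1) <= 2^-1.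
  by apply: p1; rewrite invr_gt0.
have pX : p (X + 1) != 0.
  apply/eqP => pz; have := HX (X + 1); rewrite ltrDl => /(_ ltr01).
  rewrite pz mul0r sub0r normc_opp Normc.normc1 leNgt invf_lt1 // ltr1n //.
set y := X + 1 in pX.
rewrite (W0 y) (wronskian_constant su sv x y).
apply/eqP; rewrite eq_sym -subr_eq0; apply/eqP; apply: (mulfI pX).
rewrite mulr0.
(* p (W(u, v) - W(p, r)) is a combination of the three relations at y *)
transitivity (u y * ((p y * v' y - p' y * v y) - (p y * r' y - p' y * r y))
  + (v y - r y) * (u y * p' y - u' y * p y)
  + p y * ((u y * r' y - u' y * r y) - (p y * r' y - p' y * r y))).
  by ring.
by rewrite Wpv Wup Wur !subrr !mulr0 !addr0.
Qed.

End Evans.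

(** * Zeros of the Evans function *)

Section GeneralizedEigenvalue.
Variable R : realType.
Local Notation C := R[i].
Local Notation mu := (@lebesgue_measure R).
Local Notation normc := (@Normc.normc R).

(** The Volterra equation for mu = alpha mu_+ reads mu = C e^{-sx} + A(lambda) f,
    where C = alpha + (2s)^-1 int_R e^{sy} f. The hypothesis on the integral over
    the whole line is C = 0. *)
Lemma resolvent_half (a b : R) (s alpha : C) (V A f : R -> C) (x : R) :
  potential a V -> 0 <= b -> b < a -> - b <= complex.Re s -> s != 0 ->
  jost_sol V b s A ->
  (forall y, 0 < y -> f y = V y * (alpha * jost_mu s A y)) ->
  cintegrable setT (fun y => cexp (s * y%:C) * f y) ->
  cintegral setT (fun y => cexp (s * y%:C) * f y) = - (2 * s * alpha) ->
  0 < x ->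
  alpha * jost_mu s A x =
  - (2 * s)^-1 * cintegral `]x, +oo[ (fun y => cexp (- s * (y - x)%:C) * f y)
  - (2 * s)^-1 * cintegral `]-oo, x[ (fun y => cexp (s * (y - x)%:C) * f y).
Proof.
move=> pV b0 ba bs s0 hA fE fint fT x0.
have mx : measurable (`]x, +oo[%classic : set (measurableTypeR R)).
  exact: measurable_itv.
have mx' : measurable (`]-oo, x[%classic : set (measurableTypeR R)).
  exact: measurable_itv.
have i0 := jost_g0_integrable pV b0 ba hA x.
have i1 := jost_g1_integrable pV b0 ba bs hA x.
have mE := jost_mE pV b0 ba bs hA x; have JE := jost_JE pV b0 ba bs hA x.
set I0 := cintegral _ _ in mE; set I1 := cintegral _ _ in JE.
have e1 : cintegral `]x, +oo[ (fun y => cexp (- s * (y - x)%:C) * f y) =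
    alpha * cexp (s * x%:C) * I1.
  rewrite -cintegralZ //; apply: eq_cintegral => y /=; rewrite in_itv /= andbT => xy.
  rewrite fE ?(lt_trans x0) // /jost_mu.
  have -> : cexp (- (2 * s) * y%:C) = cexp (- s * y%:C) * cexp (- s * y%:C).
    by rewrite -cexpD; congr cexp; ring.
  have -> : cexp (- s * (y - x)%:C) = cexp (s * x%:C) * cexp (- s * y%:C).
    by rewrite -cexpD; congr cexp; rewrite rmorphB /=; ring.
  by ring.
have e2 : cintegral `]x, +oo[ (fun y => cexp (s * y%:C) * f y) = alpha * I0.
  rewrite -cintegralZ //; apply: eq_cintegral => y /=; rewrite in_itv /= andbT => xy.
  rewrite fE ?(lt_trans x0) // /jost_mu.
  transitivity (cexp (- s * y%:C) * cexp (s * y%:C) * (alpha * (V y * A y))).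
    by ring.
  by rewrite mulNr cexpN_mul mul1r.
have e3 : cintegral `]-oo, x[ (fun y => cexp (s * (y - x)%:C) * f y) =
    cexp (- s * x%:C) * cintegral `]-oo, x[ (fun y => cexp (s * y%:C) * f y).
  rewrite -cintegralZ //; last exact: (cintegrableS measurableT).
  apply: eq_cintegral => y _; rewrite mulrA -cexpD; congr (cexp _ * _).
  by rewrite rmorphB /=; ring.
have e4 : cintegral `]-oo, x[ (fun y => cexp (s * y%:C) * f y) =
    - (2 * s * alpha) - alpha * I0.
  by rewrite -fT -(cintegral_split x fint) e2; ring.
rewrite e1 e3 e4 /jost_mu mE JE.
have -> : cexp (2 * s * x%:C) = cexp (s * x%:C) * cexp (s * x%:C).
  by rewrite -cexpD; congr cexp; ring.
have E : cexp (- s * x%:C) * cexp (s * x%:C) = 1 by rewrite mulNr cexpN_mul.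
set ep := cexp (s * x%:C) in E *; set em := cexp (- s * x%:C) in E *.
transitivity (alpha * em + (2 * s)^-1 * alpha * (em * I0 - (em * ep) * ep * I1)).
  by ring.
rewrite E; field; exact: s0.
Qed.

Lemma not_ae_zero (f : R -> C) (X : R) : (forall x, X < x -> f x != 0) ->
  ~ {ae mu, forall x, f x = 0}.
Proof.
move=> fX [Z [mZ Z0 fZ]].
pose I : set (measurableTypeR R) := `]X, (X + 1)]%classic.
have mI : measurable I by exact: measurable_itv.
have : (mu I <= mu Z)%E.
  apply: le_measure; rewrite ?inE //.
  apply: subset_trans fZ => x; rewrite /I /= in_itv /= => /andP[Xx _].
  by apply/eqP; exact: fX.
have := lebesgue_measure_itv `]X, (X + 1)].
rewrite /= lte_fin ltrDl ltr01 -EFinD -/I => E1; move: Z0 => /= Z0.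
rewrite /= in E1; rewrite E1 Z0.
by rewrite lee_fin addrAC subrr add0r leNgt ltr01.
Qed.

Lemma ae_neq0 : {ae mu, forall x : R, x != 0}.
Proof.
exists [set 0]; split; first exact: measurable_set1.
  exact: lebesgue_measure_set1.
by move=> x /= /negP; rewrite negbK => /eqP.
Qed.

(** The Volterra equation at x = 0 and its derivative, solved for the two integrals. *)
Lemma jost_data (a b : R) (s : C) (V : R -> C) : potential a V -> 0 <= b ->
  b < a -> - b <= complex.Re s -> s != 0 ->
  cintegral `]0, +oo[ (fun y => V y * jost a V s y) =
    s * jost_value a V s - jost_slope a V s - 2 * s /\
  cintegral `]0, +oo[
      (fun y => cexp (- (2 * s) * y%:C) * (V y * jost a V s y)) =
    - (s * jost_value a V s + jost_slope a V s).
Proof.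
move=> pV b0 ba bs s0; have hA := jostP pV b0 ba bs s0.
have mE := jost_mE pV b0 ba bs hA 0; have JE := jost_JE pV b0 ba bs hA 0.
rewrite mulr0 cexp0 mul1r in JE.
rewrite /jost_value /jost_slope -JE; split; last by ring.
move: mE; set A0 := jost a V s 0; set I0 := cintegral _ _; set J := volterra _ _ _ _.
by move=> ->; field; exact: s0.
Qed.

(** A singular 2 x 2 system has a nonzero solution: (q0, p0), or (q1, - p1) when that
    is zero, or (1, 0) when mu_+ has zero Cauchy data. *)
Lemma glue_coefficients (p0 p1 q0 q1 : C) : - (p0 * q1) - p1 * q0 = 0 ->
  exists al be : C, [/\ (al != 0) || (be != 0), al * p0 = be * q0 &
    al * p1 = - (be * q1)].
Proof.
move=> W; have W' : q0 * p1 = - (p0 * q1).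
  by apply/eqP; rewrite eq_sym -subr_eq0 [q0 * _]mulrC W.
have [p00|p00] := eqVneq p0 0; have [q00|q00] := eqVneq q0 0; last first.
- by exists q0, p0; rewrite p00 orbT; split => //; exact: mulrC.
- by exists q0, p0; rewrite p00 orbT; split => //; exact: mulrC.
- by exists q0, p0; rewrite q00; split => //; exact: mulrC.
have [p10|p10] := eqVneq p1 0.
  by exists 1, 0; rewrite p00 q00 p10 oner_eq0 !mulr0 mul0r oppr0.
exists q1, (- p1); rewrite oppr_eq0 p10 orbT p00 q00 !mulr0; split => //.
by rewrite mulNr opprK mulrC.
Qed.

(** One of al and be may vanish: with be = 0 this is a multiple of mu_+
    continued by 0. *)
Definition glued (s al be : C) (A B : R -> C) (x : R) : C :=
  if 0 <= x then al * jost_mu s A x else be * jost_mu s B (- x).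

(** The Wronskian at 0 of mu_+ and of mu_-, the reflection of the solution mu_+ for
    the potential V(-x). *)
Definition evans (a : R) (V : R -> C) (k : C) : C :=
  let s := sqrt_opp_lambda k in
  let V' := fun x : R => V (- x) in
  - (jost_value a V s * jost_slope a V' s)
  - jost_slope a V s * jost_value a V' s.

(** A zero of the Wronskian gives al and be such that al mu_+ and be mu_- have the
    same Cauchy data at 0. The glued function mu grows at most like e^{|Re s||x|},
    hence lies in X'. By jost_data, equality of the Cauchy data amounts to
    int_R e^{sy} V mu = - 2 s al (T1) and int_R e^{-sy} V mu = - 2 s be (T2),
    which are the hypotheses of resolvent_half for x > 0 and, after reflection,
    for x < 0. *)
Lemma evans_zero_eigenvalue (a : R) (V : R -> C) (k : C) : potential a V ->
  surfaceP a k -> evans a V k = 0 -> is_generalized_eigenvalue a V k.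
Proof.
move=> pV [k0 /andP[ka1 ka2]] E0.
have pV' := potential_opp pV.
set V' := (fun x : R => V (- x)) in pV'.
set s := sqrt_opp_lambda k.
have Res : complex.Re s = - complex.Im k.
  by rewrite /s /sqrt_opp_lambda cReM /= mul0r mul1r sub0r.
have s0 : s != 0.
  rewrite mulf_neq0 // -normc_gt0 /= expr0n expr1n add0r sqrtr1; exact: ltr01.
pose b := `|complex.Re s|.
have b0 : 0 <= b by exact: normr_ge0.
have ba : b < a by rewrite /b Res normrN ltr_norml ka1.
have bs : - b <= complex.Re s by rewrite lerNl /b -normrN ler_norm.
have bs' : complex.Re s <= b by exact: ler_norm.
have hA := jostP pV b0 ba bs s0; have hB := jostP pV' b0 ba bs s0.
have [I0A I1A] := jost_data pV b0 ba bs s0.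
have [I0B I1B] := jost_data pV' b0 ba bs s0.
have [al [be [albe Ep0 Ep1]]] := glue_coefficients E0.
set A := jost a V s in hA I0A I1A; set B := jost a V' s in hB I0B I1B.
rewrite -/s -/V' in Ep0 Ep1.
set p0 := jost_value a V s in Ep0 I0A I1A; set p1 := jost_slope a V s in Ep1 I0A I1A.
set q0 := jost_value a V' s in Ep0 I0B I1B; set q1 := jost_slope a V' s in Ep1 I0B I1B.
pose m := glued s al be A B.
have mmu (D : R -> C) : complex_measurable D -> complex_measurable (jost_mu s D).
  by move=> mD; apply: complex_measurableM => //; exact: complex_measurable_cexp_real.
have mA : complex_measurable A by case: hA.
have mB : complex_measurable B by case: hB.
have mV : complex_measurable V by case: pV.
have mm : complex_measurable m.
  apply: complex_measurable_if.
  - exact: measurable_fun_ler.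
  - by apply: complex_measurableM; [exact: complex_measurable_cst|exact: mmu].
  - apply: complex_measurableM; first exact: complex_measurable_cst.
    exact: (complex_measurable_opp (mmu _ mB)).
have [N N0 bm] : exists2 N, 0 <= N & forall x, normc (m x) <= N * expR (b * `|x|).
  have [NA NA0 HA] := jost_bounded pV b0 ba bs hA.
  have [NB NB0 HB] := jost_bounded pV' b0 ba bs hB.
  have half (D : R -> C) (ga : C) ND x : 0 <= x -> normc (D x) <= ND * growth b x ->
      normc (ga * jost_mu s D x) <= normc ga * ND * expR (b * `|x|).
    move=> x0; rewrite /growth ger0_norm // subrr mulr0 expR0 mulr1 => hD.
    rewrite Normc.normcM -[leRHS]mulrA; apply: ler_wpM2l; first exact: normc_ge0.
    rewrite /jost_mu Normc.normcM [leRHS]mulrC normc_cexp.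
    apply: ler_pM; rewrite ?expR_ge0 ?normc_ge0 //.
    rewrite ler_expR mulNr cReN cReM /= mulr0 subr0 -mulNr ler_wpM2r //.
    by rewrite lerNl.
  have pA : 0 <= normc al * NA by rewrite mulr_ge0 // normc_ge0.
  have pB : 0 <= normc be * NB by rewrite mulr_ge0 // normc_ge0.
  exists (normc al * NA + normc be * NB); first by rewrite addr_ge0.
  move=> x; rewrite /m /glued; case: (leP 0 x) => x0.
    rewrite (le_trans (half A al NA x x0 (HA x).1)) // ler_wpM2r ?expR_ge0 //.
    by rewrite lerDl.
  have nx0 : 0 <= - x by rewrite oppr_ge0 ltW.
  rewrite (le_trans (half B be NB (- x) nx0 (HB (- x)).1)) // normrN.
  by rewrite ler_wpM2r ?expR_ge0 // lerDr.
pose f y := V y * m y.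
have mf : complex_measurable f by exact: complex_measurableM.
have fint (c : C) (U g : R -> C) : `|complex.Re c| <= b -> potential a U ->
    complex_measurable g -> (forall x, normc (g x) <= N * expR (b * `|x|)) ->
    cintegrable setT (fun y => cexp (c * y%:C) * (U y * g y)).
  move=> cb pU mg bg.
  have [rho [D [[_ r1 ir _] _]]] := potential_weight pU ba ltr01.
  have ir' := integrable_scale N measurableT ir.
  apply: (cintegrable_dominated measurableT _ ir').
    apply: complex_measurableM; first exact: complex_measurable_cexp_real.
    by apply: complex_measurableM => //; case: pU.
  move=> y _; rewrite Normc.normcM [normc (U y * g y)]Normc.normcM normc_cexp.
  have h1 : expR (complex.Re (c * y%:C)) <= expR (b * `|y|).
    rewrite ler_expR cReM /= mulr0 subr0 (le_trans (ler_norm _)) // normrM.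
    by rewrite ler_wpM2r.
  apply: (@le_trans _ _ (expR (b * `|y|) * (normc (U y) * (N * expR (b * `|y|))))).
    apply: ler_pM; rewrite ?expR_ge0 ?mulr_ge0 ?normc_ge0 //.
    by rewrite ler_wpM2l ?normc_ge0.
  have -> : expR (2 * b * `|y|) = expR (b * `|y|) * expR (b * `|y|).
    by rewrite -expRD; congr expR; ring.
  set e := expR _.
  rewrite (_ : e * _ = N * (normc (U y) * (e * e) * 1)); last by ring.
  apply: ler_wpM2l => //; apply: ler_wpM2l; last exact: r1.
  by rewrite !mulr_ge0 ?normc_ge0 // expR_ge0.
have mm' : complex_measurable (fun y : R => m (- y)) by exact: complex_measurable_opp.
have bm' x : normc (m (- x)) <= N * expR (b * `|x|).
  by rewrite -normrN; exact: bm.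
have fints := fint s V m (lexx _) pV mm bm.
have fints' : cintegrable setT (fun y => cexp (s * y%:C) * f (- y)).
  exact: (fint s V' _ (lexx _) pV' mm' bm').
have fA y : 0 < y -> f y = V y * (al * jost_mu s A y).
  by move=> y0; rewrite /f /m /glued ltW.
have fB y : 0 < y -> f (- y) = V' y * (be * jost_mu s B y).
  by move=> y0; rewrite /f /m /glued oppr_ge0 leNgt y0 /= opprK.
have mpos : measurable (`]0, +oo[%classic : set (measurableTypeR R)).
  exact: measurable_itv.
(* both integrals over the half-lines reduce to those of jost_data *)
have plusI (c : C) (g : R -> C) (ga : C) (D U : R -> C) (d : C) :
    (forall y, 0 < y -> g y = U y * (ga * jost_mu s D y)) ->
    cintegrable `]0, +oo[ (fun y => cexp (d * y%:C) * (U y * D y)) ->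
    c = d + s ->
    cintegral `]0, +oo[ (fun y => cexp (c * y%:C) * g y) =
    ga * cintegral `]0, +oo[ (fun y => cexp (d * y%:C) * (U y * D y)).
  move=> gE ig ->; rewrite -cintegralZ //; apply: eq_cintegral => y /=.
  rewrite in_itv /= andbT => y0; rewrite gE // /jost_mu.
  rewrite (_ : cexp (d * y%:C) = cexp ((d + s) * y%:C) * cexp (- s * y%:C)).
    by ring.
  by rewrite -cexpD; congr cexp; ring.
have minusI (c : C) (g : R -> C) : complex_measurable g ->
    cintegral `]-oo, 0[ (fun y => cexp (c * y%:C) * g y) =
    cintegral `]0, +oo[ (fun y => cexp (- c * y%:C) * g (- y)).
  move=> mg; rewrite cintegral_opp //; last first.
    by apply: complex_measurableM => //; exact: complex_measurable_cexp_real.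
  rewrite (_ : (-%R : R -> R) @^-1` `]-oo, 0[ = `]0, +oo[%classic).
    by apply: eq_cintegral => y _; rewrite rmorphN /= mulrN -mulNr.
  by rewrite predeqE => y /=; rewrite !in_itv /= oppr_lt0 andbT.
have g0A := jost_g0_integrable pV b0 ba hA 0.
have g1A := jost_g1_integrable pV b0 ba bs hA 0.
have g0B := jost_g0_integrable pV' b0 ba hB 0.
have g1B := jost_g1_integrable pV' b0 ba bs hB 0.
have z0 (U D : R -> C) : (fun y : R => U y * D y) =
    (fun y => cexp (0 * y%:C) * (U y * D y)).
  by apply/funext => y; rewrite mul0r cexp0 mul1r.
rewrite z0 in g0A I0A; rewrite z0 in g0B I0B.
have e0 : s = 0 + s by rewrite add0r.
have e2 : - s = - (2 * s) + s by ring.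
have T1 : cintegral setT (fun y => cexp (s * y%:C) * f y) = - (2 * s * al).
  have h1 := plusI s f al A V 0 fA g0A e0.
  have h2 := plusI (- s) (fun y => f (- y)) be B V' (- (2 * s)) fB g1B e2.
  rewrite -(cintegral_split 0 fints) minusI // h1 h2 I0A I1B.
  transitivity (s * (al * p0) - al * p1 - 2 * s * al
    - s * (be * q0) - be * q1); first by ring.
  by rewrite Ep0 Ep1; ring.
have mf' : complex_measurable (fun y : R => f (- y)).
  exact: complex_measurable_opp.
have fA' y : 0 < y -> f (- - y) = V y * (al * jost_mu s A y).
  by rewrite opprK; exact: fA.
have T2 : cintegral setT (fun y => cexp (s * y%:C) * f (- y)) = - (2 * s * be).
  have h1 := plusI s (fun y => f (- y)) be B V' 0 fB g0B e0.
  have h2 := plusI (- s) (fun y => f (- - y)) al A V (- (2 * s)) fA' g1A e2.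
  rewrite -(cintegral_split 0 fints') (minusI _ _ mf') h1 h2 I0B I1A.
  transitivity (s * (be * q0) - be * q1 - 2 * s * be
    - s * (al * p0) - al * p1); first by ring.
  by rewrite Ep0 Ep1; ring.
exists m; split.
- split => //; have d0 : 0 < 2 * (a - b) by rewrite mulr_gt0 // subr_gt0.
  have [K K0 HK] := expR_Nabs_le d0.
  have sq0 x : 0 <= sqnormc (m x) * expR (- (2 * a * `|x|)).
    by rewrite mulr_ge0 ?expR_ge0 // -sqr_normc_sqnormc sqr_ge0.
  have int : mu.-integrable setT
      (EFin \o (fun x => sqnormc (m x) * expR (- (2 * a * `|x|)))).
    apply: (le_integrable measurableT _ _
      (integrable_scale (N ^+ 2 * K) measurableT (@integrable_inv_oneDsqr R))).
      apply/measurable_EFinP; apply: measurable_funM.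
        exact: measurable_sqnormc.
      apply: measurableT_comp => //; apply: measurable_funN => //.
      exact: measurable_funM.
    move=> x _ /=; rewrite lee_fin ger0_norm // (le_trans _ (ler_norm _)) //.
    rewrite -[leRHS]mulrA -sqr_normc_sqnormc.
    apply: (@le_trans _ _ (N ^+ 2 * expR (- (2 * (a - b) * `|x|)))).
      have -> : N ^+ 2 * expR (- (2 * (a - b) * `|x|)) =
          (N * expR (b * `|x|)) ^+ 2 * expR (- (2 * a * `|x|)).
        rewrite exprMn -[RHS]mulrA -expRM_natl -expRD; congr (_ * expR _); ring.
      rewrite ler_wpM2r ?expR_ge0 // ler_pXn2r ?nnegrE ?normc_ge0 //.
      by rewrite mulr_ge0 ?expR_ge0.
    by rewrite ler_wpM2l ?sqr_ge0.
  case/integrableP: int => _; apply: le_lt_trans; rewrite le_eqVlt.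
  apply/orP; left; apply/eqP; apply: eq_integral => x _ /=.
  by rewrite [in RHS]ger0_norm // sq0.
- have nz (U D : R -> C) (ga : C) : potential a U -> jost_sol U b s D ->
      ga != 0 -> exists X, forall x, X < x -> 0 <= x /\ ga * jost_mu s D x != 0.
    move=> pU hD ga0; have [K [kap [kap0 HK]]] := jost_decay pU b0 ba bs s0 hD.
    have h2 : 0 < 2^-1 :> R by rewrite invr_gt0.
    have [X HX] := exp_decay_small K kap0 h2; exists X => x /HX [x0 h].
    split => //; apply: mulf_neq0 => //; apply: mulf_neq0; first exact: cexp_neq0.
    apply/eqP => Dx; have [+ _] := HK x x0.
    rewrite Dx sub0r normc_opp Normc.normc1 => /le_trans /(_ h).
    by rewrite leNgt invf_lt1 // ltr1n.
  case/orP: albe => [al0|be0] mz.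
    have [X HX] := nz V A al pV hA al0; apply: (not_ae_zero _ mz) => x /HX [x0].
    by rewrite /m /glued x0.
  have [X HX] := nz V' B be pV' hB be0.
  apply: (not_ae_zero (X := Num.max X 0) _ (ae_opp mz)) => x.
  rewrite gt_max => /andP[/HX [_ h] x0].
  by rewrite /m /glued oppr_ge0 leNgt x0 /= opprK.
- apply: ae_mono ae_neq0 => x x0; have [x_gt0|x_lt0|xe] := ltgtP 0 x; last first.
  + by rewrite xe eqxx in x0.
  + have nx : 0 < - x by rewrite oppr_gt0.
    have H := resolvent_half pV' b0 ba bs s0 hB fB fints' T2 nx.
    rewrite {1}/m /glued leNgt x_lt0 /= H /resolventA -/s.
    have swap (c : C) (D D' : set (measurableTypeR R)) : measurable D ->
        (-%R : R -> R) @^-1` D = D' ->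
        cintegral D' (fun y => cexp (c * (y - - x)%:C) * f (- y)) =
        cintegral D (fun y => cexp (- c * (y - x)%:C) * f y).
      move=> mD <-; rewrite [RHS]cintegral_opp //.
        apply: eq_cintegral => y _; congr (cexp _ * _).
        by rewrite !rmorphB !rmorphN /=; ring.
      apply: complex_measurableM => //.
      apply: complex_measurable_cexp; apply: complex_measurableM.
        exact: complex_measurable_cst.
      by apply: complex_measurable_real; exact: measurable_funB.
    rewrite (swap (- s) `]-oo, x[%classic); last 2 first.
    - exact: measurable_itv.
    - by rewrite predeqE => y /=; rewrite !in_itv /= andbT ltrNl.
    rewrite (swap s `]x, +oo[%classic); last 2 first.
    - exact: measurable_itv.
    - by rewrite predeqE => y /=; rewrite !in_itv /= andbT ltrNr.
    by rewrite opprK; ring.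
  + rewrite {1}/m /glued ltW //.
    exact: (resolvent_half pV b0 ba bs s0 hA fA fints T1 x_gt0).
Qed.

End GeneralizedEigenvalue.

Theorem corollary4p2 (R : realType) (a : R) (ha : 0 < a) (V : R -> R[i])
  (hV : in_L2 (fun _ => 1) (fun x => (expR (2 * a * `|x|))%:C * V x)) :
  exists F : R[i] -> R[i],
    [/\ analytic_on (first_sheet R `|` surfaceP a) F,
        forall k, first_sheet R k -> is_Evans V k (F k) &
        forall k, surfaceP a k -> F k = 0 -> is_generalized_eigenvalue a V k ].
Proof.
have pV := potential_in_L2 hV; have pV' := potential_opp pV.
exists (evans a V); split.
- move=> k Uk.
  have [ka k0] : complex.Im k < a /\ k != 0.
    case: Uk => [k0|[k0 /andP[_ ka]]]; last by split.
    split; first exact: lt_trans ha.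
    by apply: contraTneq k0 => ->; rewrite /first_sheet /= ltxx.
  have [d1 d2] := jost_derivable pV ha ka k0.
  have [d1' d2'] := jost_derivable pV' ha ka k0.
  have dM (f g : R[i] -> R[i]) : derivable (f : R[i]^o -> R[i]^o) k 1 ->
      derivable (g : R[i]^o -> R[i]^o) k 1 ->
      derivable ((fun z => f z * g z) : R[i]^o -> R[i]^o) k 1.
    exact: derivableM.
  have dB (f g : R[i] -> R[i]) : derivable (f : R[i]^o -> R[i]^o) k 1 ->
      derivable (g : R[i]^o -> R[i]^o) k 1 ->
      derivable ((fun z => f z - g z) : R[i]^o -> R[i]^o) k 1.
    exact: derivableB.
  have dN (f : R[i] -> R[i]) : derivable (f : R[i]^o -> R[i]^o) k 1 ->
      derivable ((fun z => - f z) : R[i]^o -> R[i]^o) k 1.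
    exact: derivableN.
  have di : derivable ((fun z => 'i%C * z) : R[i]^o -> R[i]^o) k 1.
    by apply: dM; [exact: derivable_cst|exact: derivable_id].
  have dslope (U : R -> R[i]) :
      derivable ((fun z : R[i] => jost_value a U ('i%C * z)) : R[i]^o -> R[i]^o) k 1 ->
      derivable ((fun z : R[i] => volterra U (decay_kernel ('i%C * z))
        (jost a U ('i%C * z)) 0) : R[i]^o -> R[i]^o) k 1 ->
      derivable ((fun z : R[i] => jost_slope a U ('i%C * z)) : R[i]^o -> R[i]^o) k 1.
    by move=> e1 e2; exact: (dB _ _ (dN _ e2) (dM _ _ di e1)).
  exact: (dB _ _ (dN _ (dM _ _ d1 (dslope _ d1' d2'))) (dM _ _ (dslope _ d1 d2) d1')).
- move=> k k0; have := tame_evans k0 (jost_tame pV ha k0) (jost_tame pV' ha k0).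
  congr (is_Evans V k _).
  by rewrite 2!jost_mu_at0 2!jost_mu'_at0.
- move=> k; exact: evans_zero_eigenvalue.
Qed.
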